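(* Let $X_1,X_2,\ldots$ be the growing sequence of random binary search trees defined in the context, on a probability space $(\Omega,\mathcal F,\mathbb P)$; let $\mathrm{EPL}_n$ be the external path length of $X_n$ and $\mathcal G_n=\sigma(X_1,\dots,X_n)$. Let $\mathrm{EPL}_\infty$ be the almost sure limit of $\frac{\mathrm{EPL}_n-2n\log n}{n}$ as $n\to\infty$ (this limit exists). Then $$\mathcal L\left\{\sqrt{\frac{n}{2\log n}}\left(\mathrm{EPL}_\infty-\frac{\mathrm{EPL}_n-2n\log n}{n}\right)\Bigg|\,\mathcal G_n\right\}$$ converges, as $n\to\infty$, in the almost sure weak sense to the constant kernel $\omega\mapsto\mathcal N_{0,1}$; that is, for $\mathbb P$-almost every $\omega$ these conditional distributions converge weakly on $\mathbb R$ to the standard normal distribution $\mathcal N_{0,1}$.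
   Context: Let $\mathbb V=\bigcup_{k\ge0}\{0,1\}^k$ be the set of finite words over $\{0,1\}$ (including the empty word $\emptyset$), viewed as the nodes of the infinite binary tree with root $\emptyset$; a word of length $k$ has depth $k$. A binary tree is a non-empty finite subset $X\subset\mathbb V$ which together with each node $(\varepsilon_1,\dots,\varepsilon_k)\ne\emptyset$ contains its predecessor $(\varepsilon_1,\dots,\varepsilon_{k-1})$. The external nodes of $X$ are the nodes $(\varepsilon_1,\dots,\varepsilon_k)\in\mathbb V\setminus X$ with $(\varepsilon_1,\dots,\varepsilon_{k-1})\in X$; a binary tree with $n$ nodes has $n+1$ external nodes. Random binary search trees: $X_1=\{\emptyset\}$; given $X_1,\dots,X_n$, choose one of the $n+1$ external nodes of $X_n$ uniformly at random and add it to the tree to obtain $X_{n+1}$. The external path length $\mathrm{EPL}_n$ is the sum of the depths of all $n+1$ external nodes of $X_n$. $\mathcal L\{X\mid\mathcal G\}$ denotes a (regular) version of the conditional distribution of the real random variable $X$ given the $\sigma$-algebra $\mathcal G$, viewed as a random probability measure on $\mathbb R$. The formula is considered for $n\ge2$. *)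

(* Defs.v *)
From HB Require Import structures.
From mathcomp Require Import all_boot all_order all_algebra finmap.
From mathcomp Require Import all_classical all_reals all_analysis.

Set Implicit Arguments.
Unset Strict Implicit.
Unset Printing Implicit Defensive.

Import Order.TTheory GRing.Theory Num.Theory.
Import numFieldNormedType.Exports.

Local Open Scope classical_set_scope.
Local Open Scope ring_scope.

(* The word (e_1, ..., e_k) is [:: e_1; ...; e_k]: its depth is its [size], and
   the predecessor of [rcons u b] is [u]. *)
Notation word := (seq bool).

Definition is_btree (t : {fset word}) : Prop :=
  t != fset0%fset /\ forall (u : word) (b : bool), rcons u b \in t -> u \in t.

Definition external (t : {fset word}) : {fset word} :=
  ([fset rcons u b | u in t, b in [:: false; true]] `\` t)%fset.

Definition EPL (t : {fset word}) : nat := \sum_(v <- external t) size v.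

(* Sets of words carry the discrete sigma-algebra. [X 0] is irrelevant: the
   process is indexed by n >= 1. The last field says that, conditionally on
   X_1, ..., X_n, the tree X_(n+1) is X_n enlarged by an external node chosen
   uniformly among the #|external X_n| = n + 1 ones; elementary conditioning is
   enough since there are countably many trees. *)
Record is_rbst d (T : measurableType d) (R : realType) (P : probability T R)
    (X : nat -> T -> {fset word}) : Prop := {
  rbst_measurable : forall n (B : set {fset word}), (1 <= n)%N ->
    measurable (X n @^-1` B) ;
  rbst_btree : forall n w, (1 <= n)%N -> is_btree (X n w) ;
  rbst_init : forall w, X 1%N w = [fset [::]]%fset ;
  rbst_step : forall n (t : nat -> {fset word}) (v : word), (1 <= n)%N ->
    v \in external (t n) ->
    P [set w | (forall k, (1 <= k <= n)%N -> X k w = t k) /\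
               X n.+1 w = (v |` t n)%fset] =
    (P [set w | forall k, (1 <= k <= n)%N -> X k w = t k] *
     (#|` external (t n)|%:R^-1)%:E)%E
}.

(* A generating family of the sigma-algebra sigma(X_1, ..., X_n). *)
Definition history T (X : nat -> T -> {fset word}) (n : nat) : set (set T) :=
  [set A | exists k (B : set {fset word}),
    (1 <= k <= n)%N /\ A = X k @^-1` B].

Definition EPL_scaled (R : realType) T (X : nat -> T -> {fset word})
    (n : nat) (w : T) : R :=
  ((EPL (X n w))%:R - 2 * n%:R * ln n%:R) / n%:R.

(* [k] is a regular version of the conditional distribution of [Z] given <<s G>>;
   the <<s G>>-measurability of w |-> k w B is part of the kernel type. *)
Definition is_regular_cond_distr d (T : measurableType d) (R : realType)
    (P : probability T R) (G : set (set T)) (Z : T -> R)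
    (k : R.-pker (g_sigma_algebraType G) ~> measurableTypeR R) : Prop :=
  forall (A : set T) (B : set (measurableTypeR R)),
    <<s G >> A -> measurable B ->
    (\int[P]_(w in A) k w B = P (A `&` Z @^-1` B))%E.

Definition weak_cvg (R : realType)
    (mu : nat -> {measure set (measurableTypeR R) -> \bar R})
    (nu : {measure set (measurableTypeR R) -> \bar R}) : Prop :=
  forall f : R -> R, continuous f -> bounded_fun f ->
    (\int[mu n]_x (f x)%:E)%E @[n --> \oo] --> (\int[nu]_x (f x)%:E)%E.

(* Main.v *)
Require Import Defs.
From HB Require Import structures.
From mathcomp Require Import all_boot all_order all_algebra finmap.
From mathcomp Require Import all_classical all_reals all_analysis.
From mathcomp Require Import measurable_realfun ring lra.

(** Call external nodes leaves and let p = n+1 be their number. Adding the next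
    node at a leaf of depth k raises the external path length by k + 2, so the
    mean leaf depth grows by (y + 2) / (p + 1), where y is the depth of the chosen
    leaf minus the mean. Hence [mart], the mean leaf depth minus 2 H_p (H_p the
    harmonic number), is a martingale with increments y / (p + 1). By
    [harm_ln_limit] and [EPL_scaled_mart_cvg] it differs from [EPL_scaled] by a
    constant 2 gamma up to O(n^(-1/2)), so its limit is EPLoo - 2 gamma, and the
    rescaled variable is, up to a vanishing offset, the sum of all increments
    after time n, multiplied by [norming] n.

    The conditional variance of an increment is the variance of the leaf depths
    over (p + 1)^2. The difference between variance and mean of the leaf depths
    ([spread]) stays bounded along almost every path, so this variance is 2 H_p +
    O(1) and the future increments have total variance close to [varrest] = 2 H_p
    / p, which is equivalent to 2 (log n) / n. The central limit theorem is then
    proved by Lindeberg's replacement: [smoothed] evaluates a test function as if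
    the remaining fluctuation were exactly normal with variance [varrest]. By a
    third order Taylor expansion and the semigroup property [heat_add], one step
    of the tree changes [smoothed] in mean by at most the mean decrease of an
    explicit supermartingale [lindeberg_bound] ([step_smoothed]); summing over all
    future steps gives [conditional_lindeberg]. The error involves the potentials
    [energy], [decayW] and [growthW], built from squares of [spread] and [mart]
    and from the exponential moment [expmean] of the leaf depths, which controls
    all needed moments. Along almost every path they are bounded by a maximal
    inequality for nonnegative supermartingales ([ever_exceeds_bound]), whence the
    error tends to 0 ([lindeberg_bound_cvg]) and the normal approximation tends to
    the standard normal law ([heat_norming_cvg]).

    Two reductions make the argument elementary. There are finitely many histories
    of positive probability of each length, and any regular version of the
    conditional law coincides on such a history with the elementary conditional
    law ([regular_cond_integral]); so no further null set depends on the version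
    or on the test function. And convergence against nonnegative test functions
    with a uniform third order Taylor expansion implies weak convergence
    ([weak_cvg_smooth]). *)

Set Implicit Arguments.
Unset Strict Implicit.
Unset Printing Implicit Defensive.

Import Order.TTheory GRing.Theory Num.Theory.
Import numFieldNormedType.Exports.

Local Open Scope classical_set_scope.
Local Open Scope ring_scope.

(** * Gaussian integrals *)

Section Gaussian.
Context {R : realType}.
Local Notation mu := (@lebesgue_measure R).
Local Notation gauss := (@normal_prob R 0 1).
Local Notation phi := (@normal_pdf R 0 1).

(** The normal law is only given as a measure with a Radon-Nikodym derivative,
    which is identified here with the explicit density almost everywhere. *)
Lemma ge0_integral_gauss (f : R -> \bar R) : measurable_fun setT f ->
  (forall x, 0 <= f x)%E ->
  (\int[gauss]_x f x = \int[mu]_x (f x * (phi x)%:E))%E.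
Proof.
move=> mf f0.
have dom := normal_prob_dominates (0 : R) 1.
rewrite -(@Radon_Nikodym_SigmaFinite.change_of_variables _ _ _ _ mu dom f setT f0)//.
have ig := Radon_Nikodym_SigmaFinite.f_integrable dom.
have mphi : measurable_fun setT (EFin \o phi).
  by apply/measurable_EFinP; exact: measurable_normal_pdf.
apply: ae_eq_integral => //.
- by apply: emeasurable_funM => //; exact: measurable_int ig.
- exact: emeasurable_funM.
- apply: ae_eqe_mul2l => /=.
  apply: (integral_ae_eq measurableT ig) => // E _ mE.
  by rewrite -Radon_Nikodym_SigmaFinite.f_integral.
Qed.

Lemma normal_pdf1E (m s x : R) : 0 < s -> normal_pdf m s x =
  phi ((x - m) / s) / s.
Proof.
move=> s0; rewrite !normal_pdfE ?gt_eqF// /normal_peak /normal_fun subr0.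
rewrite -[s ^+ 2 * pi *+ 2]mulrnAr.
rewrite sqrtrM ?sqr_ge0// sqrtr_sqr gtr0_norm// invfM expr1n mul1r.
have -> : - (x - m) ^+ 2 / (s ^+ 2 *+ 2) = - ((x - m) / s) ^+ 2 / (1 *+ 2).
  by field; rewrite gt_eqF.
by rewrite [RHS]mulrC mulrA.
Qed.

(** Substitution u = x + s z. Nonnegative integrands are used so that no
    integrability has to be known beforehand. *)
Lemma ge0_integral_gauss_affine (f : R -> R) (x s : R) : 0 < s ->
  continuous f -> (forall x, 0 <= f x) ->
  (\int[gauss]_z (f (x + s * z))%:E =
   \int[mu]_u (f u * normal_pdf x s u)%:E)%E.
Proof.
move=> s0 cf f0.
have s00 : s != 0 by rewrite gt_eqF.
rewrite ge0_integral_gauss; last 2 first.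
- apply/measurable_EFinP; apply: measurableT_comp; first exact: continuous_measurable_fun.
  by apply: measurable_funD => //; exact: measurable_funM.
- by move=> z; rewrite lee_fin.
pose F := fun u : R => (u - x) / s.
pose G := fun z : R => f (x + s * z) * phi z.
under eq_integral do rewrite -EFinM.
have dF (u : R) : is_derive u (1:R) F s^-1.
  rewrite /F; apply: is_derive_eq.
  by rewrite subr0 scaler0 add0r /GRing.scale/= mulr1.
have F'E : F^`()%classic = cst s^-1.
  by apply/funext => u; rewrite derive1E derive_val.
rewrite -[LHS]/(\int[mu]_z (G z)%:E)%E.
rewrite (@increasing_ge0_integration_by_substitutionT _ F G).
- apply: eq_integral => u _; rewrite F'E /G /F/= normal_pdf1E// mulrA.
  congr ((f _ * _ * _)%:E); field; exact: s00.
- by move=> u v uv; rewrite /F ltr_pM2r ?invr_gt0// ltrD2r.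
- by rewrite F'E => ?; exact: cvg_cst.
- by rewrite F'E; exact: is_cvg_cst.
- by rewrite F'E; exact: is_cvg_cst.
- by move=> u; have [] := dF u.
- apply/gt0_cvgMlNy; [by rewrite invr_gt0|exact: cvg_addrr_Ny].
- apply/gt0_cvgMly; [by rewrite invr_gt0|exact: cvg_addrr].
- move=> z; apply: cvgM; last by apply: continuous_normal_pdf; rewrite oner_eq0.
  apply: (cvg_comp (fun z => x + s * z) f); last exact: cf.
  by apply: cvgD; [exact: cvg_cst|apply: cvgM; [exact: cvg_cst|exact: cvg_id]].
- by move=> z; rewrite mulr_ge0// normal_pdf_ge0.
Qed.

End Gaussian.

(** * Moments of the standard normal law *)

Section GaussianMoments.
Context {R : realType}.
Local Notation mu := (@lebesgue_measure R).
Local Notation gauss := (@normal_prob R 0 1).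
Local Notation phi := (@normal_pdf R 0 1).

Lemma phiE (x : R) : phi x = normal_peak 1 * expR (- (x ^+ 2 / 2)).
Proof. by rewrite normal_pdfE ?oner_eq0// /normal_fun subr0 expr1n mulNr. Qed.

Lemma is_derive_phi (x : R) : is_derive x (1 : R) phi (- x * phi x).
Proof.
have -> : phi = fun z : R => normal_peak 1 * expR (- (z ^+ 2 / 2)).
  by apply/funext => z; rewrite phiE.
apply: is_derive_eq.
rewrite !scaler0 ?addr0 ?add0r /GRing.scale/=.
by rewrite ?expr1 ?mulr1; move: (expR _) (normal_peak _) => e p; field.
Qed.

(** Since exp (x^2 / 2) >= x^4 / 8, the density beats every quadratic polynomial;
    this kills the boundary terms at infinity in the integrations by parts below. *)
Lemma phi_sq_bound (x : R) : 1 <= x -> (x ^+ 2 + 2 + x) * phi x <= 32 * normal_peak 1 / x.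
Proof.
move=> x1; have x0 : 0 < x by lra.
have h : x ^+ 4 / 8 <= expR (x ^+ 2 / 2).
  apply: le_trans (expR_ge1Dxn 1%N _); last by rewrite divr_ge0// sqr_ge0.
  have -> : (x ^+ 2 / 2) ^+ 2 / 2`!%:R = x ^+ 4 / 8 by rewrite -[2`!]/2%N; field.
  lra.
have e0 : 0 < expR (x ^+ 2 / 2) by exact: expR_gt0.
rewrite phiE expRN mulrCA -[leRHS]mulrA [leRHS]mulrCA ler_wpM2l ?normal_peak_ge0//.
rewrite ler_pdivrMr// mulrAC ler_pdivlMr//.
apply: le_trans (_ : 32 * (x ^+ 4 / 8) <= _); last by rewrite ler_wpM2l.
rewrite -subr_ge0.
have -> : 32 * (x ^+ 4 / 8) - (x ^+ 2 + 2 + x) * x = x * ((x ^+ 2 * (x - 1)) + 2 * (x ^+ 3 - 1) + x * (x ^+2 - 1)).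
  by field.
apply: mulr_ge0; first exact: ltW.
by rewrite !addr_ge0 ?mulr_ge0 ?sqr_ge0 ?subr_ge0 ?exprn_ege1 ?(ltW x0).
Qed.

Lemma ge0_integralT_fold (G : R -> R) : (forall x, 0 <= G x) -> continuous G ->
  (\int[mu]_x (G x)%:E =
   \int[mu]_(x in `[0%R, +oo[) (G x)%:E + \int[mu]_(x in `[0%R, +oo[) (G (- x))%:E)%E.
Proof.
move=> f0 cf.
have mf : measurable_fun [set: R] G by exact: continuous_measurable_fun.
have mposnums : measurable [set x : R | 0 <= x]%R by rewrite -set_itvcy.
rewrite -(setUv [set x : R | 0 <= x]%R) ge0_integral_setU//= ; last 4 first.
  exact: measurableC.
  by apply/measurable_EFinP; rewrite setUv.
  by move=> x _; rewrite lee_fin.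
  exact/disj_setPCl.
rewrite -set_itvcy// setCitvr; congr +%E.
rewrite integral_itv_bndo_bndc; last exact/measurable_EFinP/measurable_funTS.
rewrite -{1}oppr0 ge0_integration_by_substitutionNy//.
exact: continuous_subspaceT.
Qed.

Lemma continuous_phi : continuous phi.
Proof. by apply: continuous_normal_pdf; rewrite oner_eq0. Qed.

Lemma phiN (x : R) : phi (- x) = phi x.
Proof. by rewrite !phiE sqrrN. Qed.

Lemma integral_gauss_fold (f : R -> R) : (forall x, 0 <= f x) -> continuous f ->
  (\int[gauss]_x (f x)%:E =
   \int[mu]_(x in `[0%R, +oo[) (f x * phi x)%:E
   + \int[mu]_(x in `[0%R, +oo[) (f (- x) * phi x)%:E)%E.
Proof.
move=> f0 cf; rewrite ge0_integral_gauss; last 2 first.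
- by apply/measurable_EFinP; exact: continuous_measurable_fun.
- by move=> z; rewrite lee_fin.
rewrite (@ge0_integralT_fold (fun x => f x * phi x)).
- by congr +%E; apply: eq_integral => x _; rewrite phiN.
- by move=> x; rewrite mulr_ge0 ?normal_pdf_ge0.
- by move=> x; apply: cvgM; [exact: cf|exact: continuous_phi].
Qed.

Lemma integral_gaussN (f : R -> R) : (forall x, 0 <= f x) -> continuous f ->
  (\int[gauss]_x (f (- x))%:E = \int[gauss]_x (f x)%:E)%E.
Proof.
move=> f0 cf; rewrite (integral_gauss_fold f0 cf).
rewrite (@integral_gauss_fold (fun x => f (- x)))// 1?addeC.
  by under [X in (X + _)%E]eq_integral do rewrite opprK.
by move=> x; apply: continuous_comp; [exact: opp_continuous|exact: cf].
Qed.

(** Both |z|^3 and |z|^3 + 1 - z^2 are nonnegative and have, against the density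
    on the positive half-line, the explicit primitives (- z^2 - 2) phi and (- z^2
    - 2 + z) phi. Both integrate to 4 phi 0, so subtracting them yields the second
    moment without an integrability argument for z^2. *)
Let fc (c : bool) (z : R) : R := `|z| ^+ 3 + c%:R * (1 - z ^+ 2).

Let fc_ge0 c z : 0 <= fc c z.
Proof.
rewrite /fc -[z ^+ 2]real_normK ?num_real//.
have := normr_ge0 z; move: (`|z|) => y y0.
case: c; rewrite ?mul0r ?addr0 ?exprn_ge0// mul1r.
have [y1|/ltW y1] := leP 1 y.
  rewrite (_ : _ + _ = y ^+ 2 * (y - 1) + 1); last by ring.
  by rewrite addr_ge0// mulr_ge0 ?exprn_ge0 ?subr_ge0.
by rewrite addr_ge0 ?exprn_ge0// subr_ge0 exprn_ile1.
Qed.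

Let fc_cont c : continuous (fc c).
Proof.
move=> z; apply: cvgD.
  apply: (cvg_comp (fun z => `|z|) (fun x => x ^+ 3)); last exact: exprn_continuous.
  exact: norm_continuous.
apply: cvgM; first exact: cvg_cst.
by apply: cvgB; [exact: cvg_cst|exact: exprn_continuous].
Qed.

Let gauss_fc c : (\int[gauss]_x (fc c x)%:E = (4 * phi 0)%:E)%E.
Proof.
rewrite integral_gauss_fold//.
have -> : (\int[mu]_(x in `[0%R, +oo[) (fc c (- x) * phi x)%:E =
           \int[mu]_(x in `[0%R, +oo[) (fc c x * phi x)%:E)%E.
  by apply: eq_integral => x _; rewrite /fc normrN sqrrN.
pose F (x : R) := (- (x ^+ 2) - 2 + c%:R * x) * phi x.
have dF (x : R) : is_derive x (1 : R) F ((x ^+ 3 + c%:R * (1 - x ^+ 2)) * phi x).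
  rewrite /F; have := is_derive_phi x => ?.
  apply: is_derive_eq.
  by rewrite /GRing.scale/= ?expr1; move: (phi x) => p; ring.
rewrite (@ge0_continuous_FTC2y _ (fun x => fc c x * phi x) F 0 0).
- by rewrite -!EFinB -EFinD /F; congr EFin; rewrite expr0n/= mulr0; ring.
- by move=> x _; rewrite mulr_ge0// normal_pdf_ge0.
- apply: continuous_subspaceT => x.
  by apply: cvgM; [exact: fc_cont|exact: continuous_phi].
- apply: norm_cvg0.
  apply: (@squeeze_cvgr _ _ _ _ (cst 0) (fun x : R => 32 * normal_peak 1 / x)).
  + near=> x; rewrite normr_ge0/=.
    have x1 : 1 <= x by near: x; exact: nbhs_pinfty_ge.
    apply: le_trans (phi_sq_bound x1).
    rewrite /F normrM (ger0_norm (normal_pdf_ge0 _ _ _)) ler_wpM2r ?normal_pdf_ge0//.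
    have x2 := sqr_ge0 x.
    by case: c {dF F}; rewrite /= ?mul0r ?mul1r ler_norml; apply/andP; split; lra.
  + exact: cvg_cst.
  + rewrite -[X in _ --> X](mulr0 (32 * normal_peak 1 : R)).
    apply: cvgM; first exact: cvg_cst.
    apply/gtr0_cvgV0; [exact: nbhs_pinfty_gt|exact: cvg_id].
- by move=> x _; have [] := dF x.
- apply: cvg_at_right_filter.
  apply: differentiable_continuous.
  by apply/derivable1_diffP; have [] := dF 0.
- move=> x; rewrite in_itv/= andbT => x0.
  by rewrite derive1E derive_val /fc gtr0_norm.
Unshelve. all: by end_near. Qed.

Let fcF : fc false = fun z => `|z| ^+ 3.
Proof. by apply/funext => z; rewrite /fc mul0r addr0. Qed.

Let fcT : fc true = fun z => `|z| ^+ 3 + (1 - z ^+ 2).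
Proof. by apply/funext => z; rewrite /fc mul1r. Qed.

Lemma gauss_integrable_abs3 : gauss.-integrable setT (fun z => (`|z| ^+ 3)%:E).
Proof.
apply/integrableP; split.
  apply/measurable_EFinP; apply: continuous_measurable_fun => z.
  apply: (cvg_comp (fun z => `|z|) (fun x => x ^+ 3)); last exact: exprn_continuous.
  exact: norm_continuous.
under eq_integral do rewrite gee0_abs ?lee_fin ?exprn_ge0//.
have := gauss_fc false; rewrite fcF => ->.
by rewrite ltry.
Qed.

Lemma gauss_integrable_le3 (f : R -> R) (K : R) : measurable_fun setT f ->
  (forall z, `|f z| <= K * (1 + `|z| ^+ 3)) ->
  gauss.-integrable setT (EFin \o f).
Proof.
move=> mf fK.
apply: (@le_integrable _ _ _ gauss setT measurableT (EFin \o f) (fun z : R => (K * (1 + `|z| ^+ 3))%:E)).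
- exact/measurable_EFinP.
- by move=> z _; rewrite !abse_EFin lee_fin (le_trans (fK z))// ler_norm.
- under eq_fun do rewrite EFinM.
  apply: integrableZl => //.
  under eq_fun do rewrite EFinD.
  apply: integrableD => //; last exact: gauss_integrable_abs3.
  by apply: finite_measure_integrable_cst.
Qed.

(** The positive and negative parts of z are exchanged by the symmetry z -> - z. *)
Lemma gauss_mean : \int[gauss]_z z = 0.
Proof.
have cp : continuous (fun z : R => Num.max z 0).
  move=> z; apply: continuous_max; [exact: cvg_id|exact: cvg_cst].
have mp : measurable_fun setT (fun z : R => Num.max z 0) by exact: continuous_measurable_fun.
have i0 : gauss.-integrable setT (EFin \o (fun z : R => Num.max z 0)).
  apply: (@gauss_integrable_le3 _ 1) => // z; rewrite mul1r.
  have := normr_ge0 z; have := ler_norm z; move: (`|z|) => y zy y0.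
  have y3 : y <= 1 + y ^+ 3.
    have [y1|/ltW y1] := leP 1 y; last by rewrite ler_wpDr// exprn_ge0.
    by rewrite ler_wpDl// exprS ler_peMr// exprn_ege1.
  rewrite ger0_norm ?le_max ?lexx ?orbT// ge_max (le_trans zy y3)/=.
  exact: le_trans y0 y3.
have i1 : gauss.-integrable setT (EFin \o (fun z : R => Num.max (- z) 0)).
  apply/integrableP; split.
    apply/measurable_EFinP; apply: (measurableT_comp mp).
    exact: continuous_measurable_fun opp_continuous.
  have /integrableP[_] := i0.
  under eq_integral do rewrite gee0_abs ?lee_fin ?le_max ?lexx ?orbT//.
  under [X in _ -> (X < _)%E]eq_integral do rewrite gee0_abs ?lee_fin ?le_max ?lexx ?orbT//.
  rewrite (@integral_gaussN (fun z => Num.max z 0))// => z.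
  by rewrite le_max lexx orbT.
have -> : \int[gauss]_z z = \int[gauss]_z (Num.max z 0) - \int[gauss]_z (Num.max (- z) 0).
  rewrite -RintegralB//; apply: eq_Rintegral => z _.
  by have [z0|z0] := leP z 0; have [z1|z1] := leP (- z) 0; lra.
by rewrite /Rintegral (@integral_gaussN (fun z => Num.max z 0)) ?subrr// => z; rewrite le_max lexx orbT.
Qed.

Lemma gauss_integrable_sqr : gauss.-integrable setT (fun z : R => (z ^+ 2)%:E).
Proof.
apply: (@gauss_integrable_le3 (fun z => z ^+ 2) 1).
  by apply: continuous_measurable_fun; exact: exprn_continuous.
move=> z; rewrite mul1r normrX; have := normr_ge0 z; move: (`|z|) => y y0.
have [y1|/ltW y1] := leP 1 y; last by rewrite ler_wpDr ?exprn_ge0 ?exprn_ile1.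
by rewrite ler_wpDl// [leRHS]exprS ler_peMl ?exprn_ge0.
Qed.

Lemma gauss_var : \int[gauss]_z (z ^+ 2) = 1.
Proof.
have f1 : \int[gauss]_z (fc true z) = 4 * phi 0 by rewrite /Rintegral gauss_fc.
have : \int[gauss]_z (fc false z) = 4 * phi 0 by rewrite /Rintegral gauss_fc.
have i2 := gauss_integrable_sqr.
have ic : gauss.-integrable setT (EFin \o cst (1 : R)).
  exact: finite_measure_integrable_cst.
have i12 : gauss.-integrable setT (EFin \o (fun z : R => 1 - z ^+ 2)).
  under [X in integrable _ _ X]funext do rewrite /= EFinB.
  exact: integrableB.
rewrite -f1 fcF fcT.
rewrite RintegralD//; last exact: gauss_integrable_abs3.
rewrite RintegralB// Rintegral_cst// => /eqP.
rewrite mul1r.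
have -> : fine (gauss [set: R]) = 1 by rewrite probability_setT.
by rewrite -subr_eq0 opprD addrA subrr sub0r oppr_eq0 subr_eq0 => /eqP.
Qed.

End GaussianMoments.

(** * The heat semigroup on smooth test functions *)

Section HeatSemigroup.
Context {R : realType}.
Local Notation gauss := (@normal_prob R 0 1).

(** One constant bounds both the function and its Lipschitz constant: only its
    existence matters, and the heat semigroup preserves it. *)
Definition bdd_lip (K : R) (f : R -> R) :=
  (forall x, `|f x| <= K) /\ (forall x y, `|f x - f y| <= K * `|x - y|).

(** Expectation of f at x plus a centred normal variable of variance r. *)
Definition heat (r : R) (f : R -> R) (x : R) : R :=
  \int[gauss]_z f (x + Num.sqrt r * z).

(** The Taylor estimate stands for a bound on the third derivative; being an
    inequality between values, it survives averaging over a Gaussian shift. *)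
Record smooth3 (K : R) (g g1 g2 : R -> R) : Prop := {
  smooth3_0 : bdd_lip K g;
  smooth3_1 : bdd_lip K g1;
  smooth3_2 : bdd_lip K g2;
  smooth3_taylor : forall x y,
    `|g (x + y) - g x - g1 x * y - g2 x * y ^+ 2 / 2| <= K * `|y| ^+ 3 }.

Lemma bdd_lip_ge0 K f : bdd_lip K f -> 0 <= K.
Proof. by move=> [fK _]; exact: le_trans (fK 0). Qed.

Lemma bdd_lip_continuous K f : bdd_lip K f -> continuous f.
Proof.
move=> fK x; have K0 := bdd_lip_ge0 fK; case: fK => _ fK.
have K1 : 0 < K + 1 by lra.
apply/cvgrPdist_le => /= e e0; near=> y.
apply: le_trans (fK _ _) _.
apply: le_trans (_ : (K + 1) * `|x - y| <= _); first by rewrite ler_wpM2r//; lra.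
rewrite mulrC -ler_pdivlMr//; near: y.
have /cvgrPdist_le : y @[y --> x] --> x by exact: cvg_id.
by apply; rewrite divr_gt0.
Unshelve. all: by end_near. Qed.

Lemma continuous_affine (f : R -> R) (x s : R) : continuous f ->
  continuous (fun z => f (x + s * z)).
Proof.
move=> cf z; apply: (cvg_comp (fun z => x + s * z) f); last exact: cf.
by apply: cvgD; [exact: cvg_cst|apply: cvgM; [exact: cvg_cst|exact: cvg_id]].
Qed.

Lemma gauss_integrable_bdd (K : R) (f : R -> R) : continuous f ->
  (forall x, `|f x| <= K) -> gauss.-integrable setT (EFin \o f).
Proof.
move=> cf fK; apply: (@gauss_integrable_le3 _ _ K).
  exact: continuous_measurable_fun.
move=> z; apply: le_trans (fK z) _; rewrite ler_peMr ?lerDl ?exprn_ge0//.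
exact: le_trans (fK 0).
Qed.

Lemma heat_integrable K f (x s : R) : bdd_lip K f ->
  gauss.-integrable setT (EFin \o (fun z => f (x + s * z))).
Proof.
move=> fK; apply: (@gauss_integrable_bdd K).
  by apply: continuous_affine; exact: bdd_lip_continuous fK.
by move=> z; case: fK.
Qed.

Lemma gauss_cst (c : R) : \int[gauss]_z c = c.
Proof.
rewrite Rintegral_cst//.
have -> : fine (gauss [set: R]) = 1 by rewrite probability_setT.
by rewrite mulr1.
Qed.

Lemma gauss_norm_le (f h : R -> R) :
  gauss.-integrable setT (EFin \o f) -> gauss.-integrable setT (EFin \o h) ->
  (forall z, `|f z| <= h z) -> `|\int[gauss]_z f z| <= \int[gauss]_z h z.
Proof.
move=> fi hi fh; apply: le_trans (le_normr_Rintegral _ fi) _ => //.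
by apply: le_Rintegral => //; exact: integrable_norm.
Qed.

Lemma gauss_norm_le_cst (f : R -> R) (c : R) :
  gauss.-integrable setT (EFin \o f) ->
  (forall z, `|f z| <= c) -> `|\int[gauss]_z f z| <= c.
Proof.
move=> fi fc; rewrite -[leRHS]gauss_cst; apply: gauss_norm_le => //.
exact: (@finite_measure_integrable_cst _ _ _ gauss setT c).
Qed.

(** Linearity packed for three summands, so that the Taylor remainders below can
    be written as one integral and bounded pointwise. *)
Lemma gauss_lin3 (c1 c2 c3 : R) (f1 f2 f3 : R -> R) :
  gauss.-integrable setT (EFin \o f1) -> gauss.-integrable setT (EFin \o f2) ->
  gauss.-integrable setT (EFin \o f3) ->
  gauss.-integrable setT (EFin \o (fun z => c1 * f1 z + c2 * f2 z + c3 * f3 z)) /\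
  \int[gauss]_z (c1 * f1 z + c2 * f2 z + c3 * f3 z) =
  c1 * \int[gauss]_z f1 z + c2 * \int[gauss]_z f2 z + c3 * \int[gauss]_z f3 z.
Proof.
move=> i1 i2 i3.
have iZ (c : R) f : gauss.-integrable setT (EFin \o f) ->
    gauss.-integrable setT (EFin \o (fun z => c * f z)).
  by move=> fi; under [X in integrable _ _ X]funext do rewrite /= EFinM; exact: integrableZl.
have iD (f g : R -> R) : gauss.-integrable setT (EFin \o f) -> gauss.-integrable setT (EFin \o g) ->
    gauss.-integrable setT (EFin \o (fun z => f z + g z)).
  by move=> fi gi; under [X in integrable _ _ X]funext do rewrite /= EFinD; exact: integrableD.
split; first by apply: (iD (fun z => _ + _)); [apply: iD|]; exact: iZ.
rewrite RintegralD//; [|by apply: iD; exact: iZ|exact: iZ].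
by rewrite RintegralD//; [|exact: iZ|exact: iZ]; rewrite !RintegralZl.
Qed.

Lemma bdd_lip_heat K f r : bdd_lip K f -> bdd_lip K (heat r f).
Proof.
move=> fK; have fi x := @heat_integrable K f x (Num.sqrt r) fK.
have K0 := bdd_lip_ge0 fK.
have ic (c : R) : gauss.-integrable setT (EFin \o cst c).
  exact: finite_measure_integrable_cst.
case: fK => fK fL; split=> [x|x y].
  by rewrite /heat; apply: gauss_norm_le_cst; first exact: fi.
have [j1 e1] := gauss_lin3 1 (-1) 0 (fi x) (fi y) (ic 1).
rewrite (_ : _ - _ = \int[gauss]_z (1 * f (x + Num.sqrt r * z) + -1 * f (y + Num.sqrt r * z) + 0 * 1)).
  apply: gauss_norm_le_cst => // z.
  rewrite mul1r mulN1r mul0r addr0; apply: le_trans (fL _ _) _.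
  by rewrite opprD addrACA subrr addr0.
by rewrite e1 /heat; ring.
Qed.

(** Averaging over a Gaussian shift commutes with translations and with linear
    combinations, so every bound passes to the average. *)
Lemma smooth3_heat K g g1 g2 r : smooth3 K g g1 g2 ->
  smooth3 K (heat r g) (heat r g1) (heat r g2).
Proof.
move=> [g0 gd1 gd2 gT]; split; [exact: bdd_lip_heat..|] => x y.
have i0 u := @heat_integrable K g u (Num.sqrt r) g0.
have i1 u := @heat_integrable K g1 u (Num.sqrt r) gd1.
have i2 u := @heat_integrable K g2 u (Num.sqrt r) gd2.
have [j1 e1] := gauss_lin3 1 (-1) (- y) (i0 (x + y)) (i0 x) (i1 x).
have [j2 e2] := gauss_lin3 1 (- (y ^+ 2 / 2)) 0 j1 (i2 x) (i2 x).
rewrite (_ : _ - _ = \int[gauss]_z (1 * (1 * g (x + y + Num.sqrt r * z) + -1 * g (x + Num.sqrt r * z) +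
         - y * g1 (x + Num.sqrt r * z)) + - (y ^+ 2 / 2) * g2 (x + Num.sqrt r * z) + 0 * g2 (x + Num.sqrt r * z))); last first.
  by rewrite e2 e1 /heat; ring.
apply: gauss_norm_le_cst => // z; have := gT (x + Num.sqrt r * z) y.
rewrite (addrAC x); congr (`|_| <= _); ring.
Qed.

Definition gauss_abs3 : R := \int[gauss]_z (`|z| ^+ 3).

Lemma gauss_abs3_ge0 : 0 <= gauss_abs3.
Proof. by apply: Rintegral_ge0 => z _; rewrite exprn_ge0. Qed.

Lemma gauss_integrable_id : gauss.-integrable setT (EFin \o (fun z : R => z)).
Proof.
apply: (@gauss_integrable_le3 _ (fun z => z) 1) => // z.
rewrite mul1r; have := normr_ge0 z; move: (`|z|) => y y0.
have [y1|/ltW y1] := leP 1 y; last by rewrite ler_wpDr// exprn_ge0.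
by rewrite ler_wpDl// exprS ler_peMr// exprn_ege1.
Qed.

(** The first order term vanishes because the Gaussian is centred, and the second
    order term is g2 x * r / 2 because it has unit variance. *)
Lemma heat_taylor K g g1 g2 r x : 0 <= r -> smooth3 K g g1 g2 ->
  `|heat r g x - g x - g2 x * r / 2| <= K * gauss_abs3 * Num.sqrt r ^+ 3.
Proof.
move=> r0 [g0 _ _ gT]; set s := Num.sqrt r.
have s0 : 0 <= s by exact: sqrtr_ge0.
have i0 := @heat_integrable K g x s g0.
have ic (c : R) : gauss.-integrable setT (EFin \o cst c).
  exact: finite_measure_integrable_cst.
have i2 : gauss.-integrable setT (EFin \o (fun z : R => z ^+ 2)) by exact: gauss_integrable_sqr.
have [j1 e1] := gauss_lin3 1 (- g x) (- (g1 x * s)) i0 (ic 1) gauss_integrable_id.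
have [j2 e2] := gauss_lin3 1 (- (g2 x * r / 2)) 0 j1 i2 (ic 1).
have i3 : gauss.-integrable setT (EFin \o (fun z : R => `|z| ^+ 3)) by exact: gauss_integrable_abs3.
have [j3 e3] := gauss_lin3 (K * s ^+ 3) 0 0 i3 (ic 1) (ic 1).
rewrite (_ : heat r g x - g x - _ = \int[gauss]_z (1 * (1 * g (x + s * z) + - g x * 1 + - (g1 x * s) * z)
   + - (g2 x * r / 2) * z ^+ 2 + 0 * 1)); last first.
  by rewrite e2 e1 /heat -/s gauss_mean gauss_var gauss_cst; ring.
rewrite (_ : K * _ * _ = \int[gauss]_z (K * s ^+ 3 * `|z| ^+ 3 + 0 * 1 + 0 * 1)); last first.
  by rewrite e3 /gauss_abs3; ring.
apply: gauss_norm_le => // z.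
have -> : K * s ^+ 3 * `|z| ^+ 3 + 0 * 1 + 0 * 1 = K * `|s * z| ^+ 3.
  by rewrite normrM (ger0_norm s0) exprMn; ring.
apply: le_trans (gT x (s * z)); rewrite le_eqVlt; apply/orP; left; apply/eqP.
congr `|_|; rewrite -[in g2 x * r](sqr_sqrtr r0) -/s; ring.
Qed.

Lemma heat_lip K f r q x y : bdd_lip K f ->
  `|heat r f x - heat q f y| <=
    K * (`|x - y| + `|Num.sqrt r - Num.sqrt q| * \int[gauss]_z `|z|).
Proof.
move=> fK; have K0 := bdd_lip_ge0 fK.
have i1 := @heat_integrable K f x (Num.sqrt r) fK.
have i2 := @heat_integrable K f y (Num.sqrt q) fK.
have ic (c : R) : gauss.-integrable setT (EFin \o cst c).
  exact: finite_measure_integrable_cst.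
have iz : gauss.-integrable setT (EFin \o (fun z : R => `|z|)).
  have := gauss_integrable_id; exact: integrable_norm.
have [j1 e1] := gauss_lin3 1 (-1) 0 i1 i2 (ic 1).
have [j2 e2] := gauss_lin3 (K * `|x - y|) (K * `|Num.sqrt r - Num.sqrt q|) 0 (ic 1) iz (ic 1).
rewrite (_ : heat r f x - _ = \int[gauss]_z (1 * f (x + Num.sqrt r * z) + -1 * f (y + Num.sqrt q * z) + 0 * 1)); last first.
  by rewrite e1 /heat; ring.
rewrite [leRHS](_ : _ = \int[gauss]_z (K * `|x - y| * 1 + K * `|Num.sqrt r - Num.sqrt q| * `|z| + 0 * 1)); last first.
  by rewrite e2 gauss_cst; ring.
apply: gauss_norm_le => // z.
rewrite mul1r mulN1r mul0r !addr0 mulr1.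
case: fK => _ fL; apply: le_trans (fL _ _) _.
rewrite -mulrA -mulrDr ler_wpM2l//.
rewrite opprD addrACA -mulrBl; apply: le_trans (ler_normD _ _) _.
by rewrite normrM.
Qed.

End HeatSemigroup.

(** * The semigroup property *)

Section HeatComposition.
Context {R : realType}.
Local Notation mu := (@lebesgue_measure R).
Local Notation gauss := (@normal_prob R 0 1).
Local Notation phi := (@normal_pdf R 0 1).

(** Completing the square: the joint density of (z, u) is the density of u times
    the density of z given u. *)
Lemma normal_pdf_mul (x s t u z : R) : 0 < s -> 0 < t ->
  normal_pdf (x + s * z) t u * phi z =
  normal_pdf x (Num.sqrt (s ^+ 2 + t ^+ 2)) u *
  normal_pdf (s * (u - x) / (s ^+ 2 + t ^+ 2)) (t / Num.sqrt (s ^+ 2 + t ^+ 2)) z.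
Proof.
move=> s0 t0.
have q0 : 0 < s ^+ 2 + t ^+ 2 by rewrite addr_gt0 ?exprn_gt0.
have r0 : 0 < Num.sqrt (s ^+ 2 + t ^+ 2) by rewrite sqrtr_gt0.
have r2 : Num.sqrt (s ^+ 2 + t ^+ 2) ^+ 2 = s ^+ 2 + t ^+ 2 by rewrite sqr_sqrtr ?ltW.
move: (Num.sqrt _) r0 r2 => r r0 r2; rewrite -!r2.
rewrite (normal_pdf1E _ _ t0) (normal_pdf1E _ _ r0) [X in _ = _ * X](normal_pdf1E _ z) ?divr_gt0//.
rewrite !phiE; move: (normal_peak 1) => p.
set a := ((u - (x + s * z)) / t) ^+ 2 / 2; set b := z ^+ 2 / 2.
set a' := ((u - x) / r) ^+ 2 / 2; set b' := (X in _ = _ * (_ * expR (- X) / _)).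
have e1 : expR (- a) * expR (- b) = expR (- a') * expR (- b').
  rewrite -!expRD -!opprD; congr (expR (- _)).
  have s2 : s ^+ 2 = r ^+ 2 - t ^+ 2 by rewrite r2; ring.
  rewrite /a /b /a' /b'.
  have -> : ((z - s * (u - x) / r ^+ 2) / (t / r)) ^+ 2 / 2 =
     (z ^+ 2 * r ^+ 2 - 2 * z * s * (u - x) + s ^+ 2 * (u - x) ^+ 2 / r ^+ 2) / (t ^+ 2) / 2.
    by field; rewrite !gt_eqF.
  have -> : ((u - (x + s * z)) / t) ^+ 2 / 2 =
     ((u - x) ^+ 2 - 2 * (u - x) * s * z + s ^+ 2 * z ^+ 2) / t ^+ 2 / 2.
    by field; rewrite gt_eqF.
  by rewrite s2; field; rewrite !gt_eqF.
transitivity (p ^+ 2 * (expR (- a) * expR (- b)) / t); first by field; rewrite gt_eqF.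
by rewrite e1; field; rewrite !gt_eqF.
Qed.

(** Tonelli, then [normal_pdf_mul]: the inner integral over z is that of a normal
    density, hence 1. *)
Lemma ge0_gauss_gauss (f : R -> R) (x s t : R) : 0 < s -> 0 < t ->
  continuous f -> (forall x, 0 <= f x) ->
  (\int[gauss]_z \int[gauss]_y (f (x + s * z + t * y))%:E =
   \int[gauss]_u (f (x + Num.sqrt (s ^+ 2 + t ^+ 2) * u))%:E)%E.
Proof.
move=> s0 t0 cf f0.
have q0 : 0 < s ^+ 2 + t ^+ 2 by rewrite addr_gt0 ?exprn_gt0.
have r0 : 0 < Num.sqrt (s ^+ 2 + t ^+ 2) by rewrite sqrtr_gt0.
rewrite ge0_integral_gauss_affine//.
under eq_integral do rewrite ge0_integral_gauss_affine//.
pose F2 (p : R * R) : \bar R := (f p.2 * (phi ((p.2 - (x + s * p.1)) / t) / t))%:E.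
pose F (p : R * R) : \bar R := (f p.2 * (phi ((p.2 - (x + s * p.1)) / t) / t) * phi p.1)%:E.
have mphi : measurable_fun setT phi by exact: measurable_normal_pdf.
have mf : measurable_fun setT f by exact: continuous_measurable_fun.
have mF2 : measurable_fun setT F2.
  apply/measurable_EFinP; apply: measurable_funM.
  - exact: measurableT_comp mf measurable_snd.
  - apply: measurable_funM => //; apply: (measurableT_comp mphi).
    apply: measurable_funM => //; apply: measurable_funB; first exact: measurable_snd.
    by apply: measurable_funD => //; apply: measurable_funM => //; exact: measurable_fst.
have mF : measurable_fun setT F.
  apply/measurable_EFinP; apply: measurable_funM; first exact/measurable_EFinP.
  exact: measurableT_comp mphi measurable_fst.
have F20 p : (0 <= F2 p)%E.
  by rewrite lee_fin !mulr_ge0 ?normal_pdf_ge0// invr_ge0 ltW.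
have F0 p : (0 <= F p)%E.
  by rewrite lee_fin !mulr_ge0 ?normal_pdf_ge0// invr_ge0 ltW.
have := @fubini_tonelli _ _ _ _ _ mu mu F mF F0; rewrite /= => FT.
transitivity (\int[mu]_z \int[mu]_u F (z, u))%E.
  rewrite ge0_integral_gauss.
  - apply: eq_integral => z _.
    have mfp : measurable_fun setT (fun u => (f u * normal_pdf (x + s * z) t u)%:E).
      have mp : measurable_fun setT (normal_pdf (x + s * z) t) by exact: measurable_normal_pdf.
      by apply/measurable_EFinP; exact: measurable_funM mf mp.
    have := @ge0_integralZr _ _ _ mu setT measurableT _ mfp (phi z)%:E.
    move=> <-.
    + by apply: eq_integral => u _; rewrite -EFinM /F/= normal_pdf1E.
    + by move=> u _; rewrite lee_fin mulr_ge0 ?normal_pdf_ge0.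
    + by rewrite lee_fin normal_pdf_ge0.
  - have := @measurable_fun_fubini_tonelli_F _ _ _ _ _ mu F2 mF2 F20.
    rewrite /fubini_F; congr measurable_fun; apply/funext => z.
    by apply: eq_integral => u _; rewrite /F2/= (normal_pdf1E _ _ t0).
  - by move=> z; apply: integral_ge0 => u _; rewrite lee_fin mulr_ge0 ?normal_pdf_ge0.
rewrite FT; apply: eq_integral => u _.
transitivity (\int[mu]_z ((f u * normal_pdf x (Num.sqrt (s ^+ 2 + t ^+ 2)) u)%:E *
   (normal_pdf (s * (u - x) / (s ^+ 2 + t ^+ 2)) (t / Num.sqrt (s ^+ 2 + t ^+ 2)) z)%:E))%E.
  apply: eq_integral => z _; rewrite -EFinM /F/= -(normal_pdf1E _ _ t0).
  congr EFin; rewrite -mulrA (normal_pdf_mul x u z s0 t0) mulrA.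
  reflexivity.
set m := s * (u - x) / _; set w := t / _.
have mp : measurable_fun setT (fun z => (normal_pdf m w z)%:E).
  by apply/measurable_EFinP; exact: measurable_normal_pdf.
rewrite (@ge0_integralZl _ _ _ mu setT measurableT _ mp).
- by rewrite integral_normal_pdf mule1.
- by move=> z _; rewrite lee_fin normal_pdf_ge0.
- by rewrite lee_fin mulr_ge0 ?normal_pdf_ge0.
Qed.

(** Adding K to f makes it nonnegative, and the degenerate times 0, for which
    there is no density, are treated apart. *)
Lemma heat_add K (f : R -> R) (r q x : R) : 0 <= r -> 0 <= q -> bdd_lip K f ->
  heat r (heat q f) x = heat (r + q) f x.
Proof.
rewrite le_eqVlt => /predU1P[<-|r0].
  rewrite add0r => _ fK; rewrite /heat sqrtr0.
  by under eq_Rintegral do rewrite mul0r addr0; rewrite gauss_cst.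
rewrite le_eqVlt => /predU1P[<-|q0] fK.
  rewrite addr0 /heat sqrtr0; apply: eq_Rintegral => z _.
  by under eq_Rintegral do rewrite mul0r addr0; rewrite gauss_cst.
have K0 := bdd_lip_ge0 fK.
pose f' y := f y + K.
have f'0 y : 0 <= f' y.
  by case: fK => + _ => /(_ y); rewrite ler_norml /f' => /andP[]; lra.
have cf' : continuous f'.
  by move=> y; apply: cvgD; [exact: bdd_lip_continuous fK _|exact: cvg_cst].
have heatD p g y : bdd_lip K g -> heat p g y = heat p (fun y => g y + K) y - K.
  move=> gK; rewrite /heat RintegralD//; last 2 first.
  - exact: heat_integrable gK.
  - exact: (@finite_measure_integrable_cst _ _ _ gauss setT K).
  by rewrite gauss_cst addrK.
rewrite (heatD _ _ _ (bdd_lip_heat _ fK)) (heatD _ _ _ fK); congr (_ - _).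
rewrite -/f' [heat (r + q) _ _]/heat [heat r _ _]/heat.
have := @ge0_gauss_gauss f' x (Num.sqrt r) (Num.sqrt q).
rewrite !sqrtr_gt0 r0 q0 !sqr_sqrtr ?ltW// => /(_ isT isT cf' f'0) e.
rewrite /Rintegral -e; congr fine; apply: eq_integral => z _.
rewrite /= (heatD _ _ _ fK) subrK /heat /Rintegral fineK//.
have i1 : gauss.-integrable setT (EFin \o (fun y => f' (x + Num.sqrt r * z + Num.sqrt q * y))).
  apply: (@gauss_integrable_bdd _ (K + K)); first exact: continuous_affine.
  move=> y; rewrite /f'; apply: le_trans (ler_normD _ _) _.
  by rewrite (ger0_norm K0) lerD2r; case: fK.
exact: integrable_fin_num i1.
Qed.

End HeatComposition.

(** * Growing trees and their leaves *)

(** The trees that the process can have at time n. *)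
Inductive grown : nat -> {fset word} -> Prop :=
| grown1 : grown 1 [fset [::]]%fset
| grownS n t v : grown n t -> v \in external t -> grown n.+1 (v |` t)%fset.

Definition prefix_closed (t : {fset word}) : Prop :=
  forall (u : word) (b : bool), rcons u b \in t -> u \in t.

Lemma in_external (t : {fset word}) (v : word) :
  reflect (v \notin t /\ exists u b, u \in t /\ v = rcons u b) (v \in external t).
Proof.
rewrite /external in_fsetD; apply: (iffP andP) => -[vt].
  move=> /imfset2P[u /= ut [b _ e]]; rewrite e in vt *.
  by split; [|exists u, b].
move=> [u [b [ut e]]]; split; rewrite e in vt *; first by [].
by apply/imfset2P; exists u => //; exists b => //=; rewrite !inE; case: (b).
Qed.

Lemma grown_prefix_closed n t : grown n t -> prefix_closed t.
Proof.
elim=> {n t} [|n t v gt IH /in_external[vt [u' [b' [u't e]]]]] u b.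
  by rewrite inE => /eqP; case: u.
rewrite !in_fset1U => /orP[/eqP uv|/IH ->]; last by rewrite orbT.
by move: e; rewrite -uv => /rcons_inj[-> _]; rewrite u't orbT.
Qed.

Lemma rcons_neq (T : eqType) (v : seq T) b : (rcons v b == v) = false.
Proof. by apply/negP => /eqP /(congr1 size) /eqP; rewrite size_rcons -[X in _ == X]addn0 -addn1 eqn_add2l. Qed.

(** The leaf that becomes a node is replaced by its two children. *)
Lemma external_add (t : {fset word}) (v : word) : prefix_closed t -> v \in external t ->
  external (v |` t)%fset =
  (rcons v false |` (rcons v true |` (external t `\ v)))%fset.
Proof.
move=> ct ve; have /in_external[vt [u [b [ut uv]]]] := ve.
apply/fsetP => w; rewrite !in_fset1U in_fsetD1; apply/in_external/idP.
  rewrite in_fset1U negb_or => -[/andP[wv wt] [u' [b' [+ we]]]].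
  rewrite in_fset1U => /orP[/eqP u'v|u't].
    by rewrite we u'v; case: b' {we}; rewrite eqxx ?orbT.
  apply/orP; right; apply/orP; right; rewrite wv/=; apply/in_external.
  by split=> //; exists u', b'.
have Hv b' : rcons v b' \notin (v |` t)%fset.
  by rewrite in_fset1U rcons_neq/=; apply/negP => /ct; apply/negP.
move=> /or3P[/eqP ->|/eqP ->|/andP[wv]].
- by split; [exact: Hv|exists v, false; rewrite in_fset1U eqxx].
- by split; [exact: Hv|exists v, true; rewrite in_fset1U eqxx].
- move=> /in_external[wt [u' [b' [u't we]]]]; split.
    by rewrite in_fset1U negb_or wv.
  by exists u', b'; rewrite in_fset1U u't orbT.
Qed.

Lemma sum_external_add (V : zmodType) (t : {fset word}) (v : word) (F : word -> V) :
  prefix_closed t -> v \in external t ->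
  \sum_(w <- external (v |` t)%fset) F w =
  F (rcons v false) + F (rcons v true) + (\sum_(w <- external t) F w - F v).
Proof.
move=> ct ve; rewrite external_add//.
have vt : v \notin t by have /in_external[] := ve.
have He b : rcons v b \notin external t.
  apply/negP => /in_external[_ [u [b' [ut /rcons_inj[vu _]]]]].
  by rewrite vu ut in vt.
rewrite !big_fsetU1/=.
- rewrite -addrA; congr (_ + (_ + _)).
  by rewrite (big_fsetD1 v ve)/= addrC addrK.
- by rewrite in_fsetD1 negb_and He orbT.
- rewrite in_fset1U negb_or in_fsetD1 negb_and He orbT andbT.
  by apply/eqP => /rcons_inj[].
Qed.

(** Counting is reduced to [sum_external_add] by summing 1 in the integers, where
    subtraction is exact. *)
Lemma card_external_add (t : {fset word}) (v : word) :
  prefix_closed t -> v \in external t ->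
  #|` external (v |` t)%fset| = #|` external t|.+1.
Proof.
move=> ct ve; apply/eqP; rewrite -eqz_nat; apply/eqP.
have h (A : {fset word}) : (#|` A|%:Z = \sum_(w <- A) 1)%R.
  by rewrite big_const_seq count_predT iter_addr addr0 natz.
rewrite h sum_external_add// -h -addn1 PoszD; ring.
Qed.

Lemma card_external_grown n t : grown n t -> #|` external t| = n.+1.
Proof.
elim=> {n t} [|n t v gt IH ve]; last first.
  by rewrite card_external_add// ?IH//; exact: grown_prefix_closed gt.
have -> : external [fset [::]]%fset = [fset [:: false]; [:: true]]%fset.
  apply/fsetP => w; rewrite in_fset2; apply/in_external/idP.
    by rewrite !inE => -[_ [u [[] []]]]; rewrite !inE => /eqP-> ->.
  move=> /orP[] /eqP ->; split; rewrite ?inE//; exists [::];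
    [exists false|exists true]; by rewrite inE.
by rewrite cardfs2.
Qed.

(** * Leaf averages and the transition operator *)

Section Averages.
Context {R : realType}.
Implicit Types (t : {fset word}) (F : nat -> R).

Definition ext t : R := #|` external t|%:R.

Definition avg t F : R := (ext t)^-1 * \sum_(v <- external t) F (size v).

(** Transition operator of the growing tree: the mean of f over the next tree. *)
Definition step (f : {fset word} -> R) t : R :=
  (ext t)^-1 * \sum_(v <- external t) f (v |` t)%fset.

Lemma ext_ge2 n t : grown n t -> 2 <= ext t.
Proof.
move=> gt; rewrite /ext (card_external_grown gt) ler_nat ltnS.
by case: gt.
Qed.

Lemma ext_gt0 n t : grown n t -> 0 < ext t.
Proof. by move/ext_ge2; exact: lt_le_trans. Qed.

Lemma ext_add n t v : grown n t -> v \in external t ->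
  ext (v |` t)%fset = ext t + 1.
Proof.
move=> gt ve; rewrite /ext card_external_add//; last exact: grown_prefix_closed gt.
by rewrite -natr1.
Qed.

(** The chosen leaf, of depth k, disappears and two leaves of depth k + 1 appear. *)
Lemma avg_add n t v F : grown n t -> v \in external t ->
  avg (v |` t)%fset F =
  (ext t * avg t F + 2 * F (size v).+1 - F (size v)) / (ext t + 1).
Proof.
move=> gt ve; rewrite /avg (ext_add gt ve) sum_external_add//; last exact: grown_prefix_closed gt.
rewrite mulrA divff ?gt_eqF ?(ext_gt0 gt)// mul1r !size_rcons mulrC.
by congr (_ / _); ring.
Qed.

Lemma avgD t F G : avg t (fun k => F k + G k) = avg t F + avg t G.
Proof. by rewrite /avg big_split mulrDr. Qed.

Lemma avgZ t c F : avg t (fun k => c * F k) = c * avg t F.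
Proof. by rewrite /avg -mulr_sumr mulrCA. Qed.

Lemma avg_cst n t (c : R) : grown n t -> avg t (fun=> c) = c.
Proof.
move=> gt; rewrite /avg big_const_seq count_predT iter_addr addr0 -mulr_natl.
by rewrite -/(ext t) mulrA mulVf ?mul1r// gt_eqF// (ext_gt0 gt).
Qed.

Lemma avg_le t F G : (forall k, F k <= G k) -> avg t F <= avg t G.
Proof.
move=> FG; rewrite /avg ler_wpM2l ?invr_ge0//.
exact: ler_sum.
Qed.

Lemma avg_norm t F : `|avg t F| <= avg t (fun k => `|F k|).
Proof.
rewrite /avg normrM ger0_norm ?invr_ge0// ler_wpM2l ?invr_ge0//.
exact: ler_norm_sum.
Qed.

Lemma eq_avg t F G : F =1 G -> avg t F = avg t G.
Proof. by move=> FG; rewrite /avg; under eq_bigr do rewrite FG. Qed.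

(** When f only depends on the depth of the new node, the transition operator is
    an average over leaf depths. *)
Lemma stepE t f (F : nat -> R) :
  (forall v, v \in external t -> f (v |` t)%fset = F (size v)) ->
  step f t = avg t F.
Proof.
move=> fF; rewrite /step /avg; congr (_ * _).
by rewrite big_seq [RHS]big_seq; apply: eq_bigr => v ve; exact: fF.
Qed.

Lemma step_le t f (F : {fset word} -> R) :
  (forall v, v \in external t -> f (v |` t)%fset <= F (v |` t)%fset) ->
  step f t <= step F t.
Proof.
move=> fF; rewrite /step ler_wpM2l ?invr_ge0//.
by rewrite big_seq [leRHS]big_seq; apply: ler_sum => v ve; exact: fF.
Qed.

End Averages.

(** * Leaf-depth statistics under growth *)

Section Statistics.
Context {R : realType}.
Implicit Types (t : {fset word}) (F : nat -> R).

Definition mean t : R := avg t (fun k => k%:R).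

Definition cmoment j t : R := avg t (fun k => (k%:R - mean t) ^+ j).

Definition harm (p : nat) : R := \sum_(0 <= j < p) (j.+1%:R)^-1.

(** The mean leaf depth increases in expectation by 2 / (p + 1), which is the
    increment of 2 H_p. *)
Definition mart t : R := mean t - 2 * harm #|` external t|.

(** Variance minus mean of the leaf depths. Both grow like 2 log n, while their
    difference is almost a martingale and stays bounded. *)
Definition spread t : R := cmoment 2 t - mean t.

(** The base 5/4 is chosen so that the exponential moment grows only like the
    square root of the number of leaves: a step multiplies it in mean by (p + 3/2)
    / (p + 1). *)
Definition expmean t : R := avg t (fun k => (5 / 4) ^+ k).

(** Constant comparing the fourth moment with the exponential moment of base 5/4.
    It is locked because only [cW_ge1] and [pow4_le] are relevant, and arithmetic
    tactics should not expand it. *)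
Definition cW : R := locked (16 ^+ 4).

Lemma cW_ge1 : 1 <= cW.
Proof. by rewrite /cW -lock exprn_ege1//; lra. Qed.

Lemma avg_sqr n t F : grown n t -> avg t F ^+ 2 <= avg t (fun k => F k ^+ 2).
Proof.
move=> gt; have : 0 <= avg t (fun k => (F k - avg t F) ^+ 2).
  rewrite -(@avg_cst R n t 0 gt); apply: avg_le => k; exact: sqr_ge0.
rewrite (@eq_avg _ t _ (fun k => F k ^+ 2 + ((- 2 * avg t F) * F k + avg t F ^+ 2))); last first.
  by move=> k; ring.
by rewrite !avgD avgZ (avg_cst _ gt); nra.
Qed.

Lemma avg_quad n t (a b c : R) : grown n t ->
  avg t (fun k => a + b * (k%:R - mean t) + c * (k%:R - mean t) ^+ 2) =
  a + c * cmoment 2 t.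
Proof.
move=> gt; rewrite !avgD !avgZ !avgD !(avg_cst _ gt) -/(mean t) subrr mulr0 addr0.
by [].
Qed.

Lemma pow4_le (k : nat) : k%:R ^+ 4 <= cW * (5 / 4) ^+ k :> R.
Proof.
(* With q = k / 4, Bernoulli's inequality gives 1 + q / 4 <= (5/4)^q, and k is at
   most 16 times the left-hand side; the fourth power then gives the claim. *)
have h : k%:R <= 16 * (1 + (k %/ 4)%:R / 4 :> R).
  have : (k <= 4 * (k %/ 4) + 3)%N by rewrite {1}(divn_eq k 4) mulnC leq_add2l -ltnS ltn_mod.
  rewrite -(ler_nat R) natrD natrM => h.
  have := ler0n R (k %/ 4); lra.
have b : 1 + (k %/ 4)%:R / 4 <= (5 / 4 : R) ^+ (k %/ 4).
  elim: (k %/ 4)%N => [|q IH]; first by rewrite expr0; lra.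
  rewrite exprS -natr1; have := ler0n R q; nra.
have p : (5 / 4 : R) ^+ (4 * (k %/ 4)) <= (5 / 4) ^+ k.
  apply: ler_weXn2l; first by lra.
  by rewrite mulnC {2}(divn_eq k 4) leq_addr.
apply: le_trans (_ : cW * (5 / 4) ^+ (4 * (k %/ 4)) <= _); last by rewrite ler_wpM2l//; have := cW_ge1; lra.
rewrite mulnC exprM /cW -lock.
have z0 : 0 <= (5 / 4 : R) ^+ (k %/ 4) by rewrite exprn_ge0// divr_ge0.
rewrite -exprMn lerXn2r ?nnegrE ?ler0n ?mulr_ge0//.
by apply: le_trans h _; rewrite ler_wpM2l.
Qed.

Section OneTree.
Variables (n : nat) (t : {fset word}) (gt : grown n t).
Let p : R := ext t.

Let p2 : 2 <= p. Proof. exact: ext_ge2 gt. Qed.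

Let p1neq0 : p + 1 != 0.
Proof. by rewrite gt_eqF//; have := p2; lra. Qed.

Lemma expmean_ge1 : 1 <= expmean t.
Proof.
rewrite -(@avg_cst R n t 1 gt); apply: avg_le => k.
by rewrite exprn_ege1//; lra.
Qed.

Let q4 : R := avg t (fun k => k%:R ^+ 4).

Lemma moment4_le : avg t (fun k => k%:R ^+ 4) <= cW * expmean t.
Proof. by rewrite /expmean -avgZ; apply: avg_le => k; exact: pow4_le. Qed.

Lemma moment2_le : avg t (fun k => k%:R ^+ 2) <= q4.
Proof.
apply: avg_le => k; rewrite -!natrX ler_nat.
by case: k => [|k]; [rewrite !exp0n|exact: leq_pexp2l].
Qed.

Lemma mean_sqr_le : mean t ^+ 2 <= q4.
Proof. exact: le_trans (avg_sqr _ gt) moment2_le. Qed.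

Lemma cmoment2E : cmoment 2 t = avg t (fun k => k%:R ^+ 2) - mean t ^+ 2.
Proof.
rewrite /cmoment (@eq_avg _ t _ (fun k => k%:R ^+ 2 + ((- 2 * mean t) * k%:R + mean t ^+ 2))).
  by rewrite !avgD avgZ (avg_cst _ gt) -/(mean t); ring.
by move=> k; ring.
Qed.

Lemma cmoment2_le : cmoment 2 t <= q4.
Proof.
by rewrite cmoment2E; have := moment2_le; have := sqr_ge0 (mean t); lra.
Qed.

Lemma cmoment4_le : cmoment 4 t <= 16 * q4.
Proof.
apply: (@le_trans _ _ (avg t (fun k => 8 * k%:R ^+ 4 + 8 * mean t ^+ 4))).
  apply: avg_le => k; move: (k%:R : R) (mean t) => a b.
  rewrite -subr_ge0 (_ : _ - _ = (a + b) ^+ 2 * (2 * a ^+ 2 + 2 * b ^+ 2 + (a - b) ^+ 2) + 4 * (a ^+ 2 - b ^+ 2) ^+ 2); last ring.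
  apply: addr_ge0; apply: mulr_ge0; rewrite ?sqr_ge0//.
  by apply: addr_ge0; rewrite ?sqr_ge0//; apply: addr_ge0; apply: mulr_ge0; rewrite ?sqr_ge0.
rewrite avgD avgZ (avg_cst _ gt) -/q4.
have -> : mean t ^+ 4 = (mean t ^+ 2) ^+ 2 by rewrite -exprM.
have h : (mean t ^+ 2) ^+ 2 <= avg t (fun k => k%:R ^+ 2) ^+ 2.
  by rewrite lerXn2r ?nnegrE ?sqr_ge0 ?(avg_sqr _ gt)// (le_trans (sqr_ge0 _) (avg_sqr _ gt)).
have := avg_sqr (fun k => k%:R ^+ 2) gt.
have -> : avg t (fun k => (k%:R ^+ 2) ^+ 2) = q4 by apply: eq_avg => k; rewrite -exprM.
lra.
Qed.

Lemma cmoment2_sqr_le : cmoment 2 t ^+ 2 <= cmoment 4 t.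
Proof.
rewrite /cmoment; apply: le_trans (avg_sqr _ gt) _.
by rewrite le_eqVlt; apply/orP; left; apply/eqP/eq_avg => k; rewrite -exprM.
Qed.

Section OneLeaf.
Variables (v : word) (ve : v \in external t).
Let y : R := (size v)%:R - mean t.

Lemma mean_add : mean (v |` t)%fset = mean t + (y + 2) / (p + 1).
Proof.
rewrite /mean (avg_add _ gt ve) -/p -/(mean t) /y -natr1.
by field; rewrite p1neq0.
Qed.

Lemma mart_add : mart (v |` t)%fset = mart t + y / (p + 1).
Proof.
rewrite /mart mean_add card_external_add//; last exact: grown_prefix_closed gt.
rewrite /harm big_nat_recr//= -natr1 -/(ext t) -/p.
by field; rewrite p1neq0.
Qed.

Lemma ext_addE : ext (v |` t)%fset = p + 1.
Proof. exact: ext_add gt ve. Qed.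

End OneLeaf.

Lemma spread_add v : v \in external t ->
  spread (v |` t)%fset = spread t +
   (((size v)%:R - mean t) ^+ 2 - cmoment 2 t + 3 * ((size v)%:R - mean t)
    - ((size v)%:R - mean t + 2) ^+ 2 / (p + 1)) / (p + 1).
Proof.
move=> ve; have gt' := grownS gt ve.
rewrite /spread.
have -> : cmoment 2 (v |` t)%fset = avg (v |` t)%fset (fun k => k%:R ^+ 2) - mean (v |` t)%fset ^+ 2.
  rewrite /cmoment (@eq_avg _ _ _ (fun k => k%:R ^+ 2 + ((- 2 * mean (v |` t)%fset) * k%:R + mean (v |` t)%fset ^+ 2))).
    by rewrite !avgD avgZ (avg_cst _ gt') -/(mean (v |` t)%fset); ring.
  by move=> k; ring.
rewrite cmoment2E (mean_add ve) (avg_add _ gt ve) -/p -natr1.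
by field; rewrite p1neq0.
Qed.

Lemma expmean_add v : v \in external t ->
  expmean (v |` t)%fset = (p * expmean t + 3 / 2 * (5 / 4) ^+ size v) / (p + 1).
Proof.
move=> ve; rewrite /expmean (avg_add _ gt ve) -/p exprS.
by field; rewrite p1neq0.
Qed.

Lemma step_expmean (c : R) : step (fun t' => c * expmean t') t =
  c * (expmean t * (p + 3 / 2) / (p + 1)).
Proof.
rewrite (@stepE _ _ _ (fun k => c * (p * expmean t / (p + 1)) + c * (3 / 2 / (p + 1)) * (5 / 4) ^+ k)).
  rewrite avgD (avg_cst _ gt) avgZ -/(expmean t).
  by field; rewrite p1neq0.
move=> v ve; rewrite expmean_add//.
by field; rewrite p1neq0.
Qed.

Definition decayW t' : R := expmean t' / ext t'.

(** The decay of 1 / p exceeds the growth of the exponential moment; the surplus,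
    at least expmean / (2 (p + 1)^2), pays for all the error terms of one step. *)
Lemma step_decayW : step decayW t + expmean t / (p + 1) ^+ 2 / 2 <= decayW t.
Proof.
have -> : step decayW t = step (fun t' => (p + 1)^-1 * expmean t') t.
  rewrite /step big_seq [in RHS]big_seq; congr (_ * _); apply: eq_bigr => v ve.
  by rewrite /decayW ext_addE// mulrC.
rewrite step_expmean /decayW -/p.
have W1 := expmean_ge1; have p2' := p2.
rewrite -subr_ge0.
rewrite (_ : _ - _ = expmean t / (p * (p + 1) ^+ 2)); last first.
  by field; rewrite p1neq0 gt_eqF//; lra.
by apply: divr_ge0; [lra|apply: mulr_ge0; [lra|exact: sqr_ge0]].
Qed.

(** The growth rate 3/2 is balanced by dividing by the square root of p: (p +
    3/2)^2 p <= (p + 1)^3. *)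
Lemma step_growthW : step (fun t' => expmean t' / Num.sqrt (ext t')) t <=
  expmean t / Num.sqrt p.
Proof.
have -> : step (fun t' => expmean t' / Num.sqrt (ext t')) t =
    step (fun t' => (Num.sqrt (p + 1))^-1 * expmean t') t.
  rewrite /step big_seq [in RHS]big_seq; congr (_ * _); apply: eq_bigr => v ve.
  by rewrite ext_addE// mulrC.
have p2' := p2.
have s1 : 0 < Num.sqrt (p + 1) by rewrite sqrtr_gt0; lra.
have s0 : 0 < Num.sqrt p by rewrite sqrtr_gt0; lra.
have p1 : 0 < p + 1 by lra.
have key : (p + 3 / 2) * Num.sqrt p <= (p + 1) * Num.sqrt (p + 1).
  have l0 : 0 <= (p + 3 / 2) * Num.sqrt p by apply: mulr_ge0; lra.
  have r0 : 0 <= (p + 1) * Num.sqrt (p + 1) by apply: mulr_ge0; lra.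
  rewrite -(ler_pXn2r (ltn0Sn 1)) ?nnegrE// !exprMn !sqr_sqrtr; [nra|lra|lra].
rewrite step_expmean mulrCA -[leLHS]mulrA ler_wpM2l//.
  by have := expmean_ge1; lra.
rewrite -invfM ler_pdivrMr ?mulr_gt0// [leRHS]mulrC ler_pdivlMr//.
by rewrite [leRHS]mulrC.
Qed.

(** Orthogonality of martingale increments. *)
Lemma step_mart_sqr (x : R) :
  step (fun t' => (mart t' - x) ^+ 2) t = (mart t - x) ^+ 2 + cmoment 2 t / (p + 1) ^+ 2.
Proof.
rewrite (@stepE _ _ _ (fun k => (mart t - x) ^+ 2 + (2 * (mart t - x) / (p + 1)) * (k%:R - mean t) +
   ((p + 1) ^-2) * (k%:R - mean t) ^+ 2)).
  by rewrite (avg_quad _ _ _ gt) [_ * cmoment _ _]mulrC.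
move=> v ve; rewrite mart_add//.
by field; rewrite p1neq0.
Qed.

(** The parameter c stands for 1 / (p + 1) and s2 for the variance of the leaf
    depths. *)
Let spread_incr_bound (c s2 y : R) : 0 <= c -> c <= 1 / 3 ->
  (y ^+ 2 - s2 + 3 * y - c * (y + 2) ^+ 2) ^+ 2 <= 4 * (7 * y ^+ 4 + s2 ^+ 2 + 21).
Proof.
move=> c0 c1.
have h4 (a b e f : R) : (a - b + e - f) ^+ 2 <= 4 * (a ^+ 2 + b ^+ 2 + e ^+ 2 + f ^+ 2).
  have := sqr_ge0 (a + b); have := sqr_ge0 (a - e); have := sqr_ge0 (a + f).
  have := sqr_ge0 (b + e); have := sqr_ge0 (b - f); have := sqr_ge0 (e + f).
  by nra.
apply: le_trans (h4 _ _ _ _) _; rewrite ler_wpM2l//.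
have hc : (c * (y + 2) ^+ 2) ^+ 2 <= (1 / 3 * (2 * y ^+ 2 + 8)) ^+ 2.
  have := sqr_ge0 (y + 2); have := sqr_ge0 (y - 2); have := sqr_ge0 y => h1 h2 h3.
  have y2 : (y + 2) ^+ 2 <= 2 * y ^+ 2 + 8 by nra.
  rewrite lerXn2r ?nnegrE//; [exact: mulr_ge0|apply: mulr_ge0; lra|].
  by apply: ler_pM.
have := sqr_ge0 (y ^+ 2 - 1); have := sqr_ge0 (y ^+ 2 - 4).
have -> : y ^+ 4 = (y ^+ 2) ^+ 2 by rewrite -exprM.
move: hc; rewrite (_ : (3 * y) ^+ 2 = 9 * y ^+ 2); last ring.
move: (y ^+ 2) (c * _) => u w; nra.
Qed.

(** Expand the square of s + D / (p + 1), where D is the increment of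
    [spread_add]. The mean of D is - (s2 + 4) / (p + 1), so the cross term also
    carries a factor (p + 1)^(-2), and the mean of D^2 is at most a multiple of a
    fourth moment; both are bounded through [expmean]. *)
Lemma step_spread_sqr :
  step (fun t' => spread t' ^+ 2) t <= spread t ^+ 2 + 700 * cW * expmean t / (p + 1) ^+ 2.
Proof.
have p2' := p2.
set c := (p + 1)^-1; rewrite -exprVn -/c.
have c0 : 0 < c by rewrite invr_gt0; lra.
have c1 : c <= 1 / 3 by rewrite /c -[leRHS]invf_div divr1 lef_pV2 ?posrE; lra.
pose y k : R := k%:R - mean t.
rewrite (@stepE _ _ _ (fun k => (spread t + (y k ^+ 2 - cmoment 2 t + 3 * y k
    - c * (y k + 2) ^+ 2) * c) ^+ 2)); last first.
  by move=> v ve; rewrite spread_add// -/c /y; congr (_ ^+ 2); ring.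
set s := spread t; set s2 := cmoment 2 t.
(* The cross term is kept exactly, as a quadratic polynomial in the centred
   depth; only the square of the increment is estimated. *)
apply: (@le_trans _ _ (avg t (fun k => ((s ^+ 2 + 2 * s * c * (- s2 - 4 * c) + 4 * c ^+ 2 * (s2 ^+ 2 + 21))
   + (2 * s * c * (3 - 4 * c)) * (k%:R - mean t) + (2 * s * c * (1 - c)) * (k%:R - mean t) ^+ 2)
   + 28 * c ^+ 2 * (k%:R - mean t) ^+ 4))).
  apply: avg_le => k; have := spread_incr_bound s2 (y k) (ltW c0) c1.
  rewrite -/(y k); move: (y k) => {}y.
  move=> /(ler_wpM2l (sqr_ge0 c)); set X := (_ ^+ 2 - _ + _ - _) => hX.
  rewrite -subr_ge0 in hX; rewrite -subr_ge0.
  by apply: le_trans hX _; rewrite /X le_eqVlt; apply/orP; left; apply/eqP; ring.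
rewrite avgD (avg_quad _ _ _ gt) avgZ -/(cmoment 4 t) -/s2.
have m4 := cmoment4_le; have mm := mean_sqr_le; have s4 := cmoment2_sqr_le.
have W1 := expmean_ge1; have W4 := moment4_le.
have cW1 := cW_ge1.
have cWW : 1 <= cW * expmean t by rewrite mulr_ege1.
rewrite -subr_ge0.
rewrite (_ : _ - _ = c ^+ 2 * (700 * (cW * expmean t) - (4 * (s2 ^+ 2 + 21) + 28 * cmoment 4 t - 2 * s * (s2 + 4)))); last ring.
apply: mulr_ge0; first exact: sqr_ge0.
rewrite subr_ge0.
move: m4 mm s4 W4; rewrite /s /spread -/s2 -/q4.
have := sqr_ge0 (s2 - mean t + s2 + 4); have := sqr_ge0 (s2 + mean t); have := sqr_ge0 (s2 - 4).
by nra.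
Qed.

End OneTree.
End Statistics.

(** * Supermartingale potentials *)

Section Potentials.
Context {R : realType}.
Implicit Types (t : {fset word}).
Local Notation cW := (@cW R).

Lemma stepD t (f g : {fset word} -> R) : step (fun t' => f t' + g t') t = step f t + step g t.
Proof. by rewrite /step big_split mulrDr. Qed.

Lemma stepZ t c (f : {fset word} -> R) : step (fun t' => c * f t') t = c * step f t.
Proof. by rewrite /step -mulr_sumr mulrCA. Qed.

Lemma step_cst n t (c : R) : grown n t -> step (fun=> c) t = c.
Proof. by move=> gt; rewrite (@stepE _ _ _ (fun=> c))// (avg_cst _ gt). Qed.

Lemma eq_step t (f g : {fset word} -> R) :
  (forall v, v \in external t -> f (v |` t)%fset = g (v |` t)%fset) -> step f t = step g t.
Proof.
by move=> fg; rewrite /step big_seq [in RHS]big_seq; congr (_ * _); apply: eq_bigr.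
Qed.

Lemma step_norm t (f : {fset word} -> R) : `|step f t| <= step (fun t' => `|f t'|) t.
Proof.
by rewrite /step normrM ger0_norm ?invr_ge0// ler_wpM2l ?invr_ge0// ler_norm_sum.
Qed.

(** The factor 1402 = 2 * (700 + 1) lets the decrease of [decayW] absorb the
    increases 700 cW expmean / (p + 1)^2 of the squared spread and cW expmean / (p
    + 1)^2 of the squared martingale. *)
Definition energy t : R := 2 + spread t ^+ 2 + mart t ^+ 2 + 1402 * cW * decayW t.

Lemma decayW_ge0 t : 0 <= @decayW R t.
Proof.
rewrite /decayW divr_ge0// /expmean /avg mulr_ge0 ?invr_ge0//.
by apply: sumr_ge0 => v _; rewrite exprn_ge0// divr_ge0.
Qed.

Lemma cW_ge0 : 0 <= cW.
Proof. by have := @cW_ge1 R; lra. Qed.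

Lemma energy_ge2 t : 2 <= energy t.
Proof.
have := mulr_ge0 cW_ge0 (decayW_ge0 t); have := sqr_ge0 (@spread R t).
by have := sqr_ge0 (@mart R t); rewrite /energy; lra.
Qed.

Lemma energy_abs t : `|@spread R t| + `|@mart R t| + 2 <= 2 * energy t.
Proof.
have := mulr_ge0 cW_ge0 (decayW_ge0 t); rewrite /energy.
rewrite -[X in _ <= 2 * (2 + X + _ + _)]real_normK ?num_real//.
rewrite -[X in _ <= 2 * (2 + _ + X + _)]real_normK ?num_real//.
have := sqr_ge0 (`|@spread R t| - 1); have := sqr_ge0 (`|@mart R t| - 1).
have := sqr_ge0 (`|@spread R t|); have := sqr_ge0 (`|@mart R t|).
by nra.
Qed.

(** The potential [decayW] dominates the future variance of the martingale, so
    that maximal inequalities apply to the distance from a fixed value x. *)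
Lemma sqr_mart_dist_super n t (x : R) : grown n t ->
  step (fun t' => (mart t' - x) ^+ 2 + 2 * cW * decayW t') t <=
  (mart t - x) ^+ 2 + 2 * cW * decayW t.
Proof.
move=> gt; rewrite stepD stepZ (step_mart_sqr gt).
have p0 := @ext_ge2 R _ _ gt.
have h1 := @step_decayW R _ _ gt; have h2 := le_trans (@cmoment2_le R _ _ gt) (@moment4_le R t).
have c0 : 0 <= (ext t + 1 : R) ^- 2 by rewrite invr_ge0 sqr_ge0.
have := ler_wpM2l c0 h2; have := ler_wpM2l cW_ge0 h1.
move: (step _ _) (decayW _) (cmoment _ _) (expmean _) => a b d e.
move: (_ ^-2) c0 => u c0; move: cW => w; nra.
Qed.

Lemma step_energy n t : grown n t -> step energy t <= energy t.
Proof.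
move=> gt; rewrite /energy.
rewrite (@eq_step _ _ (fun t' => (2 + spread t' ^+ 2) + ((mart t' - 0) ^+ 2) + (1402 * cW) * decayW t')); last first.
  by move=> v _; rewrite subr0.
rewrite 3!stepD stepZ (step_mart_sqr gt) (step_cst _ gt) subr0.
have p0 := @ext_ge2 R _ _ gt.
have h3 := @step_spread_sqr R _ _ gt.
have h1 := @step_decayW R _ _ gt; have h2 := le_trans (@cmoment2_le R _ _ gt) (@moment4_le R t).
have c0 : 0 <= (ext t + 1 : R) ^- 2 by rewrite invr_ge0 sqr_ge0.
have := ler_wpM2l c0 h2; have := ler_wpM2l cW_ge0 h1; move: h3.
move: (step _ _) (step _ _) (decayW _) (cmoment _ _) (expmean _) => a a' b d e.
move: (_ ^-2) c0 => u c0; move: cW => w; nra.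
Qed.

(** Dividing a supermartingale that is at least 2 by the growing number of leaves
    yields a definite decrease, of the order of the mismatch in
    [variance_mismatch]. *)
Lemma step_energy_ext n t : grown n t ->
  step (fun t' => energy t' / ext t') t + energy t / (ext t + 1) ^+ 2 <= energy t / ext t.
Proof.
move=> gt; have p2 := @ext_ge2 R _ _ gt.
rewrite (@eq_step _ _ (fun t' => (ext t + 1)^-1 * energy t')); last first.
  by move=> v ve; rewrite (ext_addE gt ve) mulrC.
rewrite stepZ; have := step_energy gt; have := energy_ge2 t.
move: (energy t) (step _ _) => e s e2 se.
have p0 : ext t != 0 :> R by rewrite gt_eqF//; lra.
have p1 : ext t + 1 != 0 :> R by rewrite gt_eqF//; lra.
apply: (@le_trans _ _ ((ext t + 1)^-1 * e + e / (ext t + 1) ^+ 2)).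
  by rewrite lerD2r ler_wpM2l// invr_ge0; lra.
rewrite -subr_ge0 (_ : _ - _ = e / (ext t * (ext t + 1) ^+ 2)); last by field; rewrite p0 p1.
apply: divr_ge0; first lra.
by apply: mulr_ge0; [lra|exact: sqr_ge0].
Qed.

Lemma harm_ge1 p : (0 < p)%N -> 1 <= harm p :> R.
Proof.
case: p => // p _; rewrite /harm big_nat_recl//= invr1 lerDl.
by apply: sumr_ge0 => i _; rewrite invr_ge0.
Qed.

Lemma harm_le p : harm p <= p%:R :> R.
Proof.
rewrite /harm; elim: p => [|p IH]; first by rewrite big_nil.
by rewrite big_nat_recr//= -[in leRHS]natr1 lerD// invf_le1// ler1n.
Qed.

(** Proxy for the total variance of the martingale increments still to come: up to
    lower order terms, 2 H_p / p is what remains to be summed if the leaf-depth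
    variance is 2 H_p at every later time. It is deterministic given the number of
    leaves. *)
Definition varrest t : R := 2 * harm #|` external t| / ext t.

Lemma varrest_add n t v : grown n t -> v \in external t ->
  varrest (v |` t)%fset = (2 * harm #|` external t| + 2 / (ext t + 1)) / (ext t + 1).
Proof.
move=> gt ve; have pc := grown_prefix_closed gt.
rewrite /varrest (ext_addE gt ve) card_external_add// /harm big_nat_recr//=.
have -> : (#|` external t|.+1%:R : R) = ext t + 1 by rewrite -natr1.
by rewrite mulrDr.
Qed.

Lemma varrest_incr n t v : grown n t -> v \in external t ->
  varrest t - varrest (v |` t)%fset =
  (2 * harm #|` external t| + (2 * harm #|` external t| / ext t - 2)) / (ext t + 1) ^+ 2.
Proof.
move=> gt ve; rewrite (varrest_add gt ve) /varrest.
have p2 := @ext_ge2 R _ _ gt.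
by field; rewrite !gt_eqF//; lra.
Qed.

(** The last bound says that a single step uses a vanishing fraction of the
    remaining variance. *)
Lemma varrest_bounds n t v : grown n t -> v \in external t ->
  [/\ 0 <= varrest t, varrest (v |` t)%fset <= varrest t &
   varrest t - varrest (v |` t)%fset <= varrest t / ext t].
Proof.
move=> gt ve; have p2 := @ext_ge2 R _ _ gt.
have h1 : 1 <= harm #|` external t| :> R by apply: harm_ge1; rewrite (card_external_grown gt).
have r0 : 0 <= varrest t by rewrite /varrest divr_ge0//; lra.
have e : varrest t - varrest (v |` t)%fset =
    varrest t / (ext t + 1) - 2 / (ext t + 1) ^+ 2.
  by rewrite (varrest_add gt ve) /varrest; field; rewrite !gt_eqF//; lra.
have e' : varrest t - varrest (v |` t)%fset =
    (2 * (harm #|` external t| - 1) * (ext t + 1) + 2) / (ext t * (ext t + 1) ^+ 2).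
  by rewrite (varrest_add gt ve) /varrest; field; rewrite !gt_eqF//; lra.
split => //.
  rewrite -subr_ge0 e' divr_ge0//; last by rewrite mulr_ge0 ?sqr_ge0//; lra.
  by rewrite addr_ge0// mulr_ge0//; lra.
rewrite e; apply: (@le_trans _ _ (varrest t / (ext t + 1))).
  by rewrite gerBl divr_ge0// sqr_ge0.
by rewrite ler_wpM2l// lef_pV2 ?posrE; lra.
Qed.

End Potentials.

(** * Lindeberg replacement *)

Section Lindeberg.
Context {R : realType}.
Implicit Types (t : {fset word}).
Local Notation cW := (@cW R).

Variables (K : R) (g g1 g2 : R -> R) (hg : smooth3 K g g1 g2).
Variables (a c p0 rho : R) (a0 : 0 <= a) (p0_gt0 : 0 < p0).

(** Expected value of the test function g at a L + c, L being the limit of [mart],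
    if the future of the martingale were normal with variance [varrest]. *)
Definition smoothed t : R := heat (a ^+ 2 * varrest t) g (a * mart t + c).

(** The three terms pay, in this order, for the mismatch between the true
    conditional variance and the decrement of [varrest], for the third moments of
    the martingale increments, and for the third moments of the Gaussian
    increments that replace them. The numbers p0 and rho are the number of leaves
    and the scaled [varrest] at the starting time; they bound the later ones, so
    the coefficients stay constant along the path. *)
Definition lindeberg_bound t : R :=
  K * (a ^+ 2 * (energy t / ext t) + 18 * cW * a ^+ 3 / p0 * decayW t
       + gauss_abs3 * Num.sqrt (rho / p0) * (a ^+ 2 * varrest t)).

Let K0 : 0 <= K. Proof. by case: hg => /bdd_lip_ge0. Qed.

Let admissible t := p0 <= ext t /\ a ^+ 2 * varrest t <= rho.

Lemma grown_external n t : grown n t -> exists v, v \in external t.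
Proof.
move=> gt; have : (0 < #|` external t|)%N by rewrite (card_external_grown gt).
by rewrite cardfs_gt0 => /fset0Pn[v]; exists v.
Qed.

(** From y^3 <= (y^2 + y^4) / 2 for y >= 0. *)
Lemma cmoment3_le n t : grown n t ->
  avg t (fun k => `|k%:R - mean t| ^+ 3) <= 9 * cW * expmean t.
Proof.
move=> gt; apply: (@le_trans _ _ ((cmoment 2 t + cmoment 4 t) / 2)).
  rewrite /cmoment -avgD mulrC -avgZ; apply: avg_le => k.
  rewrite -[X in _ <= _ * (X + _)]real_normK ?num_real//.
  rewrite -[(k%:R - mean t) ^+ 4]/((k%:R - mean t) ^+ (2 * 2)) exprM -[X in _ <= _ * (_ + X ^+ 2)]real_normK ?num_real//.
  have := normr_ge0 (k%:R - mean t : R); move: (`|_|) => y y0.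
  have := mulr_ge0 (sqr_ge0 y) (sqr_ge0 (y - 1)); nra.
have := @cmoment2_le R _ _ gt; have := @cmoment4_le R _ _ gt; have := @moment4_le R t.
have W0 : 0 <= expmean t :> R by have := @expmean_ge1 R _ _ gt; lra.
by have := mulr_ge0 (@cW_ge0 R) W0; lra.
Qed.

(** The leaf-depth variance is [spread] plus [mart] plus 2 H_p, and 2 H_p cancels
    against the decrement of [varrest]. *)
Lemma variance_mismatch n t v : grown n t -> v \in external t ->
  `|cmoment 2 t / (ext t + 1) ^+ 2 - (varrest t - varrest (v |` t)%fset)| <=
  2 * (energy t / (ext t + 1) ^+ 2) :> R.
Proof.
move=> gt ve; have p2 := @ext_ge2 R _ _ gt.
rewrite (varrest_incr gt ve) -mulrBl normrM [X in _ * X]ger0_norm ?invr_ge0 ?sqr_ge0//.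
rewrite mulrA; apply: ler_wpM2r; first by rewrite invr_ge0 sqr_ge0.
apply: le_trans (energy_abs t).
have h1 : 1 <= harm #|` external t| :> R by apply: harm_ge1; rewrite (card_external_grown gt).
have h2 : harm #|` external t| / ext t <= 1 :> R.
  by rewrite ler_pdivrMr; [rewrite mul1r; exact: harm_le|lra].
have h3 : 0 <= harm #|` external t| / ext t :> R by apply: divr_ge0; lra.
have -> : cmoment 2 t - (2 * harm #|` external t| + (2 * harm #|` external t| / ext t - 2)) =
    spread t + mart t + (2 - 2 * (harm #|` external t| / ext t)) :> R.
  by rewrite /spread /mart; ring.
apply: le_trans (ler_normD _ _) _; apply: lerD; first exact: ler_normD.
by rewrite ger0_norm; lra.
Qed.

(** With r' the next value of [varrest] and G the test function smoothed up to it,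
    [smoothed] is now the mean of G over a Gaussian step of variance tau2 (by
    [heat_add]), and after one transition the mean of G over a martingale
    increment b y. Both are expanded to third order around X: the first order
    terms vanish, the second order terms differ by [variance_mismatch], and the
    decreases of the three potentials in [lindeberg_bound] cover the remainders. *)
Lemma step_smoothed n t : grown n t -> admissible t ->
  `|step smoothed t - smoothed t| + step lindeberg_bound t <= lindeberg_bound t.
Proof.
move=> gt [p0p rrho]; have p2 := @ext_ge2 R _ _ gt.
have := a0; have := p0_gt0 => p0pos a_ge0.
have p1 : 0 < ext t + 1 :> R by lra.
have pn0 : ext t != 0 :> R by rewrite gt_eqF//; lra.
have p1n0 : ext t + 1 != 0 :> R by rewrite gt_eqF.
have p0n0 : p0 != 0 by rewrite gt_eqF.
have [v0 ve0] := grown_external gt.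
have [r0 rle rdiff] := @varrest_bounds R _ _ _ gt ve0.
have s3 := variance_mismatch gt ve0.
have r'0 : 0 <= varrest (v0 |` t)%fset :> R.
  have gt' := grownS gt ve0; have [v1 ve1] := grown_external gt'.
  by have [] := @varrest_bounds R _ _ _ gt' ve1.
have r'E v : v \in external t -> varrest (v |` t)%fset = varrest (v0 |` t)%fset :> R.
  by move=> ve; rewrite !(varrest_add gt).
move: (varrest (v0 |` t)%fset) => r' in rle rdiff s3 r'0 r'E.
have [tau2 tau2E] : exists x, x = a ^+ 2 * (varrest t - r') by exists (a ^+ 2 * (varrest t - r')).
have tau20 : 0 <= tau2 by rewrite tau2E; apply: mulr_ge0; [exact: sqr_ge0|lra].
have r'a0 : 0 <= a ^+ 2 * r' by apply: mulr_ge0; [exact: sqr_ge0|].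
have G3 := smooth3_heat (a ^+ 2 * r') hg.
have sB : step lindeberg_bound t = K * (a ^+ 2 * step (fun t' => energy t' / ext t') t
   + 18 * cW * a ^+ 3 / p0 * step decayW t + gauss_abs3 * Num.sqrt (rho / p0) * (a ^+ 2 * r')).
  rewrite /lindeberg_bound stepZ 2!stepD !stepZ.
  by rewrite (@eq_step _ _ _ (fun=> r') r'E) (step_cst _ gt).
have [G [G1 [G2 [EG {}G3]]]] : exists G G1 G2, G = heat (a ^+ 2 * r') g /\ smooth3 K G G1 G2.
  by exists (heat (a ^+ 2 * r') g), (heat (a ^+ 2 * r') g1), (heat (a ^+ 2 * r') g2).
have [X XE] : exists x, x = a * mart t + c by exists (a * mart t + c).
have [b bE] : exists x, x = a / (ext t + 1) by exists (a / (ext t + 1)).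
have b0 : 0 <= b by rewrite bE; apply: divr_ge0; lra.
have b2 : b ^+ 2 = a ^+ 2 / (ext t + 1) ^+ 2 by rewrite bE exprMn exprVn.
have b3 : b ^+ 3 = a ^+ 3 / (ext t + 1) ^+ 2 / (ext t + 1).
  by rewrite bE; field; rewrite ?p1n0.
(* The new value of [varrest] does not depend on the chosen leaf, so the same G
   serves for all of them. *)
have sE : step smoothed t = avg t (fun k => G (X + b * (k%:R - mean t))).
  apply: stepE => v ve; rewrite /smoothed (r'E _ ve) -EG (mart_add gt ve) XE bE.
  by congr G; field; rewrite ?p1n0.
have s2 : `|smoothed t - (G X + G2 X * tau2 / 2)| <= K * gauss_abs3 * Num.sqrt tau2 ^+ 3.
  have -> : smoothed t = heat tau2 G X.
    rewrite /smoothed -XE EG (heat_add _ tau20 r'a0 (smooth3_0 hg)).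
    by congr (heat _ g X); rewrite tau2E; ring.
  by rewrite opprD addrA; exact: heat_taylor tau20 G3.
have W0 : 0 <= expmean t :> R by have := @expmean_ge1 R _ _ gt; lra.
have s1 : `|avg t (fun k => G (X + b * (k%:R - mean t))) - (G X + G2 X * (b ^+ 2 * cmoment 2 t) / 2)|
   <= K * b ^+ 3 * (9 * cW * expmean t).
  have -> : G X + G2 X * (b ^+ 2 * cmoment 2 t) / 2 =
     avg t (fun k => G X + (G1 X * b) * (k%:R - mean t) + (G2 X * b ^+ 2 / 2) * (k%:R - mean t) ^+ 2).
    by rewrite (avg_quad _ _ _ gt); ring.
  rewrite -[- avg _ _]mulN1r -avgZ -avgD.
  apply: le_trans (avg_norm _ _) _.
  apply: (@le_trans _ _ (avg t (fun k => K * b ^+ 3 * `|k%:R - mean t| ^+ 3))); last first.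
    rewrite avgZ; apply: ler_wpM2l; last exact: (cmoment3_le gt).
    by apply: mulr_ge0; [exact: K0|exact: exprn_ge0].
  apply: avg_le => k; have := smooth3_taylor G3 X (b * (k%:R - mean t)).
  rewrite normrM (ger0_norm b0) exprMn mulrA; move: (k%:R - mean t) => y.
  by congr (`|_| <= _); ring.
have G2K : `|G2 X| <= K by have [_ _ []] := G3.
(* The Gaussian step has variance at most rho / p0: one of its three factors is
   bounded by the square root of this, the other two form the decrement of the
   last potential. *)
have s4 : K * gauss_abs3 * Num.sqrt tau2 ^+ 3 <= K * (gauss_abs3 * Num.sqrt (rho / p0) * tau2).
  rewrite -mulrA; apply: ler_wpM2l; first exact: K0.
  rewrite -mulrA; apply: ler_wpM2l; first exact: gauss_abs3_ge0.
  rewrite exprS (sqr_sqrtr tau20); apply: ler_wpM2r; first exact: tau20.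
  apply: ler_wsqrtr.
  have hx : tau2 <= a ^+ 2 * varrest t / ext t.
    by rewrite tau2E -mulrA; apply: ler_wpM2l; [exact: sqr_ge0|].
  apply: le_trans hx _; apply: ler_pM; [|by rewrite invr_ge0; lra|exact: rrho|].
    by apply: mulr_ge0; [exact: sqr_ge0|].
  by rewrite lef_pV2 ?posrE; [exact: p0p|lra|lra].
have s5 : K * b ^+ 3 * (9 * cW * expmean t) <=
    K * (18 * cW * a ^+ 3 / p0 * (expmean t / (ext t + 1) ^+ 2 / 2)).
  rewrite -mulrA; apply: ler_wpM2l; first exact: K0.
  have -> : b ^+ 3 * (9 * cW * expmean t) = (9 * cW * a ^+ 3 * expmean t / (ext t + 1) ^+ 2) / (ext t + 1).
    by rewrite b3; ring.
  have -> : 18 * cW * a ^+ 3 / p0 * (expmean t / (ext t + 1) ^+ 2 / 2) =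
     (9 * cW * a ^+ 3 * expmean t / (ext t + 1) ^+ 2) / p0.
    by field; rewrite ?p0n0 ?p1n0.
  apply: ler_wpM2l; last by rewrite lef_pV2 ?posrE; [|lra|lra]; lra.
  apply: divr_ge0; last exact: sqr_ge0.
  apply: mulr_ge0; last exact: W0.
  by apply: mulr_ge0; [have := @cW_ge0 R; lra|exact: exprn_ge0].
have s6 : `|G2 X * (b ^+ 2 * cmoment 2 t) / 2 - G2 X * tau2 / 2| <= K * (b ^+ 2 * energy t).
  have -> : G2 X * (b ^+ 2 * cmoment 2 t) / 2 - G2 X * tau2 / 2 =
     (G2 X * (cmoment 2 t / (ext t + 1) ^+ 2 - (varrest t - r'))) * (a ^+ 2 / 2).
    by rewrite b2 tau2E; ring.
  have a2 : 0 <= a ^+ 2 / 2 by apply: divr_ge0; [exact: sqr_ge0|].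
  rewrite 2!normrM (ger0_norm a2).
  have := ler_wpM2r a2 (ler_pM (normr_ge0 _) (normr_ge0 _) G2K s3).
  by move=> /le_trans; apply; rewrite b2 le_eqVlt; apply/orP; left; apply/eqP; field; rewrite ?p1n0.
have h1 := @step_decayW R _ _ gt; have h2 := @step_energy_ext R _ _ gt.
rewrite sE sB.
move: (avg _ _) s1 => A s1.
have tri : `|A - smoothed t| <= K * b ^+ 3 * (9 * cW * expmean t) + K * (b ^+ 2 * energy t) +
   K * gauss_abs3 * Num.sqrt tau2 ^+ 3.
  move: s1 s2 s6; move: (_ / 2) (_ / 2) => u1 u2.
  move: (K * _ * _) (K * (_ * energy t)) (K * _ * _) (smoothed t) (G X) => e1 e2 e3 x y.
  rewrite !ler_norml => /andP[? ?] /andP[? ?] /andP[? ?].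
  by apply/andP; split; lra.
rewrite /lindeberg_bound.
have a2 : b ^+ 2 * energy t = a ^+ 2 * (energy t / (ext t + 1) ^+ 2) by rewrite b2; ring.
have h3 := ler_wpM2l (sqr_ge0 a) h2; rewrite mulrDr -a2 in h3.
have c1 : 0 <= 18 * cW * a ^+ 3 / p0.
  apply: divr_ge0; last exact: ltW.
  by apply: mulr_ge0; [have := @cW_ge0 R; lra|exact: exprn_ge0].
have h4 := ler_wpM2l c1 h1; rewrite mulrDr in h4.
have := ler_wpM2l K0 h3; have := ler_wpM2l K0 h4.
move: tri s4 s5; rewrite tau2E; clear.
move: (b ^+ 2 * _) (K * b ^+ 3 * _) (K * gauss_abs3 * _) => x1 x2 x4.
move: (18 * cW * _ / _) (gauss_abs3 * Num.sqrt _) => w1 w2.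
move: (expmean t / _ / 2) (`|_|) (step _ _) (step _ _) (energy t / _) (decayW t) (varrest t) => x3 x9 x5 x6 x7 x8 x10.
move: (a ^+ 2) => x11.
move: K => k; lra.
Qed.

(** Telescoping: the error of the later steps is at most the mean of
    [lindeberg_bound] after one step, which [step_smoothed] subtracts from its
    present value. *)
Lemma iter_step_smoothed m n t : grown n t -> admissible t ->
  `|iter m step smoothed t - smoothed t| <= lindeberg_bound t.
Proof.
elim: m n t => [|m IH] n t gt adm.
  rewrite /= subrr normr0; apply: mulr_ge0; first exact: K0.
  have r0 : 0 <= varrest t :> R.
    by have [v ve] := grown_external gt; have [] := @varrest_bounds R _ _ _ gt ve.
  have p2 := @ext_ge2 R _ _ gt; have e2 := @energy_ge2 R t.
  have := a0; have := p0_gt0 => p0pos a_ge0.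
  apply: addr_ge0; first apply: addr_ge0.
  - by apply: mulr_ge0; [exact: sqr_ge0|apply: divr_ge0; lra].
  - apply: mulr_ge0; last exact: decayW_ge0.
    apply: divr_ge0; last exact: ltW.
    by apply: mulr_ge0; [have := @cW_ge0 R; lra|exact: exprn_ge0].
  - apply: mulr_ge0; first by apply: mulr_ge0; [exact: gauss_abs3_ge0|exact: sqrtr_ge0].
    by apply: mulr_ge0; [exact: sqr_ge0|].
rewrite iterS.
have h : `|step (iter m step smoothed) t - step smoothed t| <= step lindeberg_bound t.
  have -> : step (iter m step smoothed) t - step smoothed t =
      step (fun t' => iter m step smoothed t' + -1 * smoothed t') t.
    by rewrite stepD stepZ mulN1r.
  apply: le_trans (step_norm _ _) _; apply: step_le => v ve.
  rewrite mulN1r; apply: IH; first exact: grownS gt ve.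
  case: adm => p0p arho; split; first by rewrite (@ext_add R _ _ _ gt ve); lra.
  have [_ rle _] := @varrest_bounds R _ _ _ gt ve.
  by apply: le_trans arho; apply: ler_wpM2l; first exact: sqr_ge0.
apply: le_trans (step_smoothed gt adm).
rewrite -(subrK (step smoothed t) (step (iter m step smoothed) t)) -addrA.
by apply: le_trans (ler_normD _ _) _; rewrite [leRHS]addrC; apply: lerD.
Qed.

End Lindeberg.

(** * Histories and their probabilities *)

Notation root_tree := ([fset [::]]%fset : {fset word}).

(** The possible values t 1, ..., t n of the first n trees. *)
Definition history_path (n : nat) (t : nat -> {fset word}) : Prop :=
  t 1%N = root_tree /\
  forall k, (1 <= k < n)%N -> exists2 v, v \in external (t k) & t k.+1 = (v |` t k)%fset.

Definition extend (t : nat -> {fset word}) (n : nat) (s : {fset word}) (k : nat) :=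
  if k == n.+1 then s else t k.

Lemma history_path_grown n t k : history_path n t -> (1 <= k <= n)%N -> grown k (t k).
Proof.
move=> [t1 tS]; elim: k => // k IH /andP[_ kn].
case: k IH kn => [|k] IH kn; first by rewrite t1; exact: grown1.
have [|v ve ->] := tS k.+1; first by rewrite kn.
by apply: grownS => //; apply: IH; exact: ltnW.
Qed.

Lemma extend_old t n s k : (k <= n)%N -> extend t n s k = t k.
Proof. by move=> kn; rewrite /extend ltn_eqF. Qed.

Lemma extend_new t n s : extend t n s n.+1 = s.
Proof. by rewrite /extend eqxx. Qed.

Lemma history_path_extend n t v : (1 <= n)%N -> history_path n t -> v \in external (t n) ->
  history_path n.+1 (extend t n (v |` t n)%fset).
Proof.
move=> n1 [t1 tS] ve; split=> [|k /andP[k1 kn]]; first by rewrite extend_old.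
move: (kn); rewrite ltnS leq_eqVlt => /predU1P[->|kn'].
  by exists v; rewrite ?extend_new !extend_old.
have [|v' v'e e] := tS k; first by rewrite k1.
by exists v'; rewrite !extend_old// ltnW.
Qed.

Section Process.
Context d (T : measurableType d) (R : realType) (P : probability T R).
Variables (X : nat -> T -> {fset word}) (hX : is_rbst P X).

(** The event of a given history. These events generate the conditioning
    sigma-algebra, so conditioning on it is elementary. *)
Definition atom n (t : nat -> {fset word}) : set T :=
  [set w | forall k, (1 <= k <= n)%N -> X k w = t k].

Lemma measurable_atom n t : measurable (atom n t).
Proof.
rewrite (_ : atom n t = \bigcap_(k in [set k | (1 <= k <= n)%N]) (X k @^-1` [set t k])).
  apply: bigcap_measurableType => k /= /andP[k1 _].
  exact: rbst_measurable hX _ _ k1.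
by apply/seteqP; split => w; exact.
Qed.

Lemma atom1 t : t 1%N = root_tree -> atom 1 t = setT.
Proof.
move=> t1; apply/seteqP; split => // w _ k; rewrite -eqn_leq => /eqP <-.
by rewrite t1 (rbst_init hX).
Qed.

Lemma atomS n t s : atom n.+1 (extend t n s) = atom n t `&` X n.+1 @^-1` [set s].
Proof.
apply/seteqP; split => w.
  move=> h; split=> [k /andP[k1 kn]|].
    by rewrite h ?k1 ?leqW// extend_old.
  by rewrite /= h ?extend_new// leqnn.
move=> [h /= e] k /andP[k1]; rewrite leq_eqVlt => /predU1P[->|kn].
  by rewrite extend_new.
by rewrite extend_old// h// k1.
Qed.

Lemma prob_atomS n t v : (1 <= n)%N -> history_path n t -> v \in external (t n) ->
  P (atom n.+1 (extend t n (v |` t n)%fset)) = (P (atom n t) * (ext (t n))^-1%:E)%E.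
Proof. by move=> n1 ht ve; rewrite atomS -(rbst_step hX n1 ve). Qed.

Lemma prob_atom_gt0 n t : (1 <= n)%N -> history_path n t -> (0 < P (atom n t))%E.
Proof.
case: n => // n _; elim: n => [|n IH] ht.
  by rewrite atom1 ?probability_setT//; case: ht.
have [|v ve e] := ht.2 n.+1; first by rewrite /= ltnSn.
have ht' : history_path n.+1 t.
  by split; [case: ht|move=> k /andP[k1 kn]; apply: ht.2; rewrite k1 ltnW].
have -> : atom n.+2 t = atom n.+2 (extend t n.+1 (v |` t n.+1)%fset).
  apply/seteqP; split => w h k /andP[k1 kn]; rewrite h ?k1//; move: kn;
    rewrite leq_eqVlt => /predU1P[->|kn]; rewrite ?extend_new// ?extend_old// -ltnS//.
rewrite prob_atomS// mule_gt0// ?IH// lte_fin invr_gt0.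
by apply: (ext_gt0 (n := n.+1)); apply: (history_path_grown ht'); rewrite leqnn.
Qed.

Lemma prob_atom_fin n t : P (atom n t) \is a fin_num.
Proof. by apply: fin_num_measure; exact: measurable_atom. Qed.

(** The events of the one-step extensions are disjoint and their probabilities,
    each a fraction 1 / p of that of the history, add up to it: they exhaust the
    history up to a null set. *)
Lemma ge0_integral_atom n t (f : T -> \bar R) : (1 <= n)%N -> history_path n t ->
  measurable_fun setT f -> (forall w, 0 <= f w)%E ->
  (\int[P]_(w in atom n t) f w =
   \sum_(v <- external (t n))
     \int[P]_(w in atom n.+1 (extend t n (v |` t n)%fset)) f w)%E.
Proof.
move=> n1 ht mf f0.
pose F v := atom n.+1 (extend t n (v |` t n)%fset).
have mF v : measurable (F v) by exact: measurable_atom.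
have gt : grown n (t n) by apply: (history_path_grown ht); rewrite n1 leqnn.
have tF : trivIset [set` external (t n)] F.
  move=> u v /= /in_external[ut _] /in_external[vt _] [w []].
  rewrite /F !atomS => -[_ /= e] [_ /= e'].
  have : u \in (v |` t n)%fset by rewrite -e' e in_fset1U eqxx.
  by rewrite in_fset1U (negbTE ut) orbF => /eqP.
have DU := fun f mf f0 => @ge0_integral_bigsetU _ _ _ P _ F f (external (t n)) mF (fset_uniq _) tF mf f0.
set D := \big[setU/set0]_(i <- external (t n)) F i in DU.
have mD : measurable D by apply: bigsetU_measurable => v _.
have Datom : D `<=` atom n t.
  by rewrite /D; elim/big_ind: _ => // [A B HA HB w []|v _]; [exact: HA|exact: HB|rewrite /F atomS => w []].
have PD : P D = P (atom n t).
  have := DU (cst 1%E); rewrite integral_cst// mul1e => ->//.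
  under eq_bigr do rewrite integral_cst// mul1e.
  transitivity (\sum_(v <- external (t n)) (fine (P (atom n t)) * (ext (t n))^-1)%:E)%E.
    rewrite big_seq [RHS]big_seq; apply: eq_bigr => v ve.
    by rewrite /= /F prob_atomS// EFinM fineK// prob_atom_fin.
  rewrite sumEFin big_const_seq count_predT iter_addr addr0 -mulr_natr.
  by rewrite mulrVK ?fineK// ?prob_atom_fin// unitfE gt_eqF// (ext_gt0 gt).
have aD : atom n t `&` D = D.
  by apply/seteqP; split => [w []//|w Dw]; split => //; exact: Datom.
have PN : P (atom n t `\` D) = 0%E.
  have Pfin : (P (atom n t) < +oo)%E by rewrite ltey_eq prob_atom_fin.
  transitivity (P (atom n t) - P D)%E.
    by rewrite -[in RHS]aD; exact: (measureD (measurable_atom n t) mD Pfin).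
  by rewrite PD subee// prob_atom_fin.
rewrite (@ge0_negligible_integral _ _ _ P _ (atom n t `\` D))//.
- rewrite setDD aD DU//; exact: measurable_funTS.
- by apply: measurableD => //; exact: measurable_atom.
- exact: measurable_atom.
- exact: measurable_funTS.
Qed.

Lemma prob_atom_split n t (E : set T) : (1 <= n)%N -> history_path n t -> measurable E ->
  (P (atom n t `&` E) = \sum_(v <- external (t n))
     P (atom n.+1 (extend t n (v |` t n)%fset) `&` E))%E.
Proof.
move=> n1 ht mE.
have h (A : set T) : measurable A -> P (A `&` E) = (\int[P]_(w in A) (\1_E w)%:E)%E.
  by move=> mA; rewrite integral_indic// setIC.
rewrite h; last exact: measurable_atom.
rewrite (ge0_integral_atom n1 ht)//; last first.
  by apply/measurable_EFinP; exact: measurable_indic.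
by apply: eq_bigr => v _; rewrite h//; exact: measurable_atom.
Qed.

(** Markov property: conditional expectations given a history are iterates of the
    transition operator. *)
Lemma integral_atom_step m n t (f : {fset word} -> R) : (1 <= n)%N -> history_path n t ->
  (forall s, 0 <= f s) ->
  (\int[P]_(w in atom n t) (f (X (n + m) w))%:E =
   P (atom n t) * (iter m step f (t n))%:E)%E.
Proof.
move=> + + f0; elim: m n t => [|m IH] n t n1 ht.
  rewrite addn0 (eq_integral (fun=> (f (t n))%:E)); last first.
    by move=> w; rewrite inE => /(_ n); rewrite leqnn n1 => ->.
  by rewrite (integral_cst P (measurable_atom n t) (f (t n))%:E) muleC.
have mfX : measurable_fun setT (fun w => (f (X (n + m.+1) w))%:E).
  apply/measurable_EFinP => _ A _; rewrite setTI.
  by apply: (rbst_measurable hX (f @^-1` A)); rewrite addnS.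
rewrite (ge0_integral_atom n1 ht mfX)//.
under eq_bigr do rewrite -addSnnS.
transitivity (\sum_(v <- external (t n))
    (fine (P (atom n t)) * ((ext (t n))^-1 * iter m step f (v |` t n)%fset))%:E)%E; last first.
  rewrite sumEFin iterS /step -mulr_sumr -mulr_sumr EFinM fineK//.
  exact: prob_atom_fin.
rewrite big_seq [RHS]big_seq; apply: eq_bigr => v ve; rewrite IH//; last exact: history_path_extend.
by rewrite extend_new prob_atomS// !EFinM fineK ?prob_atom_fin// muleA.
by move=> w; rewrite lee_fin.
Qed.

End Process.

(** * A maximal inequality *)

Section AlmostSure.
Context d (T : measurableType d) (R : realType) (P : probability T R).
Variables (X : nat -> T -> {fset word}) (hX : is_rbst P X).

(** A bound by u of the conditional probability of E given the first n trees,
    stated on histories to avoid dividing by their probabilities. *)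
Definition conditional_bound n (E : set T) (u : {fset word} -> R) :=
  forall t, history_path n t -> (P (atom X n t `&` E) <= P (atom X n t) * (u (t n))%:E)%E.

Lemma conditional_bound_step n E u : (1 <= n)%N -> measurable E ->
  conditional_bound n.+1 E u -> conditional_bound n E (step u).
Proof.
move=> n1 mE hE t ht; rewrite (prob_atom_split hX n1 ht mE).
apply: (@le_trans _ _ (\sum_(v <- external (t n))
    (fine (P (atom X n t)) * ((ext (t n))^-1 * u (v |` t n)%fset))%:E)%E).
  rewrite big_seq [leRHS]big_seq; apply: lee_sum => v ve.
  apply: le_trans (hE _ (history_path_extend n1 ht ve)) _.
  by rewrite extend_new (prob_atomS hX n1 ht ve) !EFinM fineK ?(prob_atom_fin hX)// muleA.
rewrite sumEFin /step -mulr_sumr -mulr_sumr EFinM fineK//.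
exact: prob_atom_fin hX _ _.
Qed.

Lemma conditional_bound_iter m n E u : (1 <= n)%N -> measurable E ->
  conditional_bound (n + m) E u -> conditional_bound n E (iter m step u).
Proof.
elim: m n u => [|m IH] n u n1 mE hE; first by rewrite addn0 in hE.
rewrite iterSr; apply: IH => //; apply: conditional_bound_step => //.
  by rewrite (leq_trans n1)// leq_addr.
by rewrite -addnS.
Qed.

Lemma conditional_bound_prob n E u : measurable E ->
  conditional_bound n.+1 E u -> (P E <= (iter n step u root_tree)%:E)%E.
Proof.
move=> mE hE; rewrite -add1n in hE.
have := @conditional_bound_iter n 1 E u (leqnn 1) mE hE (fun=> root_tree).
rewrite (atom1 hX)// setTI probability_setT mul1e; apply.
by split=> // k; case: k => [|[|k]].
Qed.

Lemma step_mono n t (f g : {fset word} -> R) : grown n t ->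
  (forall t', grown n.+1 t' -> f t' <= g t') -> step f t <= step g t.
Proof. by move=> gt fg; apply: step_le => v ve; apply: fg; exact: grownS. Qed.

Lemma iter_step_mono m n t (f g : {fset word} -> R) : grown n t ->
  (forall t', grown (n + m) t' -> f t' <= g t') -> iter m step f t <= iter m step g t.
Proof.
elim: m n t => [|m IH] n t gt fg; first by apply: fg; rewrite addn0.
rewrite !iterS; apply: (step_mono gt) => t' gt'; apply: IH gt' _ => s gs.
by apply: fg; rewrite addnS -addSn.
Qed.

Lemma iter_step_super m n t (f : {fset word} -> R) : grown n t ->
  (forall n t, grown n t -> step f t <= f t) -> iter m step f t <= f t.
Proof.
move=> + fs; elim: m n t => [//|m IH] n t gt; rewrite iterS.
by apply: le_trans (fs _ _ gt); apply: (step_mono gt) => t'; exact: IH.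
Qed.

Lemma iter_step_scale m t c (f : {fset word} -> R) :
  iter m step (fun t' => c * f t') t = c * iter m step f t.
Proof.
elim: m t => // m IH t; rewrite !iterS -stepZ.
by congr (step _ t); apply/funext => t'; rewrite IH.
Qed.

Definition exceeds n (s : {fset word} -> R) (lam : R) m : set T :=
  [set w | exists2 k, (k <= m)%N & lam <= s (X (n + k) w)].

Lemma measurable_exceeds n s lam m : (1 <= n)%N -> measurable (exceeds n s lam m).
Proof.
move=> n1; rewrite (_ : exceeds n s lam m =
    \bigcup_(k in [set k | (k <= m)%N]) X (n + k) @^-1` [set t | lam <= s t]).
  apply: bigcup_measurable => k _; apply: (rbst_measurable hX).
  by rewrite (leq_trans n1)// leq_addr.
by apply/seteqP; split => w [k /= km h]; exists k.
Qed.

(** Ville's inequality, by induction on the horizon m: either s already exceeds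
    lam and the bound is at least 1, or the event is about the next tree and s is
    a supermartingale. *)
Lemma maximal_ineq s lam m n : 0 < lam -> (1 <= n)%N -> (forall t, 0 <= s t) ->
  (forall n t, grown n t -> step s t <= s t) ->
  conditional_bound n (exceeds n s lam m) (fun t => s t / lam).
Proof.
move=> lam0 + s0 ss; elim: m n => [|m IH] n n1 t ht.
all: have [big|small] := leP lam (s (t n)).
all: try (apply: (@le_trans _ _ (P (atom X n t)));
  [apply: le_measure; rewrite ?inE; [apply: measurableI; [exact: measurable_atom hX _ _|exact: measurable_exceeds]|exact: measurable_atom hX _ _|exact: subIsetl]
  |by rewrite -[leLHS]mule1; apply: lee_wpmul2l; rewrite ?measure_ge0// lee_fin ler_pdivlMr// mul1r]).
  rewrite (_ : _ `&` _ = set0) ?measure0; last first.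
    apply/seteqP; split => // w [ha [k]]; rewrite leqn0 => /eqP ->; rewrite addn0.
    by rewrite (ha n) ?n1 ?leqnn// leNgt small.
  by apply: mule_ge0; rewrite ?measure_ge0// lee_fin divr_ge0// ltW.
have -> : atom X n t `&` exceeds n s lam m.+1 = atom X n t `&` exceeds n.+1 s lam m.
  apply/seteqP; split => w [ha [k km h]]; split => //.
    case: k km h => [|k] km h; last by exists k => //; rewrite addSnnS.
    by move: h; rewrite addn0 (ha n) ?n1 ?leqnn// leNgt small.
  by exists k.+1 => //; rewrite -addSnnS.
have := conditional_bound_step n1 (measurable_exceeds s lam m (ltn0Sn n)) (IH n.+1 (ltn0Sn n)) ht.
move=> /le_trans; apply; apply: lee_wpmul2l; rewrite ?measure_ge0// lee_fin.
have gt : grown n (t n) by apply: (history_path_grown ht); rewrite n1 leqnn.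
rewrite (_ : step _ _ = step (fun t' => lam^-1 * s t') (t n)).
  by rewrite stepZ mulrC; apply: ler_wpM2r; [rewrite invr_ge0 ltW|exact: ss gt].
by congr (step _ _); apply/funext => t'; rewrite mulrC.
Qed.

Definition ever_exceeds n (s : {fset word} -> R) (lam : R) : set T :=
  [set w | exists k, lam <= s (X (n + k) w)].

Lemma ever_exceedsE n s lam : ever_exceeds n s lam = \bigcup_m exceeds n s lam m.
Proof.
apply/seteqP; split => w; first by move=> [k h]; exists k => //; exists k.
by move=> [m _ [k _ h]]; exists k.
Qed.

Lemma measurable_ever_exceeds n s lam : (1 <= n)%N -> measurable (ever_exceeds n s lam).
Proof.
move=> n1; rewrite ever_exceedsE; apply: bigcup_measurable => k _.
exact: measurable_exceeds.
Qed.

Lemma ever_exceeds_bound s lam n : 0 < lam -> (1 <= n)%N -> (forall t, 0 <= s t) ->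
  (forall n t, grown n t -> step s t <= s t) ->
  conditional_bound n (ever_exceeds n s lam) (fun t => s t / lam).
Proof.
move=> lam0 n1 s0 ss t ht.
have mE m : measurable (atom X n t `&` exceeds n s lam m).
  by apply: measurableI; [exact: measurable_atom hX _ _|exact: measurable_exceeds].
have e : atom X n t `&` ever_exceeds n s lam = \bigcup_m (atom X n t `&` exceeds n s lam m).
  by rewrite ever_exceedsE setI_bigcupr.
have nd : nondecreasing_seq (fun m => atom X n t `&` exceeds n s lam m).
  move=> i j ij; apply/subsetPset => w [ha [k ki h]]; split => //.
  by exists k => //; exact: leq_trans ij.
have := @nondecreasing_cvg_mu _ _ _ P _ mE (bigcup_measurable (fun k _ => mE k)) nd.
rewrite -e => /cvg_lim <-//; apply: lime_le.
  by apply/cvg_ex; eexists; apply: nondecreasing_cvg_mu => //; exact: bigcup_measurable.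
by apply: nearW => m /=; exact: (maximal_ineq _ lam0 n1 s0 ss ht).
Qed.

End AlmostSure.

(** * Almost sure behaviour of the process *)

Section AlmostSureFacts.
Context d (T : measurableType d) (R : realType) (P : probability T R).
Variables (X : nat -> T -> {fset word}) (hX : is_rbst P X).

Lemma le0_of_bounds (x : \bar R) (u : nat -> R) :
  (forall k, (x <= (u k)%:E)%E) -> u @ \oo --> 0 -> (x <= 0)%E.
Proof.
move=> xu u0; have u0' : (u k)%:E @[k --> \oo] --> (0 : R)%:E.
  by apply: cvg_EFin => //; exact: nearW.
have -> : (0 = lim ((u k)%:E @[k --> \oo]))%E by apply/esym/cvg_lim.
apply: lime_ge; first by apply/cvg_ex; exists 0%:E.
exact: nearW.
Qed.

Lemma negligible_bounds (N : set T) (E : nat -> set T) (u : nat -> R) :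
  (forall k, measurable (E k)) -> (forall k, N `<=` E k) ->
  (forall k, (P (E k) <= (u k)%:E)%E) -> u @ \oo --> 0 -> P.-negligible N.
Proof.
move=> mE NE Eu u0; exists (\bigcap_k E k).
have mI : measurable (\bigcap_k E k) by exact: bigcapT_measurable.
split => //; last by move=> w Nw k _; exact: NE.
apply/eqP; rewrite eq_le measure_ge0 andbT; apply: (le0_of_bounds _ u0) => k.
apply: le_trans (Eu k); apply: le_measure; rewrite ?inE//.
by move=> w; exact.
Qed.

(** By [prob_atom_split], no possible history leaves room for a next tree that is
    not a one-leaf extension. *)
Lemma ae_growing : {ae P, forall w, forall n, (1 <= n)%N ->
  exists2 v, v \in external (X n w) & X n.+1 w = (v |` X n w)%fset}.
Proof.
apply/ae_foralln => -[|n]; first exact: aeW.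
(* There are countably many trees, which makes the event measurable. *)
pose good s := X n.+1 @^-1` [set s] `&`
  X n.+2 @^-1` [set s' | exists2 v, v \in external s & s' = (v |` s)%fset].
have mE : measurable (~` (\bigcup_s good s)).
  apply: measurableC; apply: countable_bigcupT_measurable => // s.
  by apply: measurableI; exact: (rbst_measurable hX).
exists (~` (\bigcup_s good s)); split => //.
  apply/eqP; rewrite eq_le measure_ge0 andbT.
  have := @conditional_bound_prob _ _ _ _ _ hX n _ (fun=> 0) mE.
  have -> : iter n step (fun=> 0) root_tree = 0 :> R.
    elim: (n) (root_tree) => // m IH t; rewrite iterS /step.
    by rewrite big1 ?mulr0.
  apply=> t ht; rewrite mule0 (prob_atom_split hX _ ht mE)//.
  rewrite big_seq big1// => v ve; rewrite (_ : _ `&` _ = set0) ?measure0//.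
  apply/seteqP; split => // w [ha]; apply; exists (t n.+1) => //; split => /=.
    by rewrite (ha n.+1) ?extend_old// leqnSn.
  by rewrite (ha n.+2) ?extend_new ?leqnn//; exists v.
move=> w /= nw; apply: contra_not nw => -[s _ [/= es [v ve e]]] _.
by exists v; rewrite es.
Qed.

Lemma ae_super_bounded (s : {fset word} -> R) : (forall t, 0 <= s t) ->
  (forall n t, grown n t -> step s t <= s t) ->
  {ae P, forall w, exists C : R, forall n, (1 <= n)%N -> s (X n w) <= C}.
Proof.
move=> s0 ss.
apply: (@negligible_bounds _ (fun i => ever_exceeds X 1 s i.+1%:R)
   (fun i => s root_tree * i.+1%:R^-1)).
- by move=> k; exact: (measurable_ever_exceeds hX).
- move=> k w /= nw; apply: contrapT => h; apply: nw; exists k.+1%:R => n n1.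
  rewrite leNgt; apply/negP => /ltW hn; apply: h; exists n.-1.
  by rewrite /= add1n prednK.
- move=> k; have mE := measurable_ever_exceeds hX s k.+1%:R (leqnn 1).
  apply: (conditional_bound_prob (n := 0) (u := fun t => s t / k.+1%:R) hX mE).
  exact: (ever_exceeds_bound hX).
- rewrite -[X in _ --> X](mulr0 (s root_tree)).
  by apply: cvgM; [exact: cvg_cst|exact: cvg_harmonic].
Qed.

(** Unlike [decayW] this is of constant order, and its almost sure boundedness
    gives the rate n^(-1/2) for [decayW]. *)
Definition growthW (t : {fset word}) : R := expmean t / Num.sqrt (ext t).

Lemma growthW_ge0 t : 0 <= growthW t.
Proof.
rewrite /growthW divr_ge0 ?sqrtr_ge0// /expmean /avg mulr_ge0 ?invr_ge0//.
by apply: sumr_ge0 => v _; rewrite exprn_ge0// divr_ge0.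
Qed.

Lemma decayW_growthW n t : grown n t -> decayW t = growthW t / Num.sqrt (ext t).
Proof.
move=> gt; have p2 := @ext_ge2 R _ _ gt.
rewrite /decayW /growthW -mulrA -invfM -expr2 sqr_sqrtr//; lra.
Qed.

Lemma cvg_inv_sqrt (k : nat) : (Num.sqrt (n + k).+1%:R : R)^-1 @[n --> \oo] --> 0.
Proof.
have h : Num.sqrt ((n + k).+1%:R^-1 : R) @[n --> \oo] --> Num.sqrt 0.
  apply: continuous_cvg; first exact: sqrt_continuous.
  by have := @cvg_harmonic R; rewrite -(cvg_shiftn k).
rewrite sqrtr0 in h; apply: cvg_trans h; apply: near_eq_cvg; near=> n.
by rewrite sqrtrV.
Unshelve. all: by end_near. Qed.

Lemma measurable_treefun n (f : {fset word} -> R) : (1 <= n)%N ->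
  measurable_fun setT (fun w => f (X n w)).
Proof.
by move=> n1 _ A _; rewrite setTI; exact: (rbst_measurable hX (f @^-1` A) n1).
Qed.

(** Given the first k + 1 trees, the supermartingale of [sqr_mart_dist_super]
    centred at the present value starts at 2 cW decayW, whose expectation is
    O(k^(-1/2)) by [step_growthW]; the maximal inequality at level e^2 then bounds
    the probability of a later deviation e. *)
Lemma ae_mart_cauchy (e : R) : 0 < e ->
  {ae P, forall w, exists k, forall j, `|mart (X (k.+1 + j) w) - mart (X k.+1 w)| < e :> R}.
Proof.
move=> e0.
pose E k : set T := [set w | exists j, e <= `|mart (X (k.+1 + j) w) - mart (X k.+1 w)|].
have mE k : measurable (E k).
  rewrite (_ : E k = \bigcup_j [set w | e <= `|mart (X (k.+1 + j) w) - mart (X k.+1 w)|]); last first.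
    by apply/seteqP; split => w; [move=> [j h]; exists j|move=> [j _ h]; exists j].
  apply: bigcupT_measurable => j; rewrite -[X in measurable X]setTI.
  apply: measurable_fun_le => //; apply: measurableT_comp => //.
  by apply: measurable_funB; exact: measurable_treefun.
have c0 := @cW_ge0 R.
pose u k : R := (2 * @cW R / e ^+ 2) * growthW root_tree * (Num.sqrt (k + 1).+1%:R)^-1.
apply: (negligible_bounds (u := u) mE).
- by move=> k w /= nw; apply: contrapT => h; apply: nw; exists k => j;
    rewrite ltNge; apply/negP => hj; apply: h; exists j.
- move=> k; apply: le_trans (conditional_bound_prob (n := k) (u := fun t => (2 * @cW R / e ^+ 2) * decayW t) hX (mE k) _) _.
    move=> t ht.
    have gt : grown k.+1 (t k.+1) by apply: (history_path_grown ht); rewrite leqnn.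
    pose s t' : R := (mart t' - mart (t k.+1)) ^+ 2 + 2 * @cW R * decayW t'.
    have s0 t' : 0 <= s t'.
      by rewrite addr_ge0 ?sqr_ge0// mulr_ge0 ?decayW_ge0// mulr_ge0.
    have ss n t' : grown n t' -> step s t' <= s t' by exact: sqr_mart_dist_super.
    have e20 : 0 < e ^+ 2 by rewrite exprn_gt0.
    have := ever_exceeds_bound hX e20 (ltn0Sn k) s0 ss ht.
    rewrite {2}/s subrr expr0n/= add0r mulrAC; apply: le_trans.
    apply: le_measure; rewrite ?inE.
    + by apply: measurableI; [exact: measurable_atom hX _ _|exact: mE].
    + by apply: measurableI; [exact: measurable_atom hX _ _|exact: (measurable_ever_exceeds hX)].
    + move=> w [ha [j hj]]; split => //; exists j.
      have ek : X k.+1 w = t k.+1 by apply: ha; rewrite leqnn.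
      rewrite ek in hj; rewrite /s -[X in _ <= X + _]real_normK ?num_real//.
      apply: ler_wpDr; first by rewrite mulr_ge0 ?decayW_ge0// mulr_ge0.
      by rewrite lerXn2r ?nnegrE ?normr_ge0 ?(ltW e0).
  rewrite lee_fin iter_step_scale /u -[leRHS]mulrA; apply: ler_wpM2l.
    by rewrite divr_ge0 ?sqr_ge0// mulr_ge0.
  apply: le_trans (_ : iter k step (fun t => (Num.sqrt (k + 1).+1%:R)^-1 * growthW t) root_tree <= _).
    apply: (iter_step_mono grown1) => t gt.
    rewrite (decayW_growthW gt) mulrC /ext (card_external_grown gt).
    by rewrite add1n addn1.
  rewrite iter_step_scale mulrC ler_wpM2r ?invr_ge0 ?sqrtr_ge0//.
  by apply: (iter_step_super _ grown1) => n t; exact: step_growthW.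
- rewrite /u -[X in _ --> X](mulr0 (2 * @cW R / e ^+ 2 * growthW root_tree)).
  by apply: cvgM; [exact: cvg_cst|exact: cvg_inv_sqrt].
Qed.

Lemma ae_mart_cvg : {ae P, forall w, cvg (mart (X n w) @[n --> \oo] : set_system R)}.
Proof.
have : {ae P, forall w, forall i : nat, exists k, forall j,
    `|mart (X (k.+1 + j) w) - mart (X k.+1 w)| < i.+1%:R^-1 :> R}.
  by apply/ae_foralln => i; apply: ae_mart_cauchy; rewrite invr_gt0.
apply: filterS => w hw; apply/cauchy_cvgP; apply: cauchy_exP => e e0.
have [i ie] : exists i : nat, i.+1%:R^-1 < e.
  near \oo => i; exists i; near: i.
  have /cvgrPdist_lt/(_ e e0) := @cvg_harmonic R.
  by apply: filterS => i; rewrite /harmonic sub0r normrN ger0_norm// invr_ge0.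
have [k hk] := hw i; exists (mart (X k.+1 w)).
exists k.+1 => // n /= kn; rewrite -ball_normE /= distrC.
by apply: lt_trans ie; have := hk (n - k.+1)%N; rewrite subnKC.
Unshelve. all: by end_near. Qed.

End AlmostSureFacts.

(** * Smooth approximation of Lipschitz functions *)

Section Smoothing.
Context {R : realType}.
Implicit Types (f F G : R -> R).
Local Notation mu := (@lebesgue_measure R).

Definition primitive F f := forall x : R, is_derive x (1 : R) F (f x).

Lemma primitive_continuous F f : primitive F f -> continuous F.
Proof.
move=> dF x; apply: differentiable_continuous.
by apply/derivable1_diffP; have [] := dF x.
Qed.

Lemma mean_value F f (x y : R) : primitive F f ->
  exists2 xi, `|xi - x| <= `|y| & F (x + y) - F x = f xi * y.
Proof.
move=> dF; have cF := primitive_continuous dF.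
have [y0|/ltW y0] := leP 0 y.
  have [|||xi] := @MVT_segment R F f x (x + y); first by rewrite lerDl.
  - by move=> z _; exact: dF.
  - exact: continuous_subspaceT.
  rewrite in_itv/= => /andP[h1 h2] e; exists xi; last by rewrite e addrAC subrr add0r.
  by rewrite (ger0_norm y0) ger0_norm; lra.
have [|||xi] := @MVT_segment R F f (x + y) x; first by rewrite gerDl.
- by move=> z _; exact: dF.
- exact: continuous_subspaceT.
rewrite in_itv/= => /andP[h1 h2] e; exists xi.
  by rewrite (ler0_norm y0) ler0_norm; lra.
by rewrite -opprB e; ring.
Qed.

Lemma primitive_exists f : continuous f -> exists F, primitive F f.
Proof.
move=> cf.
pose I (b x : R) := \int[mu]_(t in `[b, x]) f t.
have fi (b x : R) : mu.-integrable `[b, x] (EFin \o f).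
  apply: continuous_compact_integrable; first exact: segment_compact.
  exact: continuous_subspaceT.
have Isub b b' x : b < b' -> b' <= x -> I b x - I b b' = I b' x.
  move=> bb' b'x; rewrite /I (@Rintegral_itvB _ f (BLeft b) (BRight x) b' (fi b x)) ?bnd_simp ?(ltW bb')//.
  rewrite Rintegral_itv_obnd_cbnd//.
  by apply: integrableS (fi b' x) => //; apply: subset_itvr; rewrite bnd_simp.
(* Integrals over segments need ordered bounds: the base point is chosen to the
   left of 0 and x, and the difference of two integrals does not depend on it. *)
pose F x := I (- (`|x| + 1)) x - I (- (`|x| + 1)) 0.
have FE : forall c x, c < - (`|x| + 1) -> F x = I c x - I c 0.
  move=> c x cx; have nx := normr_ge0 x.
  have h1 : - (`|x| + 1) <= x by have := ler_norm (- x); rewrite normrN; lra.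
  have h2 : - (`|x| + 1) <= 0 by lra.
  by rewrite /F -(Isub _ _ x cx h1) -(Isub _ _ 0 cx h2); ring.
exists F => x.
pose b := - (`|x| + 3).
have bx : b < x by have := ler_norm (- x); rewrite /b normrN; lra.
have [||||dI eI] := @continuous_FTC1 R f (BLeft b) x (x + 1); first by lra.
- exact: fi.
- by rewrite /= lte_fin.
- exact: cf.
have dI' : is_derive x (1 : R) (I b) (f x) by split; [exact: dI|rewrite -derive1E; exact: eI].
have dIc : is_derive x (1 : R) (fun z => I b z - I b 0) (f x).
  by apply: is_derive_eq; rewrite subr0.
apply: near_eq_is_derive dIc; near=> z.
symmetry; apply: FE; rewrite /b.
have xz : `|x - z| < 1.
  near: z; have /cvgrPdist_lt : z @[z --> x] --> x by exact: cvg_id.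
  by apply.
have := ler_normD (z - x) x; rewrite subrK distrC; lra.
Unshelve. all: by end_near. Qed.

Definition fdiff (h : R) F (x : R) : R := (F (x + h) - F x) / h.

Lemma primitive_fdiff h F f : primitive F f -> primitive (fdiff h F) (fdiff h f).
Proof.
move=> dF x; rewrite /fdiff.
have d1 : is_derive x (1 : R) (fun z => F (z + h)) (f (x + h)).
  have d0 : is_derive x (1 : R) (fun z : R => z + h) 1 by apply: is_derive_eq; rewrite addr0.
  have := @is_derive1_comp _ F (fun z : R => z + h) x _ _ (dF (x + h)) d0.
  by rewrite mulr1.
have d2 := dF x.
apply: is_derive_eq.
by rewrite scaler0 add0r mulrC.
Qed.

(** A difference quotient of a primitive of f is a value of f nearby; iterated, it
    turns smoothness of primitives into smoothness of an approximation of f. *)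
Lemma fdiff_mean h F f x : 0 < h -> primitive F f ->
  exists2 xi, `|xi - x| <= h & fdiff h F x = f xi.
Proof.
move=> h0 dF; have [xi xih e] := mean_value x h dF.
exists xi; first by rewrite (gtr0_norm h0) in xih.
by rewrite /fdiff e mulfK// gt_eqF.
Qed.

Lemma fdiff_le h (M : R) f x : 0 < h -> (forall y, `|f y| <= M) -> `|fdiff h f x| <= 2 * M / h.
Proof.
move=> h0 fM; rewrite /fdiff normrM normfV (gtr0_norm h0); apply: ler_wpM2r.
  by rewrite invr_ge0 ltW.
by apply: le_trans (ler_normB _ _) _; have := fM x; have := fM (x + h); lra.
Qed.

(** Mean value inequality, used to integrate a Taylor bound once. *)
Lemma taylor_growth (phi psi : R -> R) c k : primitive phi psi -> phi 0 = 0 ->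
  0 <= c -> (forall s, `|psi s| <= c * `|s| ^+ k) -> forall s, `|phi s| <= c * `|s| ^+ k.+1.
Proof.
move=> dphi phi0 c0 psic s; have [xi xis] := mean_value 0 s dphi.
rewrite add0r phi0 subr0 => ->; rewrite normrM exprSr mulrA ler_wpM2r//.
apply: le_trans (psic xi) _; rewrite ler_wpM2l// lerXn2r ?nnegrE//.
by rewrite subr0 in xis.
Qed.

Lemma primitive_bdd_lip (K : R) F f : primitive F f ->
  (forall x, `|F x| <= K) -> (forall x, `|f x| <= K) -> bdd_lip K F.
Proof.
move=> dF FK fK; split => // x y; have [xi _] := mean_value y (x - y) dF.
by rewrite subrKC => ->; rewrite normrM ler_wpM2r.
Qed.

Lemma primitive_smooth3 (K : R) g g1 g2 g3 :
  primitive g g1 -> primitive g1 g2 -> primitive g2 g3 ->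
  (forall x, `|g x| <= K) -> (forall x, `|g1 x| <= K) -> (forall x, `|g2 x| <= K) ->
  (forall x, `|g3 x| <= K) -> smooth3 K g g1 g2.
Proof.
move=> d0 d1 d2 b0 b1 b2 b3; have K0 : 0 <= K by exact: le_trans (b0 0).
split; [exact: primitive_bdd_lip d0 _ _|exact: primitive_bdd_lip d1 _ _|exact: primitive_bdd_lip d2 _ _|].
move=> x y.
have shift F f : primitive F f -> primitive (fun s => F (x + s)) (fun s => f (x + s)).
  move=> dF s; have dd : is_derive s (1 : R) (fun z : R => x + z) 1.
    have -> : (fun z : R => x + z) = (fun z : R => z + x) by apply/funext => z; rewrite addrC.
    by apply: is_derive_eq; rewrite addr0.
  have := @is_derive1_comp _ F (fun z : R => x + z) s _ _ (dF (x + s)) dd.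
  by rewrite mulr1.
pose p2 s := g2 (x + s) - g2 x.
pose p1 s := g1 (x + s) - g1 x - g2 x * s.
pose p0 s := g (x + s) - g x - g1 x * s - g2 x * s ^+ 2 / 2.
have e2 s : `|p2 s| <= K * `|s| ^+ 1.
  have [xi _ e] := mean_value x s d2; rewrite /p2 e normrM expr1 ler_wpM2r//.
have e1 : forall s, `|p1 s| <= K * `|s| ^+ 2.
  apply: (@taylor_growth _ p2) => //; last by rewrite /p1 addr0 mulr0; ring.
  move=> s; have ds := shift _ _ d1 s; rewrite /p1 /p2; apply: is_derive_eq.
  by rewrite /GRing.scale/=; ring.
apply: (@taylor_growth p0 p1) => //; last by rewrite /p0 addr0; ring.
move=> s; have ds := shift _ _ d0 s; rewrite /p1 /p0; apply: is_derive_eq.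
by rewrite /GRing.scale/= ?expr1; field.
Qed.

(** Take the third difference quotient, with step h, of a triple primitive of f.
    It is a value of f at distance at most 3 h, so it is nonnegative and close to
    f, and its first three derivatives are difference quotients of f, bounded in
    terms of h. *)
Lemma lipschitz_smooth_approx (M L e : R) f : 0 < e -> 0 <= L ->
  (forall x, 0 <= f x <= M) -> (forall x y, `|f x - f y| <= L * `|x - y|) ->
  exists K g g1 g2, [/\ smooth3 K g g1 g2, (forall x, 0 <= g x) & forall x, `|g x - f x| <= e].
Proof.
move=> e0 L0 fM fL.
have cf : continuous f.
  apply: (@bdd_lip_continuous _ (M + L)); split => [x|x y].
    by have /andP[? ?] := fM x; rewrite ger0_norm; lra.
  apply: le_trans (fL x y) _; rewrite ler_wpM2r//.
  by have /andP[? ?] := fM 0; lra.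
have [F1 d1] := primitive_exists cf.
have [F2 d2] := primitive_exists (primitive_continuous d1).
have [F3 d3] := primitive_exists (primitive_continuous d2).
pose h := e / (3 * (L + 1)).
have h0 : 0 < h by rewrite divr_gt0// mulr_gt0//; lra.
have hE : 3 * h * L <= e.
  rewrite /h; have -> : 3 * (e / (3 * (L + 1))) * L = e * (L / (L + 1)).
    by field; rewrite gt_eqF//; lra.
  by rewrite ger_pMr// ler_pdivrMr; lra.
have D F f' (dF : primitive F f') := primitive_fdiff h dF.
have fb x : `|f x| <= M by have /andP[? ?] := fM x; rewrite ger0_norm.
have gE x : exists2 xi, `|xi - x| <= 3 * h & fdiff h (fdiff h (fdiff h F3)) x = f xi.
  have [x1 h1 ->] := fdiff_mean x h0 (D _ _ (D _ _ d3)).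
  have [x2 h2 ->] := fdiff_mean x1 h0 (D _ _ d2).
  have [x3 h3 ->] := fdiff_mean x2 h0 d1.
  exists x3 => //; rewrite (_ : x3 - x = (x3 - x2) + ((x2 - x1) + (x1 - x))); last by ring.
  have := ler_normD (x3 - x2) (x2 - x1 + (x1 - x)); have := ler_normD (x2 - x1) (x1 - x).
  by lra.
have g1E x : exists xi, fdiff h (fdiff h (fdiff h F2)) x = fdiff h f xi.
  have [x1 h1 ->] := fdiff_mean x h0 (D _ _ (D _ _ d2)).
  by have [x2 h2 ->] := fdiff_mean x1 h0 (D _ _ d1); exists x2.
have g2E x : exists xi, fdiff h (fdiff h (fdiff h F1)) x = fdiff h (fdiff h f) xi.
  by have [x1 h1 ->] := fdiff_mean x h0 (D _ _ (D _ _ d1)); exists x1.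
have M0 : 0 <= M by exact: le_trans (fb 0).
have b1 x : `|fdiff h f x| <= 2 * M / h by exact: fdiff_le.
have b2 x : `|fdiff h (fdiff h f) x| <= 2 * (2 * M / h) / h by exact: fdiff_le.
have b3 x : `|fdiff h (fdiff h (fdiff h f)) x| <= 2 * (2 * (2 * M / h) / h) / h by exact: fdiff_le.
pose K := M + 2 * M / h + 2 * (2 * M / h) / h + 2 * (2 * (2 * M / h) / h) / h.
have K1 : 0 <= 2 * M / h by exact: le_trans (b1 0).
have K2 : 0 <= 2 * (2 * M / h) / h by exact: le_trans (b2 0).
have K3 : 0 <= 2 * (2 * (2 * M / h) / h) / h by exact: le_trans (b3 0).
exists K, (fdiff h (fdiff h (fdiff h F3))), (fdiff h (fdiff h (fdiff h F2))), (fdiff h (fdiff h (fdiff h F1))).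
split.
- apply: (primitive_smooth3 (g3 := fdiff h (fdiff h (fdiff h f)))).
  + exact: D _ _ (D _ _ (D _ _ d3)).
  + exact: D _ _ (D _ _ (D _ _ d2)).
  + exact: D _ _ (D _ _ (D _ _ d1)).
  + by move=> x; have [xi _ ->] := gE x; apply: le_trans (fb xi) _; rewrite /K; lra.
  + by move=> x; have [xi ->] := g1E x; apply: le_trans (b1 xi) _; rewrite /K; lra.
  + by move=> x; have [xi ->] := g2E x; apply: le_trans (b2 xi) _; rewrite /K; lra.
  + by move=> x; apply: le_trans (b3 x) _; rewrite /K; lra.
- by move=> x; have [xi _ ->] := gE x; have /andP[] := fM xi.
- move=> x; have [xi xih ->] := gE x; apply: le_trans (fL _ _) _.
  apply: le_trans hE; rewrite mulrC ler_wpM2r//.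
Qed.

End Smoothing.

(** * Weak convergence tested on smooth functions *)

Section WeakConvergence.
Context {R : realType}.
Local Notation pmeas := {measure set (measurableTypeR R) -> \bar R}.

Lemma bounded_integrable (mu : pmeas) (M : R) (f : R -> R) : mu setT = 1%E ->
  continuous f -> (forall x, `|f x| <= M) -> mu.-integrable setT (EFin \o f).
Proof.
move=> mu1 cf fM; apply: measurable_bounded_integrable => //.
- by rewrite mu1 ltry.
- exact: continuous_measurable_fun.
- exists M; split; first exact: num_real.
  by move=> y My x _; exact: le_trans (fM x) (ltW My).
Qed.

Lemma expect_cst (mu : pmeas) (c : R) : mu setT = 1%E -> \int[mu]_x c = c.
Proof. by move=> mu1; rewrite Rintegral_cst// mu1 mulr1. Qed.

Lemma expect_le (mu : pmeas) (M c : R) (f g : R -> R) : mu setT = 1%E ->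
  continuous f -> continuous g -> (forall x, `|f x| <= M) -> (forall x, `|g x| <= M) ->
  (forall x, f x <= g x + c) -> \int[mu]_x f x <= \int[mu]_x g x + c.
Proof.
move=> mu1 cf cg fM gM fg.
have i1 := bounded_integrable mu1 cf fM.
have i2 := bounded_integrable mu1 cg gM.
have ic : mu.-integrable setT (EFin \o cst c).
  by apply: (@bounded_integrable _ `|c|) => // x; exact: cvg_cst.
rewrite -[X in _ + X](expect_cst c mu1) -RintegralD//.
apply: le_Rintegral => //.
apply: (@bounded_integrable _ (M + `|c|)) => //.
  by move=> x; apply: cvgD; [exact: cg|exact: cvg_cst].
by move=> x; apply: le_trans (ler_normD _ _) _; rewrite lerD2r.
Qed.

(** The largest j-Lipschitz function below f. *)
Definition infconv (f : R -> R) (j : nat) (x : R) : R :=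
  inf [set f y + j%:R * `|x - y| | y in [set: R]].

Section InfConvolution.
Variables (f : R -> R) (M : R) (fM : forall x, 0 <= f x <= M) (cf : continuous f).

Let f0 x : 0 <= f x. Proof. by have /andP[] := fM x. Qed.

Let lb0 j x : lbound [set f y + j%:R * `|x - y| | y in [set: R]] 0.
Proof. by move=> _ [y _ <-]; rewrite addr_ge0// mulr_ge0. Qed.

Let ne j x : [set f y + j%:R * `|x - y| | y in [set: R]] !=set0.
Proof. by exists (f x + j%:R * `|x - x|); exists x. Qed.

Lemma infconv_le j x y : infconv f j x <= f y + j%:R * `|x - y|.
Proof. by apply: ge_inf; [exists 0; exact: lb0|exists y]. Qed.

Lemma infconv_ge j x c : (forall y, c <= f y + j%:R * `|x - y|) -> c <= infconv f j x.
Proof. by move=> h; apply: lb_le_inf; [exact: ne|move=> _ [y _ <-]]. Qed.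

Lemma infconv_bounds j x : 0 <= infconv f j x <= f x.
Proof.
apply/andP; split; first by apply: infconv_ge => y; rewrite addr_ge0// mulr_ge0.
by have := infconv_le j x x; rewrite subrr normr0 mulr0 addr0.
Qed.

Lemma infconv_lip j x y : `|infconv f j x - infconv f j y| <= j%:R * `|x - y|.
Proof.
have h u v : infconv f j u - j%:R * `|u - v| <= infconv f j v.
  apply: infconv_ge => z; rewrite lerBlDr; apply: le_trans (infconv_le j u z) _.
  rewrite -addrA lerD2l -mulrDr ler_wpM2l// [leRHS]addrC.
  by rewrite -[X in `|X| <= _](subrKA v) ler_normD.
have := h x y; have := h y x; rewrite (distrC y x) ler_norml => h1 h2.
by apply/andP; split; lra.
Qed.

Lemma infconv_cvg x : infconv f j x @[j --> \oo] --> f x.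
Proof.
apply/cvgrPdist_le => e e0.
have /cvgrPdist_le/(_ e e0)[del /= del0 hdel] : f y @[y --> x] --> f x by exact: cf.
near=> j.
have /andP[_ hle] := infconv_bounds j x.
rewrite ger0_norm ?subr_ge0// lerBlDr -lerBlDl; apply: infconv_ge => y.
have [xy|xy] := ltP `|x - y| del.
  have := hdel y xy; rewrite ler_norml => /andP[_ h].
  by rewrite ler_wpDr ?mulr_ge0//; lra.
apply: le_trans (_ : j%:R * del <= _); last first.
  by apply: ler_wpDl => //; rewrite ler_wpM2l.
apply: (@le_trans _ _ (f x)); first by lra.
rewrite -ler_pdivrMr//; near: j; exact: nbhs_infty_ger.
Unshelve. all: by end_near. Qed.

End InfConvolution.

Variables (mu : nat -> pmeas) (nu : pmeas).
Hypotheses (mu1 : forall n, mu n setT = 1%E) (nu1 : nu setT = 1%E).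
Hypothesis smooth_cvg : forall K (g g1 g2 : R -> R), smooth3 K g g1 g2 -> (forall x, 0 <= g x) ->
  \int[mu n]_x g x @[n --> \oo] --> \int[nu]_x g x.

(** One-sided estimate: f is approximated from below by its j-Lipschitz
    regularization, which converges to f only pointwise. Dominated convergence
    under the limit law nu selects j, and monotonicity under mu n carries the
    bound to f. *)
Lemma weak_lower_bound (f : R -> R) (M e : R) : continuous f ->
  (forall x, 0 <= f x <= M) -> 0 < e ->
  \forall n \near \oo, \int[nu]_x f x - e <= \int[mu n]_x f x.
Proof.
move=> cf fM e0.
have M0 : 0 <= M by have /andP[? ?] := fM 0; lra.
have fb x : `|f x| <= M by have /andP[? ?] := fM x; rewrite ger0_norm.
have gb j x : `|infconv f j x| <= M.
  have /andP[h1 h2] := infconv_bounds fM j x; rewrite ger0_norm//.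
  by have /andP[_] := fM x; exact: le_trans.
have cg j : continuous (infconv f j).
  apply: (@bdd_lip_continuous _ (M + j%:R)); split => [x|x y].
    by apply: le_trans (gb j x) _; rewrite lerDl.
  by apply: le_trans (infconv_lip fM j x y) _; rewrite ler_wpM2r// lerDr.
have cvgj : \int[nu]_x infconv f j x @[j --> \oo] --> \int[nu]_x f x.
  have fi := bounded_integrable nu1 cf fb.
  have gi j := bounded_integrable nu1 (cg j) (gb j).
  have ci : nu.-integrable setT (EFin \o cst M).
    by apply: (@bounded_integrable _ M) => // x; [exact: cvg_cst|rewrite ger0_norm].
  have [] := @dominated_convergence _ _ _ nu setT measurableT
    (fun j x => (infconv f j x)%:E) (EFin \o f) (EFin \o cst M).
  - by move=> j; apply/measurable_EFinP; exact: continuous_measurable_fun.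
  - by apply/measurable_EFinP; exact: continuous_measurable_fun.
  - by apply: aeW => x _; apply: cvg_EFin; [exact: nearW|exact: infconv_cvg fM cf x].
  - exact: ci.
  - by apply: aeW => x j _; rewrite /= lee_fin gb.
  move=> _ _ h; apply: fine_cvg; rewrite fineK//.
  exact: integrable_fin_num.
have e40 : 0 < e / 4 by lra.
have [j hj] : exists j, \int[nu]_x f x - e / 4 <= \int[nu]_x infconv f j x.
  move/cvgrPdist_le : cvgj => /(_ _ e40)[N _ /(_ N (leqnn N))].
  by rewrite ler_norml => /andP[_ h]; exists N; lra.
have [K [g [g1 [g2 [g3 g0 gf]]]]] := lipschitz_smooth_approx e40 (ler0n R j)
  (fun x => let: conj a b := andP (infconv_bounds fM j x) in
    introT andP (conj a (le_trans b (proj2 (andP (fM x)))))) (infconv_lip fM j).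
have gK := smooth3_0 g3; have cgg := bdd_lip_continuous gK.
have /cvgrPdist_le/(_ _ e40) := smooth_cvg g3 g0.
apply: filterS => n; rewrite ler_norml => /andP[_ hn].
have B1 x : `|g x| <= K + M by case: gK => gK _; apply: le_trans (gK x) _; rewrite lerDl.
have B2 j' x : `|infconv f j' x| <= K + M.
  by apply: le_trans (gb _ _) _; rewrite lerDr; exact: bdd_lip_ge0 gK.
have B3 x : `|f x| <= K + M.
  by apply: le_trans (fb _) _; rewrite lerDr; exact: bdd_lip_ge0 gK.
have s1 : \int[nu]_x infconv f j x <= \int[nu]_x g x + e / 4.
  apply: (expect_le nu1 (cg j) cgg (B2 j) B1) => x.
  by have := gf x; rewrite ler_norml => /andP[? ?]; lra.
have s2 : \int[mu n]_x g x <= \int[mu n]_x f x + e / 4.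
  apply: (expect_le (mu1 n) cgg cf B1 B3) => x.
  have := gf x; rewrite ler_norml => /andP[? ?].
  by have /andP[_ ?] := infconv_bounds fM j x; lra.
lra.
Qed.

(** The lower bound of [weak_lower_bound], applied to M + f and to M - f with M a
    bound of |f|, gives both sides of the limit. *)
Lemma weak_cvg_smooth : weak_cvg mu nu.
Proof.
move=> f cf [M0 [_ fM0]].
pose M := `|M0| + 1.
have fM x : `|f x| <= M.
  by apply: fM0 => //; rewrite /M; have := ler_norm M0; lra.
have M_ge0 : 0 <= M by exact: le_trans (fM 0).
have Efin (m : pmeas) : m setT = 1%E -> (\int[m]_x (f x)%:E = (\int[m]_x f x)%:E)%E.
  move=> m1; rewrite fineK//.
  exact: (integrable_fin_num _ (bounded_integrable m1 cf fM)).
rewrite (Efin _ nu1); under eq_fun do rewrite (Efin _ (mu1 _)).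
apply: cvg_EFin; first exact: nearW.
apply/cvgrPdist_le => e e0.
have shift (m : pmeas) (s : R) : m setT = 1%E -> `|s| = 1 ->
    \int[m]_x (M + s * f x) = M + s * \int[m]_x f x.
  move=> m1 s1; have fi := bounded_integrable m1 cf fM.
  have ci : m.-integrable setT (EFin \o cst M).
    by apply: (@bounded_integrable _ M) => // x; [exact: cvg_cst|rewrite ger0_norm].
  have sfi : m.-integrable setT (EFin \o (fun x => s * f x)).
    apply: (@bounded_integrable _ M) => // x.
      by apply: cvgM; [exact: cvg_cst|exact: cf].
    by rewrite normrM s1 mul1r.
  by rewrite RintegralD// RintegralZl// expect_cst.
have bnd (s : R) : `|s| = 1 -> forall x, 0 <= M + s * f x <= M + M.
  move=> s1 x; have : `|s * f x| <= M by rewrite normrM s1 mul1r.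
  by rewrite ler_norml => /andP[? ?]; apply/andP; split; lra.
have cs (s : R) : continuous (fun x => M + s * f x).
  move=> x; apply: cvgD; first exact: cvg_cst.
  by apply: cvgM; [exact: cvg_cst|exact: cf].
have n1 : `|-1 : R| = 1 by rewrite normrN1.
have l1 := weak_lower_bound (cs 1) (bnd _ (normr1 R)) e0.
have l2 := weak_lower_bound (cs (-1)) (bnd _ n1) e0.
apply: filterS2 l1 l2 => n.
rewrite !shift ?normr1// ler_norml => h1 h2.
rewrite -[(fine \o _) n]/(\int[mu n]_x f x).
by apply/andP; split; lra.
Qed.

End WeakConvergence.

(** * Conditional laws on histories *)

Section ConditionalLaw.
Context d (T : measurableType d) (R : realType) (P : probability T R).
Variables (X : nat -> T -> {fset word}) (hX : is_rbst P X).

(** An event of the sigma-algebra generated by the first n trees cannot separate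
    two points with the same first n trees. *)
Lemma history_saturated n (A : set T) w w' : <<s history X n >> A ->
  (forall k, (1 <= k <= n)%N -> X k w = X k w') -> A w -> A w'.
Proof.
move=> sA; move: w w'.
suff: [set A | forall w w', (forall k, (1 <= k <= n)%N -> X k w = X k w') -> A w -> A w'] A.
  by move=> h w w'; exact: h.
move: A sA; apply: smallest_sub; last first.
  by move=> _ [k [B [kn ->]]] w w' ww' /=; rewrite ww'.
split=> [//|A hA w w' ww' [_ nA]|F hF w w' ww' [i _ Fi]].
  by split => // Aw'; apply: nA; apply: hA Aw' => k kn; rewrite ww'.
by exists i => //; exact: hF Fi.
Qed.

Lemma atom_history n t : <<s history X n >> (atom X n t).
Proof.
rewrite (_ : atom X n t = \bigcap_(k in [set k | (1 <= k <= n)%N]) (X k @^-1` [set t k])).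
  have h k : [set k | (1 <= k <= n)%N] k ->
      d.-measurable (X k @^-1` [set t k] : set T) /\ <<s history X n >> (X k @^-1` [set t k]).
    move=> kn; split; first by apply: (rbst_measurable hX); case/andP: kn.
    by apply: sub_sigma_algebra; exists k, [set t k].
  exact: (@bigcap_measurableType _ (g_sigma_algebraType (history X n)) _ _ (fun k kn => (h k kn).2)).
by apply/seteqP; split => w; exact.
Qed.

Lemma integral_mrestr (A : set T) (mA : measurable A) (h : T -> \bar R) :
  measurable_fun setT h -> (forall x, 0 <= h x)%E ->
  (\int[mrestr P mA]_x h x = \int[P]_(x in A) h x)%E.
Proof.
move=> mh h0.
rewrite (@ge0_negligible_integral _ _ _ _ setT (~` A))//.
- rewrite setTD setCK; apply: eq_measure_integral => B mB BA.
  by rewrite -[LHS]/(P (B `&` A)) (setIidl BA).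
- exact: measurableC.
- by rewrite /= /mrestr setICl measure0.
Qed.

Variables (n : nat) (Z : T -> R) (mZ : measurable_fun setT Z).
Let mZ_mixin := isMeasurableFun.Build _ _ T (measurableTypeR R) Z mZ.
Let Zpack : {mfun T >-> measurableTypeR R} := HB.pack Z mZ_mixin.
Variable kappa : R.-pker (g_sigma_algebraType (history X n)) ~> measurableTypeR R.
Hypothesis hk : is_regular_cond_distr P Z kappa.

(** A regular version of the conditional law is measurable with respect to the
    history, hence constant on its atoms, and integrating it over an atom
    determines it there. *)
Lemma regular_cond_atom t w (B : set (measurableTypeR R)) : measurable B -> atom X n t w ->
  (P (atom X n t) * kappa w B = P (atom X n t `&` Z @^-1` B))%E.
Proof.
move=> mB tw; have mA := measurable_atom hX n t.
rewrite -(hk (@atom_history n t) mB).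
rewrite (eq_integral (fun=> kappa w B)); first by rewrite integral_cst// muleC.
move=> w'; rewrite inE => tw'.
have mk := measurable_kernel kappa B mB.
have := mk measurableT _ (emeasurable_set1 (kappa w B)).
rewrite setTI => hB.
by apply: (@history_saturated n _ w w' hB) => // k kn; rewrite tw// tw'.
Qed.

Lemma regular_cond_integral t w (f : R -> R) : measurable_fun setT f -> (forall x, 0 <= f x) ->
  atom X n t w ->
  (P (atom X n t) * \int[kappa w]_x (f x)%:E = \int[P]_(x in atom X n t) (f (Z x))%:E)%E.
Proof.
move=> mf f0 tw; have mA := measurable_atom hX n t.
have Pfin : P (atom X n t) \is a fin_num by exact: prob_atom_fin hX _ _.
have P0 : 0 <= fine (P (atom X n t)) by rewrite fine_ge0// measure_ge0.
have mf' : measurable_fun setT (EFin \o f) by exact/measurable_EFinP.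
(* Both sides integrate f against the same measure: P (atom) times the kernel,
   that is the image under Z of P restricted to the atom. *)
transitivity (\int[mscale (NngNum P0) (kappa w)]_x (f x)%:E)%E.
  rewrite ge0_integral_mscale//; try by move=> x _; rewrite lee_fin.
  by rewrite -[in LHS](fineK Pfin).
transitivity (\int[pushforward (mrestr P mA) Zpack]_x (f x)%:E)%E.
  apply: eq_measure_integral => B mB _.
  rewrite -[LHS]/((fine (P (atom X n t)))%:E * kappa w B)%E (fineK Pfin).
  rewrite (regular_cond_atom mB tw).
  by rewrite /pushforward /mrestr setIC.
rewrite ge0_integral_pushforward//.
  rewrite preimage_setT integral_mrestr//.
  exact: measurableT_comp mf' mZ.
  by move=> x; rewrite /= lee_fin.
by move=> x _; rewrite /= lee_fin.
Qed.

End ConditionalLaw.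

(** * Harmonic numbers *)

Section Asymptotics.
Context {R : realType}.
Local Notation harm := (@harm R).

Lemma harmS p : harm p.+1 = harm p + p.+1%:R^-1.
Proof. by rewrite /harm big_nat_recr. Qed.

(** A crude bound, sufficient to show that the corrections H_n / n are
    O(n^(-1/2)). *)
Lemma harm_le_sqrt p : harm p <= 2 * Num.sqrt p%:R.
Proof.
elim: p => [|p IH]; first by rewrite /harm big_nil mulr_ge0 ?sqrtr_ge0.
rewrite harmS; set a := Num.sqrt p%:R in IH *; set b := Num.sqrt p.+1%:R.
have a0 : 0 <= a by exact: sqrtr_ge0.
have b0 : 0 < b by rewrite sqrtr_gt0 ltr0n.
have a2 : a ^+ 2 = p%:R by rewrite sqr_sqrtr.
have b2 : b ^+ 2 = p%:R + 1 by rewrite sqr_sqrtr// -natr1.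
have ab : a <= b by rewrite ler_sqrt ?ltr0n// ler_nat.
suff : p.+1%:R^-1 <= 2 * (b - a) by move: (p.+1%:R^-1) => i; lra.
rewrite -natr1 -b2 -[leLHS]mul1r ler_pdivrMr ?exprn_gt0//.
have e : 1 = (b - a) * (b + a) by rewrite -subr_sqr b2 a2; ring.
have b1 : 1 <= b by rewrite /b -[leLHS]sqrtr1 ler_sqrt ?ltr0n// ler1n.
have h : 1 <= 2 * (b - a) * b by have := sqr_ge0 (b - a); nra.
rewrite expr2 mulrA -[leLHS]mulr1; apply: ler_pM => //; lra.
Qed.

Definition harm_ln (n : nat) : R := harm n.+1 - ln n%:R.

(** From ln (1 + x) <= x at x = 1 / n and at x = - 1 / (n + 1). *)
Lemma harm_ln_step n : (1 <= n)%N ->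
  harm_ln n.+1 <= harm_ln n <= harm_ln n.+1 + (n%:R^-1 - n.+2%:R^-1).
Proof.
move=> n1; have n0 : 0 < n%:R :> R by rewrite ltr0n.
rewrite /harm_ln [harm n.+2]harmS.
have nS : n.+1%:R = n%:R + 1 :> R by rewrite -natr1.
have nSS : n.+2%:R = n%:R + 2 :> R by rewrite -natr1 -natr1; ring.
rewrite nS nSS.
have np1 : 0 < n%:R + 1 :> R by lra.
have e : ln (n%:R + 1 : R) - ln n%:R = ln (1 + n%:R^-1).
  rewrite -ln_div ?posrE//.
  by congr ln; field; rewrite gt_eqF.
have e' : ln n%:R - ln (n%:R + 1 : R) = ln (1 + - (n%:R + 1)^-1).
  rewrite -ln_div ?posrE//.
  by congr ln; field; rewrite gt_eqF.
have i0 : 0 < n%:R^-1 :> R by rewrite invr_gt0.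
have u1 := @le_ln1Dx R (n%:R^-1).
have i1 : (n%:R + 1)^-1 < 1 :> R by rewrite invf_lt1; lra.
have u2 := @le_ln1Dx R (- (n%:R + 1)^-1).
have i2 : (n%:R + 2)^-1 <= (n%:R + 1)^-1 :> R by rewrite lef_pV2 ?posrE; lra.
rewrite -e in u1; rewrite -e' in u2.
have := u1 ltac:(lra); have := u2 ltac:(lra).
by move=> ? ?; apply/andP; split; lra.
Qed.

(** The constant gamma is the Euler-Mascheroni constant; the sequence decreases to
    it, and the companion sequence reduced by 1 / n + 1 / (n + 1) increases to it. *)
Lemma harm_ln_limit : exists gamma : R, forall n, (1 <= n)%N ->
  0 <= harm_ln n - gamma <= 2 / n%:R.
Proof.
pose u n := harm_ln n.+1.
pose v n := harm_ln n.+1 - (n.+1%:R^-1 + n.+2%:R^-1).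
have du : nonincreasing_seq u.
  by apply/nonincreasing_seqP => n; have /andP[] := harm_ln_step (ltn0Sn n).
have dv : nondecreasing_seq v.
  apply/nondecreasing_seqP => n; have /andP[_] := harm_ln_step (ltn0Sn n).
  by rewrite /v; move: (n.+1%:R^-1) (n.+2%:R^-1) (n.+3%:R^-1) => a b c; lra.
have uv n : v n <= u n by rewrite /v /u gerBl addr_ge0 ?invr_ge0.
have cu : cvgn u.
  apply: nonincreasing_is_cvgn => //; exists (v 0%N) => _ [n _ <-].
  by apply: le_trans (uv n); exact: dv.
have cv : cvgn v.
  apply: nondecreasing_is_cvgn => //; exists (u 0%N) => _ [n _ <-].
  by apply: le_trans (uv n) _; exact: du.
have h0 : v n - u n @[n --> \oo] --> (0 : R).
  apply/cvgr0Pnorm_le => e e0.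
  have e20 : 0 < e / 2 by lra.
  have /cvgrPdist_le/(_ _ e20) := @cvg_harmonic R.
  apply: filterS => n; rewrite sub0r normrN ger0_norm ?invr_ge0// /harmonic /= => hn.
  rewrite /v /u addrAC subrr add0r normrN ger0_norm ?addr_ge0 ?invr_ge0//.
  have : n.+2%:R^-1 <= n.+1%:R^-1 :> R by rewrite lef_pV2 ?posrE ?ltr0n// ler_nat.
  move: hn; move: (n.+1%:R^-1) (n.+2%:R^-1) => a b; lra.
have lim_eq : limn v = limn u.
  apply/eqP; rewrite -subr_eq0 -limB//; apply/eqP; exact: cvg_lim h0.
exists (limn u) => -[//|n] _.
have h1 := nonincreasing_cvgn_ge du cu n.
have h2 := nondecreasing_cvgn_le dv cv n; rewrite lim_eq /v in h2.
have : n.+2%:R^-1 <= n.+1%:R^-1 :> R by rewrite lef_pV2 ?posrE ?ltr0n// ler_nat.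
have -> : 2 / n.+1%:R = n.+1%:R^-1 + n.+1%:R^-1 :> R by rewrite mulr_natl mulr2n.
move: h1 h2; rewrite /u; move: (limn _) (harm_ln _) (n.+1%:R^-1) (n.+2%:R^-1) => l c a b ? ? ?.
by apply/andP; split; lra.
Qed.

Lemma cvg_ln : ln (n%:R : R) @[n --> \oo] --> +oo.
Proof.
apply/cvgryPge => A; near=> n.
rewrite -[A]expRK ler_ln ?posrE ?expR_gt0//.
  by near: n; exact: nbhs_infty_ger.
rewrite ltr0n; near: n; exact: nbhs_infty_gt.
Unshelve. all: by end_near. Qed.

Lemma cvg_inv_ln : (ln (n%:R : R))^-1 @[n --> \oo] --> 0.
Proof.
apply/gtr0_cvgV0; last exact: cvg_ln.
have /cvgryPgt/(_ 0) := cvg_ln; exact.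
Qed.

(** The squared norming times the remaining variance [varrest]. *)
Lemma cvg_variance :
  n%:R / (2 * ln n%:R) * (2 * harm n.+1 / n.+1%:R) @[n --> \oo] --> (1 : R).
Proof.
have [gamma hg] := harm_ln_limit.
have cb : (harm n.+1 / ln n%:R) @[n --> \oo] --> (1 : R).
  have hb : (harm_ln n * (ln n%:R)^-1) @[n --> \oo] --> (0 : R).
    have z : ((`|gamma| + 2) * (ln n%:R)^-1) @[n --> \oo] --> (0 : R).
      rewrite -[X in _ --> X](mulr0 (`|gamma| + 2)).
      by apply: cvgM; [exact: cvg_cst|exact: cvg_inv_ln].
    apply: norm_cvg0; apply: (squeeze_cvgr _ (cvg_cst 0) z); near=> n.
    have l0 : 0 < ln (n%:R : R) by near: n; have /cvgryPgt/(_ 0) := cvg_ln; exact.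
    rewrite normr_ge0/= normrM [X in _ * X]ger0_norm ?invr_ge0 ?(ltW l0)//.
    rewrite ler_pM2r ?invr_gt0//.
    have n1 : (1 <= n)%N by near: n; exact: nbhs_infty_ge.
    have /andP[h1 h2] := hg n n1.
    rewrite -[harm_ln n](subrK gamma) addrC; apply: le_trans (ler_normD _ _) _.
    rewrite lerD2l ger0_norm//; apply: le_trans h2 _.
    by rewrite ler_pdivrMr ?ltr0n// ler_peMr// ler1n.
  have h2 : (harm_ln n * (ln n%:R)^-1 + 1) @[n --> \oo] --> (0 + 1 : R).
    by apply: cvgD => //; exact: cvg_cst.
  rewrite add0r in h2; apply: cvg_trans h2; apply: near_eq_cvg; near=> n.
  have l0 : 0 < ln (n%:R : R) by near: n; have /cvgryPgt/(_ 0) := cvg_ln; exact.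
  by rewrite /harm_ln /=; field; rewrite gt_eqF.
have cn : (1 - n.+1%:R^-1) @[n --> \oo] --> (1 : R).
  rewrite -[X in _ --> X]subr0; apply: cvgB; [exact: cvg_cst|exact: cvg_harmonic].
have h3 : (harm n.+1 / ln n%:R * (1 - n.+1%:R^-1)) @[n --> \oo] --> (1 * 1 : R).
  exact: cvgM.
rewrite mul1r in h3; apply: cvg_trans h3; apply: near_eq_cvg; near=> n.
have l0 : 0 < ln (n%:R : R) by near: n; have /cvgryPgt/(_ 0) := cvg_ln; exact.
have nS : n.+1%:R = n%:R + 1 :> R by rewrite -natr1.
have n0 : 0 < n%:R + 1 :> R by rewrite -nS ltr0n.
by rewrite /= nS; field; rewrite !gt_eqF.
Unshelve. all: by end_near. Qed.

Lemma cvg_harm_div : harm p / p%:R @[p --> \oo] --> (0 : R).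
Proof.
have z : (2 * (Num.sqrt p%:R)^-1) @[p --> \oo] --> (0 : R).
  rewrite -[X in _ --> X](mulr0 2); apply: cvgM; first exact: cvg_cst.
  rewrite -(cvg_shiftS (fun p => (Num.sqrt p%:R : R)^-1)).
  have h : Num.sqrt (n.+1%:R^-1 : R) @[n --> \oo] --> Num.sqrt 0.
    by apply: continuous_cvg; [exact: sqrt_continuous|exact: cvg_harmonic].
  rewrite sqrtr0 in h; apply: cvg_trans h; apply: near_eq_cvg; near=> n.
  by rewrite sqrtrV.
apply: (squeeze_cvgr _ (cvg_cst 0) z); near=> p.
have p0 : 0 < p%:R :> R by rewrite ltr0n; near: p; exact: nbhs_infty_gt.
have s0 : 0 < Num.sqrt p%:R :> R by rewrite sqrtr_gt0.
apply/andP; split.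
  by rewrite divr_ge0// /harm; apply: sumr_ge0 => i _; rewrite invr_ge0.
rewrite ler_pdivrMr//; apply: le_trans (harm_le_sqrt p) _.
by rewrite -mulrA ler_pM2l// ler_pdivlMl// -expr2 sqr_sqrtr ?(ltW p0).
Unshelve. all: by end_near. Qed.

End Asymptotics.

(** * Conditional normal approximation of the limit *)

Section ConditionalLindeberg.
Context d (T : measurableType d) (R : realType) (P : probability T R).
Variables (X : nat -> T -> {fset word}) (hX : is_rbst P X).

Definition growing (w : T) := forall n, (1 <= n)%N ->
  exists2 v, v \in external (X n w) & X n.+1 w = (v |` X n w)%fset.

Lemma growing_path w n : growing w -> history_path n (X ^~ w).
Proof.
move=> gw; split=> [|k /andP[k1 _]]; first exact: rbst_init hX w.
exact: gw.
Qed.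

Lemma growing_grown w n : growing w -> (1 <= n)%N -> grown n (X n w).
Proof.
by move=> gw n1; apply: (history_path_grown (growing_path n gw)); rewrite n1 leqnn.
Qed.

Lemma growing_varrest w n : growing w -> (1 <= n)%N ->
  varrest (X n w) = 2 * harm n.+1 / n.+1%:R :> R.
Proof.
by move=> gw n1; rewrite /varrest /ext (card_external_grown (growing_grown gw n1)).
Qed.

Lemma growing_varrest_cvg w : growing w -> varrest (X n w) @[n --> \oo] --> (0 : R).
Proof.
move=> gw; have h : (2 * (harm n.+1 / n.+1%:R)) @[n --> \oo] --> (0 : R).
  rewrite -[X in _ --> X](mulr0 2); apply: cvgM; first exact: cvg_cst.
  by have := @cvg_harm_div R; rewrite -(cvg_shiftS (fun n => harm n / n%:R)).
apply: cvg_trans h; apply: near_eq_cvg; near=> n.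
rewrite growing_varrest ?mulrA//; near: n; exact: nbhs_infty_ge.
Unshelve. all: by end_near. Qed.

Variables (L : T -> R) (mL : measurable_fun setT L).
Hypothesis hL : {ae P, forall w, mart (X n w) @[n --> \oo] --> L w}.

Variables (K : R) (g g1 g2 : R -> R) (hg : smooth3 K g g1 g2) (g0 : forall x, 0 <= g x).
Variables (a c : R) (a0 : 0 <= a).

Lemma smoothed_ge0 t : 0 <= smoothed g a c t.
Proof. by rewrite /smoothed /heat; apply: Rintegral_ge0 => z _; exact: g0. Qed.

Lemma smoothed_le t : smoothed g a c t <= K.
Proof.
have [h _] := bdd_lip_heat (a ^+ 2 * varrest t) (smooth3_0 hg).
exact: le_trans (ler_norm _) (h _).
Qed.

(** As the remaining variance vanishes, the smoothing disappears. *)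
Lemma smoothed_cvg w n : growing w -> mart (X m w) @[m --> \oo] --> L w ->
  smoothed g a c (X (n + m) w) @[m --> \oo] --> g (a * L w + c).
Proof.
move=> gw hw; have gK := smooth3_0 hg.
suff h : smoothed g a c (X m w) @[m --> \oo] --> g (a * L w + c).
  rewrite -(cvg_shiftn n (fun m => smoothed g a c (X m w))) in h.
  by under eq_fun do rewrite addnC.
have hr : Num.sqrt (a ^+ 2 * varrest (X m w)) @[m --> \oo] --> (0 : R).
  rewrite -[X in _ --> X]sqrtr0; apply: continuous_cvg; first exact: sqrt_continuous.
  rewrite -[X in _ --> X](mulr0 (a ^+ 2)); apply: cvgM; first exact: cvg_cst.
  exact: growing_varrest_cvg.
have hm : a * mart (X m w) + c - (a * L w + c) @[m --> \oo] --> (0 : R).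
  rewrite -[X in _ --> X](subrr (a * L w + c)); apply: cvgB; last exact: cvg_cst.
  by apply: cvgD; [apply: cvgM => //; exact: cvg_cst|exact: cvg_cst].
have e : g (a * L w + c) = heat 0 g (a * L w + c).
  by rewrite /heat sqrtr0; under eq_Rintegral do rewrite mul0r addr0; rewrite gauss_cst.
rewrite e; apply/subr_cvg0; apply: norm_cvg0.
pose c1 : R := \int[normal_prob 0 1]_z `|z|.
have z : K * (`|a * mart (X m w) + c - (a * L w + c)| +
    `|Num.sqrt (a ^+ 2 * varrest (X m w)) - Num.sqrt 0| * c1) @[m --> \oo] --> (0 : R).
  rewrite [X in _ --> X](_ : _ = K * (`|0 : R| + `|0 - Num.sqrt 0 : R| * c1)); last first.
    by rewrite sqrtr0 subrr !normr0 mul0r addr0 mulr0.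
  apply: cvgM; first exact: cvg_cst.
  apply: cvgD; first exact: cvg_norm.
  apply: cvgM; last exact: cvg_cst.
  by apply: cvg_norm; apply: cvgB; [exact: hr|exact: cvg_cst].
apply: (squeeze_cvgr _ (cvg_cst 0) z); near=> m.
rewrite normr_ge0/=; exact: heat_lip gK.
Unshelve. all: by end_near. Qed.

(** The mean of [smoothed] over the trees m steps later is given by
    [integral_atom_step] and stays within [lindeberg_bound] of its present value
    by [iter_step_smoothed]; dominated convergence lets m tend to infinity. *)
Lemma conditional_lindeberg n t : (1 <= n)%N -> history_path n t ->
  `|\int[P]_(w in atom X n t) g (a * L w + c) -
    fine (P (atom X n t)) * smoothed g a c (t n)| <=
  fine (P (atom X n t)) *
    lindeberg_bound K a (ext (t n)) (a ^+ 2 * varrest (t n)) (t n).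
Proof.
move=> n1 ht; have mA := measurable_atom hX n t.
set A := atom X n t in mA *.
have Pfin : P A \is a fin_num by exact: prob_atom_fin hX _ _.
have gt : grown n (t n) by apply: (history_path_grown ht); rewrite n1 leqnn.
have p0 : 0 < ext (t n) :> R by exact: ext_gt0 gt.
have cg := bdd_lip_continuous (smooth3_0 hg).
have K0 := bdd_lip_ge0 (smooth3_0 hg).
have mf m : measurable_fun A (fun w => (smoothed g a c (X (n + m) w))%:E).
  apply: measurable_funTS; apply/measurable_EFinP; apply: (measurable_treefun hX).
  by rewrite (leq_trans n1)// leq_addr.
have ci : P.-integrable A (EFin \o cst K).
  exact: (finite_measure_integrable_cst P).
have [] := @dominated_convergence _ _ _ P A mA
  (fun m w => (smoothed g a c (X (n + m) w))%:E) (fun w => (g (a * L w + c))%:E) (EFin \o cst K) mf.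
- apply: measurable_funTS; apply/measurable_EFinP; apply: measurableT_comp.
    exact: continuous_measurable_fun.
  by apply: measurable_funD => //; exact: measurable_funM.
- apply: filterS2 (ae_growing hX) hL => w gw hw _.
  apply: cvg_EFin; first exact: nearW.
  exact: smoothed_cvg.
- exact: ci.
- by apply: aeW => w m _; rewrite /= lee_fin ger0_norm ?smoothed_ge0// smoothed_le.
move=> fi _; rewrite -[X in _ --> X]fineK; last exact: integrable_fin_num.
move=> /fine_cvg h.
have e m : fine (\int[P]_(w in A) (smoothed g a c (X (n + m) w))%:E) =
    fine (P A) * iter m step (smoothed g a c) (t n).
  by rewrite (integral_atom_step hX m n1 ht (smoothed_ge0))// fineM.
have h' : fine (P A) * iter m step (smoothed g a c) (t n) @[m --> \oo] -->
    \int[P]_(w in A) g (a * L w + c).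
  by apply: cvg_trans h; apply: near_eq_cvg; apply: nearW => m; rewrite /= e.
have h2 : `|fine (P A) * iter m step (smoothed g a c) (t n) - fine (P A) * smoothed g a c (t n)|
    @[m --> \oo] --> `|\int[P]_(w in A) g (a * L w + c) - fine (P A) * smoothed g a c (t n)|.
  by apply: cvg_norm; apply: cvgB => //; exact: cvg_cst.
apply: (cvgr_to_le h2); apply: nearW => m.
have PA0 : 0 <= fine (P A) by rewrite fine_ge0// measure_ge0.
rewrite -mulrBr normrM (ger0_norm PA0) ler_wpM2l//.
exact: (iter_step_smoothed hg c a0 p0 m gt (conj (lexx _) (lexx _))).
Qed.

End ConditionalLindeberg.

(** * Limits along one path *)

Section PointwiseLimits.
Context {R : realType} (T : Type).
Variables (X : nat -> T -> {fset word}) (w : T).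
Hypothesis grownX : forall n, (1 <= n)%N -> grown n (X n w).
Variables (C : R) (C0 : 0 <= C).
Hypothesis martC : forall n, (1 <= n)%N -> `|mart (X n w)| <= C.
Hypothesis energyC : forall n, (1 <= n)%N -> energy (X n w) <= C.
Hypothesis growthC : forall n, (1 <= n)%N -> growthW R (X n w) <= C.
Variables (gamma : R) (hgamma : forall n, (1 <= n)%N -> 0 <= harm_ln n - gamma <= 2 / n%:R).

Definition norming (n : nat) : R := Num.sqrt (n%:R / (2 * ln n%:R)).

Let s n : R := Num.sqrt (ln n%:R)^-1.

Let extE n : (1 <= n)%N -> ext (X n w) = n.+1%:R :> R.
Proof. by move=> n1; rewrite /ext (card_external_grown (grownX n1)). Qed.

Lemma EPL_mean n : (1 <= n)%N -> (EPL (X n w))%:R = n.+1%:R * mean (X n w) :> R.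
Proof.
move=> n1; rewrite /mean /avg (extE n1) mulrA divff ?mul1r ?pnatr_eq0//.
by rewrite /EPL natr_sum.
Qed.

(** The offset comes from normalizing by n instead of n + 1 and from replacing the
    harmonic numbers by logarithms. *)
Lemma mart_EPL_scaled n : (1 <= n)%N ->
  `|mart (X n w) + 2 * gamma - EPL_scaled R X n w| <= (C + 12) / Num.sqrt n%:R.
Proof.
move=> n1; have n0 : 0 < n%:R :> R by rewrite ltr0n.
have r0 : 0 < Num.sqrt n%:R :> R by rewrite sqrtr_gt0.
have r2 : Num.sqrt n%:R ^+ 2 = n%:R :> R by rewrite sqr_sqrtr// ltW.
have -> : mart (X n w) + 2 * gamma - EPL_scaled R X n w =
    - 2 * (harm_ln n - gamma) - (mart (X n w) + 2 * harm n.+1) / n%:R.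
  rewrite /EPL_scaled (EPL_mean n1) /mart (card_external_grown (grownX n1)) /harm_ln.
  by rewrite -natr1; field; rewrite gt_eqF.
have /andP[h1 h2] := hgamma n1.
have hm := martC n1.
have hh := @harm_le_sqrt R n.+1.
have hs : Num.sqrt n.+1%:R <= 2 * Num.sqrt n%:R :> R.
  rewrite -[leRHS]ger0_norm; last by rewrite mulr_ge0// ltW.
  rewrite -sqrtr_sqr ler_sqrt ?sqr_ge0// exprMn r2 -natr1.
  have : 1 <= n%:R :> R by rewrite ler1n.
  by lra.
have hp : 0 <= harm n.+1 :> R by rewrite (le_trans _ (harm_ge1 _))//.
have r1 : 1 <= Num.sqrt n%:R :> R by rewrite -[leLHS]sqrtr1 ler_sqrt// ler1n.
have -> : (C + 12) / Num.sqrt n%:R = ((C + 12) * Num.sqrt n%:R) / n%:R.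
  rewrite -[X in _ = _ / X]r2; move: (Num.sqrt _) r0 => r r0.
  by field; rewrite gt_eqF.
apply: le_trans (ler_normB _ _) _.
have i0 : 0 <= n%:R^-1 :> R by rewrite invr_ge0 ltW.
rewrite normrM (ger0_norm h1) normrM (ger0_norm i0).
have -> : `|- 2 : R| = 2 by rewrite normrN ger0_norm.
apply: le_trans (_ : (4 + (C + 2 * harm n.+1)) / n%:R <= _).
  rewrite [leRHS]mulrDl lerD//.
    by rewrite (_ : 4 = 2 * 2) ?ler_pM2l//; [rewrite -mulrA ler_pM2l|ring].
  rewrite ler_pM2r ?invr_gt0//; apply: le_trans (ler_normD _ _) _.
  by rewrite lerD// ger0_norm// mulr_ge0.
rewrite ler_pM2r ?invr_gt0//.
have := mulr_ge0 C0 (ltW r0); have := ler_wpM2l C0 r1.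
lra.
Qed.

Lemma EPL_scaled_mart_cvg (l : R) :
  (mart (X n w) @[n --> \oo] --> l) <-> (EPL_scaled R X n w @[n --> \oo] --> l + 2 * gamma).
Proof.
have z : ((C + 12) / Num.sqrt n%:R) @[n --> \oo] --> (0 : R).
  rewrite -[X in _ --> X](mulr0 (C + 12)); apply: cvgM; first exact: cvg_cst.
  have h := @cvg_inv_sqrt R 0.
  rewrite -(cvg_shiftS (fun n => (Num.sqrt n%:R : R)^-1)).
  by under eq_fun do rewrite -[X in X.+1]addn0.
have e0 : mart (X n w) + 2 * gamma - EPL_scaled R X n w @[n --> \oo] --> (0 : R).
  apply: norm_cvg0; apply: (squeeze_cvgr _ (cvg_cst 0) z); near=> n.
  rewrite normr_ge0/=; apply: mart_EPL_scaled; near: n; exact: nbhs_infty_ge.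
split=> h.
  have h2 : mart (X n w) + 2 * gamma - (mart (X n w) + 2 * gamma - EPL_scaled R X n w)
      @[n --> \oo] --> l + 2 * gamma - 0.
    by apply: cvgB => //; apply: cvgD => //; exact: cvg_cst.
  rewrite subr0 in h2; apply: cvg_trans h2; apply: near_eq_cvg; near=> n.
  by ring.
have h2 : (mart (X n w) + 2 * gamma - EPL_scaled R X n w) + EPL_scaled R X n w - 2 * gamma
    @[n --> \oo] --> 0 + (l + 2 * gamma) - 2 * gamma.
  by apply: cvgB; [exact: cvgD|exact: cvg_cst].
rewrite add0r addrK in h2; apply: cvg_trans h2; apply: near_eq_cvg; near=> n.
by ring.
Unshelve. all: by end_near. Qed.

Let ln_pos : \forall n \near \oo, 0 < ln (n%:R : R).
Proof. by have /cvgryPgt/(_ 0) := @cvg_ln R; exact. Qed.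

Let s_cvg : s n @[n --> \oo] --> (0 : R).
Proof.
rewrite -[X in _ --> X]sqrtr0; apply: continuous_cvg; first exact: sqrt_continuous.
exact: cvg_inv_ln.
Qed.

(** The norming is the square root of n times a factor s n tending to 0; this
    factor makes the error terms vanish. *)
Lemma norming_le n : (1 <= n)%N -> 0 < ln (n%:R : R) -> norming n <= s n * Num.sqrt n%:R.
Proof.
move=> n1 l0; have n0 : 0 < n%:R :> R by rewrite ltr0n.
have i0 : 0 < (ln n%:R : R)^-1 by rewrite invr_gt0.
rewrite /norming /s -sqrtrM ?(ltW i0)//; apply: ler_wsqrtr.
rewrite (_ : n%:R / (2 * ln n%:R) = (ln n%:R)^-1 * n%:R / 2); last by field; rewrite gt_eqF.
by have := mulr_gt0 i0 n0; lra.
Qed.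

Lemma variance_cvg : norming n ^+ 2 * varrest (X n w) @[n --> \oo] --> (1 : R).
Proof.
apply: cvg_trans (@cvg_variance R); apply: near_eq_cvg; near=> n.
have l0 : 0 < ln (n%:R : R) by near: n; exact: ln_pos.
have n1 : (1 <= n)%N by near: n; exact: nbhs_infty_ge.
rewrite /norming sqr_sqrtr; last by rewrite divr_ge0// mulr_ge0// ltW.
by rewrite /varrest (extE n1) (card_external_grown (grownX n1)).
Unshelve. all: by end_near. Qed.

Lemma offset_cvg :
  norming n * (mart (X n w) + 2 * gamma - EPL_scaled R X n w) @[n --> \oo] --> (0 : R).
Proof.
have z : (s n * (C + 12)) @[n --> \oo] --> (0 : R).
  by rewrite -[X in _ --> X](mul0r (C + 12)); apply: cvgM; [exact: s_cvg|exact: cvg_cst].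
apply: norm_cvg0; apply: (squeeze_cvgr _ (cvg_cst 0) z); near=> n.
have l0 : 0 < ln (n%:R : R) by near: n; exact: ln_pos.
have n1 : (1 <= n)%N by near: n; exact: nbhs_infty_ge.
have r0 : 0 < Num.sqrt n%:R :> R by rewrite sqrtr_gt0 ltr0n.
rewrite normr_ge0/= normrM ger0_norm ?sqrtr_ge0//.
have a0 : 0 <= norming n by exact: sqrtr_ge0.
apply: le_trans (ler_pM a0 (normr_ge0 _) (norming_le n1 l0) (mart_EPL_scaled n1)) _.
rewrite le_eqVlt; apply/orP; left; apply/eqP.
by move: r0; move: (Num.sqrt n%:R) => r r0; field; rewrite gt_eqF.
Unshelve. all: by end_near. Qed.

(** With a the norming and p = n + 1, the ratio a / sqrt p is at most (log
    n)^(-1/2). The first term is its square times [energy], the second its cube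
    times [growthW], and the last contains the square root of rho / p with rho
    tending to 1. *)
Lemma lindeberg_bound_cvg (K : R) : 0 <= K ->
  lindeberg_bound K (norming n) (ext (X n w)) (norming n ^+ 2 * varrest (X n w)) (X n w)
    @[n --> \oo] --> (0 : R).
Proof.
move=> K0.
pose rho n : R := norming n ^+ 2 * varrest (X n w).
have z : K * (s n ^+ 2 * C + 18 * @cW R * (s n ^+ 3 * C)
     + gauss_abs3 * Num.sqrt (rho n * n.+1%:R^-1) * rho n) @[n --> \oo] --> (0 : R).
  rewrite [X in _ --> X](_ : _ = K * (0 ^+ 2 * C + 18 * @cW R * (0 ^+ 3 * C)
     + gauss_abs3 * Num.sqrt (1 * 0) * 1)); last first.
    rewrite mulr0 sqrtr0 !expr0n/= !mul0r.
    by rewrite !(mulr0, mul0r, addr0).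
  apply: cvgM; first exact: cvg_cst.
  have s2 k : s n ^+ k.+1 @[n --> \oo] --> (0 ^+ k.+1 : R).
    apply: (cvg_comp s (fun x => x ^+ k.+1) s_cvg); exact: exprn_continuous.
  apply: cvgD; first apply: cvgD.
  - by apply: cvgM; [exact: s2|exact: cvg_cst].
  - apply: cvgM; first exact: cvg_cst.
    by apply: cvgM; [exact: s2|exact: cvg_cst].
  - apply: cvgM; last exact: variance_cvg.
    apply: cvgM; first exact: cvg_cst.
    apply: continuous_cvg; first exact: sqrt_continuous.
    by apply: cvgM; [exact: variance_cvg|exact: cvg_harmonic].
apply: norm_cvg0; apply: (squeeze_cvgr _ (cvg_cst 0) z); near=> n.
have l0 : 0 < ln (n%:R : R) by near: n; exact: ln_pos.
have n1 : (1 <= n)%N by near: n; exact: nbhs_infty_ge.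
have gt := grownX n1.
have p0 : 0 < n.+1%:R :> R by rewrite ltr0n.
have a0 : 0 <= norming n by exact: sqrtr_ge0.
have s0 : 0 <= s n by exact: sqrtr_ge0.
have pr0 : 0 < Num.sqrt n.+1%:R :> R by rewrite sqrtr_gt0.
have pr2 : Num.sqrt n.+1%:R ^+ 2 = n.+1%:R :> R by rewrite sqr_sqrtr// ltW.
have u0 : 0 <= norming n / Num.sqrt n.+1%:R by rewrite divr_ge0// ltW.
have us : norming n / Num.sqrt n.+1%:R <= s n.
  rewrite ler_pdivrMr//; apply: le_trans (norming_le n1 l0) _.
  by rewrite ler_wpM2l// ler_sqrt ?ltr0n// ler_nat.
have v0 : 0 <= varrest (X n w) :> R.
  by have [v ve] := grown_external gt; have [] := @varrest_bounds R _ _ _ gt ve.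
have W0 := @growthW_ge0 R (X n w).
have e0 := le_trans (ler0n R 2) (energy_ge2 (X n w)).
have t1 : norming n ^+ 2 * (energy (X n w) / n.+1%:R) <= s n ^+ 2 * C.
  rewrite -pr2 mulrCA -expr_div_n mulrC; apply: ler_pM => //; first exact: sqr_ge0.
    by rewrite lerXn2r ?nnegrE.
  exact: energyC.
have t2 : norming n ^+ 3 / n.+1%:R * decayW (X n w) <= s n ^+ 3 * C.
  rewrite (decayW_growthW R gt) (extE n1).
  have -> : norming n ^+ 3 / n.+1%:R * (growthW R (X n w) / Num.sqrt n.+1%:R) =
     (norming n / Num.sqrt n.+1%:R) ^+ 3 * growthW R (X n w).
    by rewrite -{1}pr2; field; rewrite gt_eqF.
  apply: ler_pM => //; first exact: exprn_ge0.
    by rewrite lerXn2r ?nnegrE.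
  exact: growthC.
have c0 := @cW_ge0 R.
have d0 := @decayW_ge0 R (X n w).
have g0 := @gauss_abs3_ge0 R.
have rho0 : 0 <= rho n by rewrite mulr_ge0 ?sqr_ge0.
rewrite normr_ge0/= /lindeberg_bound (extE n1) -/(rho n).
rewrite ger0_norm; last first.
  apply: mulr_ge0 => //; apply: addr_ge0; first apply: addr_ge0.
  - by apply: mulr_ge0; [exact: sqr_ge0|apply: divr_ge0 => //; exact: ltW].
  - apply: mulr_ge0 => //; apply: divr_ge0; last exact: ltW.
    by apply: mulr_ge0; [apply: mulr_ge0|exact: exprn_ge0].
  - by apply: mulr_ge0 => //; apply: mulr_ge0 => //; exact: sqrtr_ge0.
apply: ler_wpM2l => //; apply: lerD => //; apply: lerD => //.
rewrite (_ : 18 * cW * norming n ^+ 3 / n.+1%:R * decayW (X n w) =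
  18 * cW * (norming n ^+ 3 / n.+1%:R * decayW (X n w))); last by ring.
by apply: ler_wpM2l => //; apply: mulr_ge0.
Unshelve. all: by end_near. Qed.

(** The scaled remaining variance tends to 1 and the evaluation point to 0. *)
Lemma heat_norming_cvg K (g : R -> R) : bdd_lip K g ->
  heat (norming n ^+ 2 * varrest (X n w)) g
    (norming n * (mart (X n w) + 2 * gamma - EPL_scaled R X n w)) @[n --> \oo] -->
  \int[normal_prob 0 1]_z g z.
Proof.
move=> gK.
have -> : \int[normal_prob 0 1]_z g z = heat 1 g 0.
  by rewrite /heat sqrtr1; apply: eq_Rintegral => z _; rewrite add0r mul1r.
pose c1 : R := \int[normal_prob 0 1]_z `|z|.
pose rho n : R := norming n ^+ 2 * varrest (X n w).
pose del n : R := norming n * (mart (X n w) + 2 * gamma - EPL_scaled R X n w).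
have z : K * (`|del n - 0| + `|Num.sqrt (rho n) - Num.sqrt 1| * c1) @[n --> \oo] --> (0 : R).
  rewrite [X in _ --> X](_ : _ = K * (`|0 - 0 : R| + `|Num.sqrt 1 - Num.sqrt 1 : R| * c1)); last first.
    by rewrite !subrr !normr0 mul0r addr0 mulr0.
  apply: cvgM; first exact: cvg_cst.
  apply: cvgD.
    by apply: cvg_norm; apply: cvgB; [exact: offset_cvg|exact: cvg_cst].
  apply: cvgM; last exact: cvg_cst.
  apply: cvg_norm; apply: cvgB; last exact: cvg_cst.
  by apply: continuous_cvg; [exact: sqrt_continuous|exact: variance_cvg].
apply/subr_cvg0; apply: norm_cvg0; apply: (squeeze_cvgr _ (cvg_cst 0) z).
by apply: nearW => n; rewrite normr_ge0/=; exact: heat_lip gK.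
Qed.

End PointwiseLimits.

(** * The central limit theorem *)

Section PathwiseBounds.
Context d (T : measurableType d) (R : realType) (P : probability T R).
Variables (X : nat -> T -> {fset word}) (hX : is_rbst P X).

Definition tame (w : T) := exists2 C : R, 0 <= C & forall n, (1 <= n)%N ->
  [/\ `|mart (X n w)| <= C, energy (X n w) <= C & growthW R (X n w) <= C].

Lemma energy_ge0 t : 0 <= energy t :> R.
Proof. by have := @energy_ge2 R t; lra. Qed.

Lemma ae_tame : {ae P, forall w, tame w}.
Proof.
have h1 := ae_super_bounded hX energy_ge0 (@step_energy R).
have h2 := ae_super_bounded hX (growthW_ge0 R) (@step_growthW R).
apply: filterS2 h1 h2 => w [C1 hC1] [C2 hC2].
have C10 : 0 <= C1 by exact: le_trans (energy_ge0 _) (hC1 1%N (leqnn 1)).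
have C20 : 0 <= C2 by exact: le_trans (growthW_ge0 _ _) (hC2 1%N (leqnn 1)).
exists (2 * C1 + C2) => [|n n1]; first by lra.
have := hC1 n n1; have := hC2 n n1; have := @energy_abs R (X n w).
by have := normr_ge0 (@spread R (X n w)) => ? ? ? ?; split; lra.
Qed.

Lemma measurable_EPL_scaled n : (1 <= n)%N -> measurable_fun setT (EPL_scaled R X n).
Proof.
move=> n1.
exact: (measurable_treefun hX (fun t => ((EPL t)%:R - 2 * n%:R * ln n%:R) / n%:R) n1).
Qed.

Lemma ae_EPL_scaled_mart (gamma : R) :
  (forall n, (1 <= n)%N -> 0 <= harm_ln n - gamma <= 2 / n%:R) ->
  {ae P, forall w, forall l : R, mart (X n w) @[n --> \oo] --> l <->
     EPL_scaled R X n w @[n --> \oo] --> l + 2 * gamma}.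
Proof.
move=> hg; apply: filterS2 (ae_growing hX) ae_tame => w gw [C C0 hC] l.
have {}gw : growing X w := gw.
have grownX n : (1 <= n)%N -> grown n (X n w) by exact: (growing_grown hX gw).
have martC n (n1 : (1 <= n)%N) : `|mart (X n w)| <= C by have [] := hC n n1.
exact: (EPL_scaled_mart_cvg grownX C0 martC hg).
Qed.

(** The upper limit provides a measurable version of the almost sure limit of the
    martingale, shifted by 2 gamma. *)
Lemma EPL_limit_exists : exists EPLoo : {RV P >-> R},
  {ae P, forall w, EPL_scaled R X n w @[n --> \oo] --> EPLoo w}.
Proof.
have [gamma hg] := @harm_ln_limit R.
pose f w : R := fine (limn_esup (fun n => (EPL_scaled R X n.+1 w)%:E)).
have mf : measurable_fun setT f.
  apply: measurableT_comp => //; apply: measurable_fun_limn_esup => n.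
  by apply/measurable_EFinP; exact: measurable_EPL_scaled.
pose F : {RV P >-> R} := HB.pack f (isMeasurableFun.Build _ _ _ _ f mf).
exists F; apply: filterS2 (ae_mart_cvg hX) (ae_EPL_scaled_mart hg) => w /cvg_ex[l hl] hw.
have h := (hw l).1 hl.
rewrite (_ : F w = l + 2 * gamma)//.
have hE : (EPL_scaled R X n.+1 w)%:E @[n --> \oo] --> (l + 2 * gamma)%:E.
  apply: cvg_EFin; first exact: nearW.
  by rewrite (cvg_shiftS (fun n => EPL_scaled R X n w)).
rewrite /F/= /f is_cvg_limn_esupE; last by apply/cvg_ex; eexists; exact: hE.
by rewrite (cvg_lim _ hE).
Qed.

End PathwiseBounds.

Theorem mainTheorem3 (d : measure_display) (T : measurableType d)
    (R : realType) (P : probability T R) (X : nat -> T -> {fset word})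
    (hX : is_rbst P X) :
  (exists EPLoo : {RV P >-> R},
    {ae P, forall w, EPL_scaled R X n w @[n --> \oo] --> EPLoo w}) /\
  (forall EPLoo : {RV P >-> R},
    {ae P, forall w, EPL_scaled R X n w @[n --> \oo] --> EPLoo w} ->
    forall kappa : forall n : nat,
        R.-pker (g_sigma_algebraType (history X n)) ~> measurableTypeR R,
      (forall n : nat, (2 <= n)%N ->
        is_regular_cond_distr P
          (fun w => Num.sqrt (n%:R / (2 * ln n%:R)) *
                    (EPLoo w - EPL_scaled R X n w))
          (kappa n)) ->
      {ae P, forall w, weak_cvg (fun n => kappa n w) (normal_prob (0 : R) 1)}).
Proof.
split; first exact: EPL_limit_exists hX.
move=> EPLoo hEPL kappa hk.
have [gamma hg] := @harm_ln_limit R.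
pose L w : R := EPLoo w - 2 * gamma.
have mL : measurable_fun setT L by apply: measurable_funB => //; exact: measurable_funP.
have hL : {ae P, forall w, mart (X n w) @[n --> \oo] --> L w}.
  apply: filterS2 hEPL (ae_EPL_scaled_mart hX hg) => w hw /(_ (L w)) h.
  by apply/h; rewrite /L subrK.
apply: filterS2 (ae_growing hX) (ae_tame hX) => w gw [C C0 hC].
have {}gw : growing X w := gw.
have grownX n : (1 <= n)%N -> grown n (X n w) by exact: (growing_grown hX gw).
have martC n (n1 : (1 <= n)%N) : `|mart (X n w)| <= C by have [] := hC n n1.
have energyC n (n1 : (1 <= n)%N) : energy (X n w) <= C by have [] := hC n n1.
have growthC n (n1 : (1 <= n)%N) : growthW R (X n w) <= C by have [] := hC n n1.
apply: weak_cvg_smooth => [n||K g g1 g2 g3 g0].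
- exact: prob_kernel.
- exact: probability_setT.
have gK := smooth3_0 g3; have K0 := bdd_lip_ge0 gK.
have cg := bdd_lip_continuous gK.
pose H n := heat (norming n ^+ 2 * varrest (X n w)) g
    (norming n * (mart (X n w) + 2 * gamma - EPL_scaled R X n w)).
have hH : H n @[n --> \oo] --> \int[normal_prob 0 1]_z g z.
  exact: (heat_norming_cvg grownX C0 martC hg gK).
have hB := lindeberg_bound_cvg grownX energyC growthC K0.
(* It remains to compare the conditional law at time n with the normal law H n. *)
suff est n : (2 <= n)%N -> `|\int[kappa n w]_x g x - H n| <=
    lindeberg_bound K (norming n) (ext (X n w)) (norming n ^+ 2 * varrest (X n w)) (X n w).
  have hd : \int[kappa n w]_x g x - H n @[n --> \oo] --> (0 : R).
    apply: norm_cvg0; apply: (squeeze_cvgr _ (cvg_cst 0) hB); near=> n.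
    by rewrite normr_ge0/= est//; near: n; exact: nbhs_infty_ge.
  have h2 : \int[kappa n w]_x g x - H n + H n @[n --> \oo] --> 0 + \int[normal_prob 0 1]_z g z.
    exact: cvgD.
  rewrite add0r in h2; apply: cvg_trans h2; apply: near_eq_cvg; near=> n.
  by rewrite subrK.
move=> n2; have n1 : (1 <= n)%N by exact: ltnW.
have ht := growing_path hX n gw.
have tw : atom X n (X ^~ w) w by [].
pose c := norming n * (2 * gamma - EPL_scaled R X n w).
have P0 : 0 < fine (P (atom X n (X ^~ w))).
  by rewrite fine_gt0// prob_atom_gt0//= ltey_eq prob_atom_fin.
have mZ : measurable_fun setT (fun w => Num.sqrt (n%:R / (2 * ln n%:R)) * (EPLoo w - EPL_scaled R X n w)).
  apply: measurable_funM => //; apply: measurable_funB; first exact: measurable_funP.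
  exact: (measurable_EPL_scaled hX n1).
have mg : measurable_fun setT g by exact: continuous_measurable_fun.
have := regular_cond_integral hX mZ (hk n n2) mg g0 tw.
move/(congr1 fine); rewrite fineM; last 2 first.
- exact: prob_atom_fin hX _ _.
- have k1 : kappa n w setT = 1%E by exact: prob_kernel.
  apply: integrable_fin_num => //; apply: (bounded_integrable k1 cg); exact: (proj1 gK).
(* On the history of w the observed path length is constant, so the rescaled
   variable is an affine function of the limit L of the martingale. *)
have -> : fine (\int[P]_(x in atom X n (X ^~ w))
     (g (Num.sqrt (n%:R / (2 * ln n%:R)) * (EPLoo x - EPL_scaled R X n x)))%:E) =
   \int[P]_(x in atom X n (X ^~ w)) g (norming n * L x + c).
  apply: eq_Rintegral => x; rewrite inE => xA; congr g.
  have -> : EPL_scaled R X n x = EPL_scaled R X n w.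
    by rewrite /EPL_scaled (xA n)// n1 leqnn.
  by rewrite -/(norming n) /L /c; ring.
have := conditional_lindeberg hX mL hL g3 g0 c (sqrtr_ge0 _ : 0 <= norming n) n1 ht.
move=> + e; rewrite -e -mulrBr normrM (ger0_norm (ltW P0)) ler_pM2l//.
rewrite /smoothed /H.
have -> // : norming n * (mart (X n w) + 2 * gamma - EPL_scaled R X n w) = norming n * mart (X n w) + c.
by rewrite /c; ring.
Unshelve. all: by end_near. Qed.
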